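(* Let $\mathcal N=\{z\in\mathbb Z^d:|z|=1\}$ and let $\omega>0$. Suppose that the probability measure $\mathbb P$ on $\Omega$ is stationary and ergodic with respect to the action $(\tau_g)_{g\in\mathbb Z^d}$ of the group $\mathbb Z^d$ and that $L^2(\mathbb P)$ is separable. In addition, suppose that the (strictly positive, symmetric) nearest-neighbour conductance field satisfies the covariant relation $c_{x+z,y+z}(\xi)=c_{x,y}(\tau_z\xi)$ and that $\mathbb E[c_{0,z}^2]<+\infty$ for all $z\in\mathcal N$. Then for $\mathbb P$-a.a. $\xi\in\Omega$ it holds $$\lim_{N\to+\infty}\sigma_N^\xi(\omega)=\sigma(\omega),$$ where $\sigma_N^\xi(\omega)$ is the complex mobility matrix of the random walk on the discrete torus $\mathbb T^d_N$ with $N$-periodized conductances, and the symmetric $d\times d$ complex matrix $\sigma(\omega)$ is defined as follows. Let $c,\gamma:\Omega\to\mathbb R^d$ be $$c(\xi):=\sum_{j=1}^d[c_{0,e_j}(\xi)+c_{0,-e_j}(\xi)]e_j,\qquad \gamma(\xi):=\sum_{j=1}^d[c_{0,e_j}(\xi)-c_{0,-e_j}(\xi)]e_j=\sum_{z\in\mathcal N}c_{0,z}(\xi)z .$$ Then, for $j,k\in\{1,\dots,d\}$, $$\sigma(\omega)_{j,k}=\mathbb E[c_j]\delta_{j,k}-2\langle\gamma_j,(i\omega-\mathbb L)^{-1}\gamma_k\rangle_{L^2(\mathbb P)}=\mathbb E[c_j]\delta_{j,k}-2\int_0^{+\infty}\langle\gamma_j,e^{-(i\omega-\mathbb L)s}\gamma_k\rangle_{L^2(\mathbb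 P)}\,ds,$$ where $\mathbb L$ is the self-adjoint operator associated with the environment Dirichlet form (see context), extended to complex functions.
   Context: **Environment.** $(\Omega,\mathcal F,\mathbb P)$ is a probability space with expectation $\mathbb E$. The group $\mathbb Z^d$ acts on $\Omega$ by measurable maps $\tau_g:\Omega\to\Omega$, with $\tau_0=\mathrm{id}$ and $\tau_g\circ\tau_{g'}=\tau_{g+g'}$. Stationarity: $\mathbb P(\tau_gA)=\mathbb P(A)$ for all $A\in\mathcal F$, $g\in\mathbb Z^d$. Ergodicity: $\mathbb P(A)\in\{0,1\}$ whenever $A\in\mathcal F$ satisfies $\tau_gA=A$ for all $g$. To each $\xi\in\Omega$ and each pair $x,x+z$ with $x\in\mathbb Z^d$, $z\in\mathcal N$, is associated a conductance $c_{x,x+z}(\xi)>0$ (measurable in $\xi$), with $c_{x,x+z}(\xi)=c_{x+z,x}(\xi)$. $e_1,\dots,e_d$ is the canonical basis of $\mathbb R^d$. **Scalar products.** $L^2(\mu)$ is the complex Hilbert space with $\langle f,g\rangle_{L^2(\mu)}=\int\overline f g\,d\mu$; $L^2_R(\mu)$ is its subset of real functions. An operator $A$ on $L^2_R(\mu)$ is extended to complex functions by $A(f+ig)=Af+iAg$ for $f,g\in\mathcal D(A)$. **Periodization.** For $N\in\mathbb N_+$, $c^{(N)}_{x,x+e_j}(\xi)=c_{x,x+e_j}(\xi)$ for $x\in[0,N)^d\cap\mathbb Z^d$, $j=1,\dots,d$, extended to $x\in\mathbb Z^d$ by $N\mathbb Z^d$-periodicity and symmetrically ($c^{(N)}_{x+e_j,x}=c^{(N)}_{x,x+e_j}$).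 $\mathbb T^d_N=\mathbb Z^d/N\mathbb Z^d$ and the $c^{(N)}$ are viewed as conductances on neighbouring pairs of $\mathbb T^d_N$ (unambiguous for $N\ge3$; only large $N$ matters). For $x\in\mathbb T^d_N$, $z\in\mathbb Z^d$, $x+z$ means $x+\pi_N(z)$, with $\pi_N:\mathbb Z^d\to\mathbb T^d_N$ the projection. $\mathfrak m_N$ is the uniform probability measure on $\mathbb T^d_N$. **Complex mobility matrix.** For $v\in\mathbb R^d\setminus\{0\}$, $\lambda>0$, let $X^{\xi,N,\lambda}$ be the continuous-time random walk on $\mathbb T^d_N$ jumping at time $t$ from $x$ to $x+z$ ($z\in\mathcal N$) with rate $c^{(N)}_{x,x+z}(\xi)\exp\{\lambda\cos(\omega t)z\cdot v\}$. With $T=2\pi/\omega$, the chain $(X^{\xi,N,\lambda}_{nT})_{n\ge0}$ has a unique invariant distribution; the law of the walk started from it is the oscillatory steady state (OSS). The mean instantaneous velocity is $V^{\xi,N,\lambda}(t)=\sum_{x\in\mathbb T^d_N}\sum_{z\in\mathcal N}P^{OSS}(X_t^{\xi,N,\lambda}=x)\,c^{(N)}_{x,x+z}(\xi)e^{\lambda\cos(\omega t)z\cdot v}z$. The complex mobility matrix $\sigma^\xi_N(\omega)$ is the unique $d\times d$ complex matrix with $\partial_{\lambda=0}V^{\xi,N,\lambda}(t)=\Re(e^{i\omega t}\sigma_N^\xi(\omega)v)$ for all $v\in\mathbb R^d$, $t\ge0$. It is a known fact (which may equivalently be taken as definition) that $$\sigma^\xi_N(\omega)_{j,k}=\mathfrak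 m_N[c^\xi_{N,j}]\delta_{j,k}-2\langle\gamma^\xi_{N,j},(i\omega-\mathcal L^\xi_N)^{-1}\gamma^\xi_{N,k}\rangle_{L^2(\mathfrak m_N)},$$ where $\mathcal L_N^\xi f(x)=\sum_{z\in\mathcal N}c^{(N)}_{x,x+z}(\xi)(f(x+z)-f(x))$, $c^\xi_{N,j}(x)=c^{(N)}_{x,x+e_j}(\xi)+c^{(N)}_{x,x-e_j}(\xi)$, and $\gamma^\xi_{N,j}(x)=c^{(N)}_{x,x+e_j}(\xi)-c^{(N)}_{x,x-e_j}(\xi)$. **Operator $\mathbb L$.** Let $\mathcal E(f,g)=\frac12\sum_{z\in\mathcal N}\mathbb E[c_{0,z}(\xi)(f(\tau_z\xi)-f(\xi))(g(\tau_z\xi)-g(\xi))]$ with domain $\mathcal D(\mathcal E)=\{f\in L^2_R(\mathbb P):\sum_{z\in\mathcal N}\mathbb E[c_{0,z}(\xi)(f(\tau_z\xi)-f(\xi))^2]<+\infty\}$. $\mathbb L$ is the unique negative semidefinite self-adjoint operator on $L^2_R(\mathbb P)$ with $\mathcal D(\mathcal E)=\mathcal D(\sqrt{-\mathbb L})$ and $\|\sqrt{-\mathbb L}f\|^2_{L^2(\mathbb P)}=\mathcal E(f,f)$ for $f\in\mathcal D(\mathcal E)$. By spectral calculus $i\omega-\mathbb L$ has a bounded inverse on $L^2(\mathbb P)$. Integrals $\int_0^{+\infty}\cdots ds$ involving $\mathbb L$ are understood as $\lim_{S\to+\infty}\int_0^S\cdots ds$. *)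

(* Defs.v *)
From HB Require Import structures.
From mathcomp Require Import all_boot all_order all_algebra.
From mathcomp Require Import all_classical all_reals all_analysis.
From mathcomp Require Export complex.

Set Implicit Arguments.
Unset Strict Implicit.
Unset Printing Implicit Defensive.

Import Order.TTheory GRing.Theory Num.Theory.
Import numFieldNormedType.Exports.

Local Open Scope classical_set_scope.
Local Open Scope ring_scope.
Local Open Scope complex_scope.

Local Notation Re := (@complex.Re _).
Local Notation Im := (@complex.Im _).

Definition unitv {d : nat} (j : 'I_d) : 'rV[int]_d := delta_mx 0 j.

(* |z| is the Euclidean norm; since z has integer entries, |z| = 1 iff
   |z|^2 = 1. *)
Definition nbr (d : nat) : set 'rV[int]_d :=
  [set z | \sum_(j < d) z 0 j ^+ 2 = 1].
Arguments nbr d : clear implicits.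

Section Environment.
Context {disp : measure_display} {Omega : measurableType disp} {R : realType}.
Context {d : nat}.
Implicit Types (P : probability Omega R) (tau : 'rV[int]_d -> Omega -> Omega).

Definition is_action tau :=
  [/\ forall g, measurable_fun [set: Omega] (tau g),
      tau 0 = id &
      forall g g', tau g \o tau g' = tau (g + g')].

Definition stationary P tau :=
  forall g A, measurable A -> P (tau g @` A) = P A.

Definition ergodic P tau :=
  forall A, measurable A -> (forall g, tau g @` A = A) ->
  P A = 0%E \/ P A = 1%E.

(* [c x y xi] is the conductance c_{x,y}(xi); only its values on nearest
   neighbour pairs matter. *)
Definition is_conductance (c : 'rV[int]_d -> 'rV[int]_d -> Omega -> R) :=
  forall x z, nbr d z ->
  [/\ measurable_fun [set: Omega] (c x (x + z)),
      forall xi, 0 < c x (x + z) xi &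
      forall xi, c x (x + z) xi = c (x + z) x xi].

Definition covariant tau (c : 'rV[int]_d -> 'rV[int]_d -> Omega -> R) :=
  forall x y z xi, nbr d (y - x) -> c (x + z) (y + z) xi = c x y (tau z xi).

End Environment.

Section ComplexL2.
Context {disp : measure_display} {Omega : measurableType disp} {R : realType}.
Implicit Types (mu : {measure set Omega -> \bar R}) (f g h : Omega -> R[i]).

Definition Cintegral mu (D : set Omega) f : R[i] :=
  (\int[mu]_(x in D) Re (f x)) +i* (\int[mu]_(x in D) Im (f x)).

Definition CL2 mu : set (Omega -> R[i]) :=
  [set f : Omega -> R[i] | (Re \o f) \in Lfun mu 2%:E /\
           (Im \o f) \in Lfun mu 2%:E].

Definition Cinner mu f g : R[i] :=
  Cintegral mu setT (fun x => (f x)^* * g x).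

Definition CL2norm mu f : R :=
  Num.sqrt (\int[mu]_x (Re (f x) ^+ 2 + Im (f x) ^+ 2)).

Definition CL2_separable mu :=
  exists u : nat -> Omega -> R[i], (forall n, CL2 mu (u n)) /\
  forall f (e : R), CL2 mu f -> 0 < e ->
    exists n, CL2norm mu (fun x => f x - u n x) < e.

End ComplexL2.

(* A (possibly unbounded) operator A is represented by its graph: [A f g] means
   that f is in the domain of A and A f = g. *)
Definition operator_domain {V : Type} (A : V -> V -> Prop) : set V :=
  [set f | exists g, A f g].

(* The preimage of g under A, with value h0 when there is none. *)
Definition operator_inv {V : choiceType} (h0 : V) (A : V -> V -> Prop) (g : V)
  : V := xget h0 [set h | A h g].

Section RealOperators.
Context {disp : measure_display} {Omega : measurableType disp} {R : realType}.
Variable mu : {measure set Omega -> \bar R}.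
Implicit Types (f g h u v : Omega -> R) (A B : (Omega -> R) -> (Omega -> R) -> Prop).

Definition inner f g : R := \int[mu]_x (f x * g x).

Definition L2dense (D : set (Omega -> R)) :=
  forall f (e : R), f \in Lfun mu 2%:E -> 0 < e ->
  exists2 g, D g & Num.sqrt (inner (f \- g) (f \- g)) < e.

(* The domain is dense and A is equal to its adjoint
   {(u, v) | <A f, u> = <f, v> for all f in the domain of A}. Such a graph is
   linear, stable under a.e. equality, and single-valued up to a.e. equality. *)
Definition selfadjoint A :=
  [/\ forall f g, A f g -> f \in Lfun mu 2%:E /\ g \in Lfun mu 2%:E,
      L2dense (operator_domain A) &
      forall u v, u \in Lfun mu 2%:E -> v \in Lfun mu 2%:E ->
        (A u v <-> forall f g, A f g -> inner g u = inner f v)].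

Definition negative_semidefinite A := forall f g, A f g -> inner f g <= 0.

Definition positive_semidefinite A := forall f g, A f g -> 0 <= inner f g.

(* B = sqrt (- A): B is positive semidefinite and self-adjoint, and B o B = - A,
   with equality of the domains. *)
Definition is_sqrt_opp A B :=
  [/\ selfadjoint B, positive_semidefinite B &
      forall f h, A f h <-> exists2 g, B f g & B g (\- h)].

End RealOperators.

Section DirichletForm.
Context {disp : measure_display} {Omega : measurableType disp} {R : realType}.
Context {d : nat}.
Variables (P : probability Omega R) (tau : 'rV[int]_d -> Omega -> Omega).
Variable c : 'rV[int]_d -> 'rV[int]_d -> Omega -> R.
Local Open Scope ereal_scope.

Definition dirichlet_form (f g : Omega -> R) : \bar R :=
  2^-1%:E * \sum_(z \in nbr d)
    'E_P[fun xi => (c 0 z xi * (f (tau z xi) - f xi) * (g (tau z xi) - g xi))%R].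

Definition dirichlet_domain : set (Omega -> R) :=
  [set f : Omega -> R | f \in Lfun P 2%:E /\
    \sum_(z \in nbr d)
      'E_P[fun xi => (c 0 z xi * (f (tau z xi) - f xi) ^+ 2)%R] < +oo].

(* The characterization determines L uniquely: the domain of B = sqrt(- L) is
   that of the form E, and |B f|^2 = E(f, f). *)
Definition is_dirichlet_operator (L : (Omega -> R) -> (Omega -> R) -> Prop) :=
  [/\ selfadjoint P L, negative_semidefinite P L &
      exists B, [/\ is_sqrt_opp P L B,
        operator_domain B = dirichlet_domain &
        forall f g, B f g -> (inner P g g)%:E = dirichlet_form f f]].

End DirichletForm.

Section ComplexOperators.
Context {disp : measure_display} {Omega : measurableType disp} {R : realType}.
Variable mu : {measure set Omega -> \bar R}.
Implicit Types (f g h : Omega -> R[i]) (A : (Omega -> R[i]) -> (Omega -> R[i]) -> Prop).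

(* L (f + i g) = L f + i L g. *)
Definition complexify (L : (Omega -> R) -> (Omega -> R) -> Prop) f g :=
  L (Re \o f) (Re \o g) /\ L (Im \o f) (Im \o g).

(* The operator z - A. *)
Definition operator_shift (z : R[i]) A h g :=
  exists2 w, A h w & {ae mu, forall x, g x = z * h x - w x}.

Definition operator_opp A f g := A f (fun x => - g x).

(* (T_s)_{s >= 0} is the strongly continuous semigroup on L^2(mu) generated by
   A, that is, T_s = e^{s A}: the two blocks say that each T_s is a bounded
   linear operator, and that T is a C_0-semigroup with generator A. *)
Definition is_semigroup_generated_by A (T : R -> (Omega -> R[i]) -> Omega -> R[i]) :=
  [/\ forall s f, 0 <= s -> CL2 mu f -> CL2 mu (T s f),
      forall s (a : R[i]) f g, 0 <= s -> CL2 mu f -> CL2 mu g ->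
        {ae mu, forall x, T s (fun y => a * f y + g y) x = a * T s f x + T s g x}
      & forall s, 0 <= s -> exists M : R, forall f, CL2 mu f ->
        CL2norm mu (T s f) <= M * CL2norm mu f] /\
  [/\ forall f, CL2 mu f -> {ae mu, forall x, T 0 f x = f x},
      forall s t f, 0 <= s -> 0 <= t -> CL2 mu f ->
        {ae mu, forall x, T (s + t) f x = T s (T t f) x},
      forall f, CL2 mu f ->
        CL2norm mu (fun x => T s f x - f x) @[s --> (0 : R)^'+] --> (0 : R) &
      forall f g, CL2 mu f -> CL2 mu g ->
        (A f g <->
         CL2norm mu (fun x => (s^-1)%:C * (T s f x - f x) - g x)
           @[s --> (0 : R)^'+] --> (0 : R))].

End ComplexOperators.

Section Torus.
Context {Omega : Type} {R : realType} {d : nat}.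
Variable c : 'rV[int]_d -> 'rV[int]_d -> Omega -> R.
Variable (N : nat) (xi : Omega).

Definition representative (x : 'rV[int]_d) : 'rV[int]_d :=
  \row_j modz (x 0 j) N%:Z.

(* c^{(N)}_{x,y}(xi) on Z^d, with value 0 if x and y are not neighbours. *)
Definition periodized (x y : 'rV[int]_d) : R :=
  if [pick j | y == x + unitv j] is Some j then
    c (representative x) (representative x + unitv j) xi
  else if [pick j | x == y + unitv j] is Some j then
    c (representative y) (representative y + unitv j) xi
  else 0.

(* For N >= 2, 'Z_N is Z / N Z; sizes N < 2 do not affect limits in N. *)
Definition torus := 'rV['Z_N]_d.

Definition torus_proj (z : 'rV[int]_d) : torus := map_mx intr z.

Definition torus_lift (x : torus) : 'rV[int]_d := \row_j (x 0 j : nat)%:Z.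

(* c^{(N)}_{x,x+z}(xi) for x in the torus. *)
Definition ctorus (x : torus) (z : 'rV[int]_d) : R :=
  periodized (torus_lift x) (torus_lift x + z).

Definition torus_mean (f : torus -> R[i]) : R[i] :=
  (#|{: torus}|%:R)^-1 * \sum_(x : torus) f x.

Definition torus_inner (f g : torus -> R[i]) : R[i] :=
  torus_mean (fun x => (f x)^* * g x).

Definition torus_generator (f : torus -> R[i]) : torus -> R[i] :=
  fun x => \sum_(z \in nbr d) (ctorus x z)%:C * (f (x + torus_proj z) - f x).

Definition torus_c (j : 'I_d) (x : torus) : R[i] :=
  (ctorus x (unitv j) + ctorus x (- unitv j))%:C.

Definition torus_gamma (j : 'I_d) (x : torus) : R[i] :=
  (ctorus x (unitv j) - ctorus x (- unitv j))%:C.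

(* (i omega - L_N)^{-1} *)
Definition torus_resolvent (omega : R) (g : torus -> R[i]) : torus -> R[i] :=
  operator_inv 0
    (fun h g => forall x, g x = 0 +i* omega * h x - torus_generator h x) g.

(* The complex mobility matrix sigma_N: the linear response at lambda = 0 of the
   mean velocity, in the oscillatory steady state, of the walk with rates
   c^{(N)}_{x,x+z} exp(lambda cos(omega t) z.v) is Re(e^{i omega t} sigma_N v). *)
Definition torus_mobility (omega : R) : 'M[R[i]^o]_d :=
  \matrix_(j, k) (torus_mean (torus_c j) *+ (j == k)
    - 2 * torus_inner (torus_gamma j) (torus_resolvent omega (torus_gamma k))).

End Torus.

Section LimitMobility.
Context {disp : measure_display} {Omega : measurableType disp} {R : realType}.
Context {d : nat}.
Variable P : probability Omega R.
Variable c : 'rV[int]_d -> 'rV[int]_d -> Omega -> R.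

Definition env_c (xi : Omega) : 'rV[R]_d :=
  \row_j (c 0 (unitv j) xi + c 0 (- unitv j) xi).

Definition env_gamma (xi : Omega) : 'rV[R]_d :=
  \row_j (c 0 (unitv j) xi - c 0 (- unitv j) xi).

Definition env_gammaC (j : 'I_d) (xi : Omega) : R[i] := (env_gamma xi 0 j)%:C.

Definition mean_env_c (j : 'I_d) : R[i] :=
  (\int[P]_xi env_c xi 0 j)%:C.

Variables (L : (Omega -> R) -> (Omega -> R) -> Prop) (omega : R).

(* i omega - L on the complex space L^2(P). *)
Definition iomega_sub : (Omega -> R[i]) -> (Omega -> R[i]) -> Prop :=
  operator_shift P (0 +i* omega) (complexify L).

Definition limit_mobility : 'M[R[i]^o]_d :=
  \matrix_(j, k) (mean_env_c j *+ (j == k)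
    - 2 * Cinner P (env_gammaC j)
            (operator_inv 0 iomega_sub (env_gammaC k))).

End LimitMobility.

(* Main.v *)
(* Discrete integration by parts gives [<gamma_j, f> = - <c_{0,e_j}, grad_j f>],
   on Omega and on the torus, so both mobilities involve the resolvents
   [h_k = (i omega - L)^-1 gamma_k] only through their gradients.  The complex
   resolvent equation is a real system for the real and imaginary parts of the
   solution, which satisfies, again on Omega and on the torus alike,
   an energy estimate: the distance of the solution to any pair [(G1, G2)], in
   the form norm, is bounded by the residuals of [(G1, G2)] and of any pair of
   fields [(Q1, Q2)] put in place of the gradients.

   On Omega these residuals can be made arbitrarily small with bounded [G] and
   bounded [Q], [sqrt c Q] (density, by an orthogonality argument).  Pulled back
   to the torus along the environment, the same [G] and [Q] have residuals whose
   averages converge to those on Omega by the multidimensional ergodic theorem;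
   boundedness makes the wrap-around layer of the torus contribute at most
   [N^-d sum c] over the layer, which vanishes.  Hence the torus fluxes converge
   to the flux on Omega.

   For the integral formula, [s |-> <gamma_j, T_s h_k>] has derivative
   [- <gamma_j, T_s gamma_k>], and its square is at most a constant times the
   form at [T_s h_k], that is, times the decay rate of [|T_s h_k|^2].  Being
   uniformly continuous, it tends to 0, and the fundamental theorem of calculus
   gives the value of the integral. *)
Require Import Defs.
From HB Require Import structures.
From mathcomp Require Import all_boot all_order all_algebra.
From mathcomp Require Import all_classical all_reals all_analysis.
From mathcomp Require Import measurable_realfun zify ring lra.

Set Implicit Arguments.
Unset Strict Implicit.
Unset Printing Implicit Defensive.

Import Order.TTheory GRing.Theory Num.Theory.
Import numFieldNormedType.Exports.

Local Open Scope classical_set_scope.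
Local Open Scope ring_scope.

(** The conductances are only square-integrable: they are bounded neither above nor away from 0.
    Density of bounded functions in the form norm does not by itself give a bounded [G] whose
    residual in the resolvent equation is small in [L^2]. So the flux gets its own approximation
    [Q], and the residual is split into a function ([omega G] against the divergence of [Q]) and a
    field (gradient and source against [Q]); the energy estimate absorbs both, the field through the
    form. As [G] and [Q] vary independently, the orthogonal complement in the density argument can
    be computed. Functions that agree almost everywhere are not identified. Hence semi-inner
    products, and equalities of vectors expressed by null norms. The semigroup is only known to be
    strongly continuous with the given generator, with a constant for each single time. Local
    boundedness is derived first; then the orbits can be differentiated, and contractivity on the
    domain of the generator follows from the sign of the form. *)

Lemma natSinv_small (R : realType) (e : R) : 0 < e ->
  exists N, forall n, (N <= n)%N -> n.+1%:R^-1 < e.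
Proof.
move=> e0; have [N _ hN] := @near_infty_natSinv_lt R (PosNum e0).
by exists N => n /hN.
Qed.

(** * Semi-inner products and semigroups *)

Section PreHilbert.
Context {R : realType} {V : lmodType R}.
Implicit Types (q : V -> V -> R) (M : set V) (x y z m : V).

Definition qcauchy q (u : nat -> V) := forall e : R, 0 < e ->
  exists N, forall m n : nat, (N <= m)%N -> (N <= n)%N -> q (u m - u n) (u m - u n) < e.

Definition qlim q (u : nat -> V) x := forall e : R, 0 < e ->
  exists N, forall n, (N <= n)%N -> q (u n - x) (u n - x) < e.

(** No definiteness: functions that agree almost everywhere stay distinct, so limits are unique only
    up to null vectors, and equalities are later stated as [qnorm (x - y) = 0]. *)
Record prehilbert q := PreHilbert {
  phC : forall x y, q x y = q y x;
  phL : forall a x y z, q (a *: x + y) z = a * q x z + q y z;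
  ph_ge0 : forall x, 0 <= q x x }.

Definition qcomplete q := forall u, qcauchy q u -> exists x, qlim q u x.

Definition subspace M := M 0 /\ forall a x y, M x -> M y -> M (a *: x + y).

Section Theory.
Context (q : V -> V -> R) (hq : prehilbert q).

Lemma phDl x y z : q (x + y) z = q x z + q y z.
Proof. by have := phL hq 1 x y z; rewrite scale1r mul1r. Qed.

Lemma ph0l z : q 0 z = 0.
Proof. by have := phDl 0 0 z; rewrite addr0 => /eqP; rewrite -subr_eq subrr => /eqP. Qed.

Lemma phZl a x z : q (a *: x) z = a * q x z.
Proof. by have := phL hq a x 0 z; rewrite addr0 ph0l addr0. Qed.

Lemma phNl x z : q (- x) z = - q x z.
Proof. by rewrite -scaleN1r phZl mulN1r. Qed.

Lemma phBl x y z : q (x - y) z = q x z - q y z.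
Proof. by rewrite phDl phNl. Qed.

Lemma phDr x y z : q z (x + y) = q z x + q z y.
Proof. by rewrite (phC hq) phDl !(phC hq z). Qed.

Lemma phZr a x z : q z (a *: x) = a * q z x.
Proof. by rewrite (phC hq) phZl (phC hq z). Qed.

Lemma phNr x z : q z (- x) = - q z x.
Proof. by rewrite (phC hq) phNl (phC hq z). Qed.

Lemma phBr x y z : q z (x - y) = q z x - q z y.
Proof. by rewrite phDr phNr. Qed.

Lemma phBB x y : q (x - y) (x - y) = q x x - 2 * q x y + q y y.
Proof. by rewrite phBl !phBr (phC hq y x); ring. Qed.

Lemma phDD x y : q (x + y) (x + y) = q x x + 2 * q x y + q y y.
Proof. by rewrite phDl !phDr (phC hq y x); ring. Qed.

Lemma ph_CS x y : q x y ^+ 2 <= q x x * q y y.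
Proof.
have hx := ph_ge0 hq x; have hy := ph_ge0 hq y.
have key t : 0 <= q x x - 2 * t * q x y + t ^+ 2 * q y y.
  have := ph_ge0 hq (x - t *: y).
  by rewrite phBB phZr phZl phZr; congr (0 <= _); ring.
have [y0|yn0] := eqVneq (q y y) 0.
  have [->|xyn0] := eqVneq (q x y) 0; first by rewrite expr0n/= mulr_ge0.
  (* When [q y y = 0] the quadratic in [key] is affine in [t]; this [t] gives it the negative value
     [- q x x - 2]. *)
  have := key ((q x x + 1) / q x y); rewrite y0 mulr0 addr0.
  rewrite -mulrA divfK// => h; exfalso; lra.
have ypos : 0 < q y y by rewrite lt_def yn0.
have := key (q x y / q y y).
rewrite -(pmulr_lge0 _ ypos) => h.
have e : (q x x - 2 * (q x y / q y y) * q x y + (q x y / q y y) ^+ 2 * q y y) * q y y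
   = q x x * q y y - q x y ^+ 2 by field.
by rewrite e subr_ge0 in h.
Qed.

Definition qnorm x := Num.sqrt (q x x).

Lemma qnorm_ge0 x : 0 <= qnorm x. Proof. exact: sqrtr_ge0. Qed.

Lemma qnorm_sqr x : qnorm x ^+ 2 = q x x.
Proof. by rewrite sqr_sqrtr// (ph_ge0 hq). Qed.

Lemma ph_CSnorm x y : `|q x y| <= qnorm x * qnorm y.
Proof.
rewrite -[leRHS]ger0_norm ?mulr_ge0 ?qnorm_ge0// -ler_sqr ?nnegrE//.
by rewrite !real_normK ?num_real// exprMn !qnorm_sqr ph_CS.
Qed.

Lemma qnormD x y : qnorm (x + y) <= qnorm x + qnorm y.
Proof.
rewrite -ler_sqr ?nnegrE ?addr_ge0 ?qnorm_ge0// qnorm_sqr phDD sqrrD !qnorm_sqr.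
rewrite lerD2r lerD2l mulr2n mulrDl mul1r.
by have := le_trans (ler_norm _) (ph_CSnorm x y) => h; apply: lerD.
Qed.

Lemma qnormZ a x : qnorm (a *: x) = `|a| * qnorm x.
Proof.
by rewrite /qnorm phZl phZr mulrA -expr2 sqrtrM ?sqr_ge0// sqrtr_sqr.
Qed.

Lemma qnormN x : qnorm (- x) = qnorm x.
Proof. by rewrite /qnorm phNl phNr opprK. Qed.

Lemma qnorm_distC x y : qnorm (x - y) = qnorm (y - x).
Proof. by rewrite -opprB qnormN. Qed.

Lemma qnorm_lt x e : 0 < e -> (q x x < e ^+ 2) = (qnorm x < e).
Proof.
by move=> e0; rewrite -qnorm_sqr ltr_sqr ?nnegrE ?qnorm_ge0// ltW.
Qed.

Lemma subspaceZ M a x : subspace M -> M x -> M (a *: x).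
Proof. by move=> [M0 ML] Mx; have := ML a x 0 Mx M0; rewrite addr0. Qed.

(* Parallelogram law: a minimizing sequence of [m |-> |x - m|] in [M] is
   Cauchy, and the difference of [x] with its limit is orthogonal to [M]. *)
Lemma dense_of_orthogonal M (x : V) : qcomplete q -> subspace M ->
  (forall v, (forall m, M m -> q v m = 0) -> q v v = 0) ->
  forall e : R, 0 < e -> exists2 m, M m & q (x - m) (x - m) < e.
Proof.
move=> cq sM orth.
have [M0 ML] := sM.
pose S := [set q (x - m) (x - m) | m in M].
have Sinf : has_inf S.
  split; first by exists (q (x - 0) (x - 0)), 0.
  by exists 0 => _ [m _ <-]; exact: ph_ge0.
pose dlt := inf S.
have dle m : M m -> dlt <= q (x - m) (x - m).
  by move=> Mm; apply: ge_inf; [exact: (proj2 Sinf)|exists m].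
have pos n : 0 < (n.+1%:R : R)^-1 by rewrite invr_gt0.
have /choice[u hu] : forall n, exists m, M m /\ q (x - m) (x - m) < dlt + n.+1%:R^-1.
  move=> n; have [_ [m Mm <-] h] := inf_adherent (pos n) Sinf.
  by exists m.
have half m m' : M m -> M m' ->
    q (m - m') (m - m') <= 2 * q (x - m) (x - m) + 2 * q (x - m') (x - m') - 4 * dlt.
  move=> Mm Mm'.
  have Mh : M (2^-1 *: (m + m')).
    by apply: subspaceZ => //; have := ML 1 m m' Mm Mm'; rewrite scale1r.
  have := dle _ Mh.
  have -> : q (m - m') (m - m') = 2 * q (x - m) (x - m) + 2 * q (x - m') (x - m')
     - 4 * q (x - 2^-1 *: (m + m')) (x - 2^-1 *: (m + m')).
    by rewrite !phBB phZr phZl phZr phDr phDD; field.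
  by lra.
have small := @natSinv_small R.
have [y hy] : exists y, qlim q u y.
  apply: cq => e e0; have [N hN] := small (e / 4) (divr_gt0 e0 (ltr0n _ 4)).
  exists N => m n Nm Nn; have [Mm hm] := hu m; have [Mn hn] := hu n.
  have := half _ _ Mm Mn; have := hN _ Nm; have := hN _ Nn.
  move: hm hn; move: (m.+1%:R^-1 : R) (n.+1%:R^-1 : R) => a b; lra.
suff d0 : dlt = 0.
  move=> e e0; have [N hN] := small e e0; exists (u N); first exact: (hu N).1.
  by have := (hu N).2; rewrite d0 add0r => /lt_trans; apply; exact: hN.
(* [M] need not be closed, so [y] may lie outside it; the translates [y + m] are still limits of
   elements of [M], which keeps them at distance at least [sqrt dlt] from [x]. *)
have near m e : M m -> 0 < e -> exists2 m', M m' & q (m' - (y + m)) (m' - (y + m)) < e.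
  move=> Mm e0; have [N hN] := hy e e0; exists (u N + m).
    by have := ML 1 _ _ (hu N).1 Mm; rewrite scale1r.
  by rewrite opprD addrA addrAC [u N + m - m]addrK hN.
have ge m : M m -> Num.sqrt dlt <= qnorm (x - (y + m)).
  move=> Mm; apply/ler_addgt0Pr => e e0.
  have [m' Mm' /=] := near m (e ^+ 2) Mm (exprn_gt0 _ e0).
  rewrite qnorm_lt// => hm'.
  have := dle _ Mm'; rewrite -(@ler_sqrt _ _ (q _ _)) ?ph_ge0//.
  move=> /le_trans; apply.
  rewrite -/(qnorm _) (_ : x - m' = (x - (y + m)) + ((y + m) - m')); last first.
    by rewrite addrA subrK.
  by apply: (le_trans (qnormD _ _)); rewrite lerD2l qnorm_distC ltW.
have d_ge0 : 0 <= dlt by apply: lb_le_inf; [exact: (proj1 Sinf)|move=> _ [m _ <-]; exact: ph_ge0].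
have le : qnorm (x - y) <= Num.sqrt dlt.
  apply/ler_addgt0Pr => e e0.
  have [N hN] := hy ((e / 2) ^+ 2) (exprn_gt0 _ (divr_gt0 e0 (ltr0n _ 2))).
  have [N' hN'] := small ((e / 2) ^+ 2) (exprn_gt0 _ (divr_gt0 e0 (ltr0n _ 2))).
  pose n := maxn N N'.
  have := hN n (leq_maxl _ _); rewrite qnorm_lt ?divr_gt0// => h1.
  have h2 : qnorm (x - u n) <= Num.sqrt dlt + e / 2.
    rewrite -ler_sqr ?nnegrE ?addr_ge0 ?sqrtr_ge0 ?qnorm_ge0 ?divr_ge0 ?(ltW e0)//.
    rewrite qnorm_sqr sqrrD sqr_sqrtr//.
    have := (hu n).2; have := hN' n (leq_maxr _ _); move: (n.+1%:R^-1 : R) => a.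
    have : 0 <= Num.sqrt dlt * (e / 2) *+ 2.
      by rewrite mulrn_wge0// mulr_ge0 ?sqrtr_ge0 ?divr_ge0 ?(ltW e0).
    by set z := (_ *+ 2); lra.
  rewrite (_ : x - y = (x - u n) + (u n - y)); last by rewrite addrA subrK.
  by apply: (le_trans (qnormD _ _)); lra.
have vv : q (x - y) (x - y) = dlt.
  rewrite -qnorm_sqr -[RHS]sqr_sqrtr//; congr (_ ^+ 2).
  apply/eqP; rewrite eq_le le/=; have := ge 0 M0; by rewrite addr0.
rewrite -vv; apply: orth => m Mm.
have key t : 0 <= - 2 * t * q (x - y) m + t ^+ 2 * q m m.
  have := ge _ (subspaceZ t sM Mm).
  rewrite -ler_sqr ?nnegrE ?sqrtr_ge0 ?qnorm_ge0// sqr_sqrtr// qnorm_sqr.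
  rewrite opprD addrA phBB vv phZr phZl phZr; lra.
have mm := ph_ge0 hq m.
have pos1 : 0 < q m m + 1 by lra.
(* The [+ 1] keeps the denominator positive for null [m]; the value of the quadratic is still a
   negative multiple of the square of [q (x - y) m]. *)
have := key (q (x - y) m / (q m m + 1)).
set a := q (x - y) m; set b := q m m in mm pos1 *.
have -> : - 2 * (a / (b + 1)) * a + (a / (b + 1)) ^+ 2 * b = - (a ^+ 2 * ((b + 2) / (b+1)^+2)).
  by field; rewrite gt_eqF.
rewrite oppr_ge0 pmulr_lle0 ?divr_gt0 ?exprn_gt0//; last by lra.
by move=> h; apply/eqP; rewrite -sqrf_eq0 eq_le h sqr_ge0.
Qed.

Lemma qnorm0 : qnorm 0 = 0.
Proof. by rewrite /qnorm ph0l sqrtr0. Qed.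

Lemma qnorm_leD x y z : qnorm (x - z) <= qnorm (x - y) + qnorm (y - z).
Proof. by rewrite (le_trans _ (qnormD _ _))// addrA subrK. Qed.

Lemma qnorm_eq x y : qnorm (x - y) = 0 -> qnorm x = qnorm y.
Proof.
move=> h; apply/eqP; rewrite eq_le.
have := qnorm_leD x y 0; have := qnorm_leD y x 0.
by rewrite !subr0 (qnorm_distC y) h !add0r => -> ->.
Qed.

Lemma qlimP (u : nat -> V) x : qlim q u x <->
  forall e : R, 0 < e -> exists N, forall n, (N <= n)%N -> qnorm (u n - x) < e.
Proof.
split=> h e e0.
  have [N hN] := h _ (exprn_gt0 2 e0).
  by exists N => n /hN; rewrite qnorm_lt.
have [N hN] := h (Num.sqrt e) (etrans (sqrtr_gt0 _) e0).
exists N => n /hN; rewrite -qnorm_lt ?sqrtr_gt0//.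
by rewrite sqr_sqrtr// ltW.
Qed.

Lemma qcauchyP (u : nat -> V) :
  (forall e : R, 0 < e -> exists N, forall m n : nat, (N <= m)%N -> (N <= n)%N ->
    qnorm (u m - u n) < e) -> qcauchy q u.
Proof.
move=> h e e0.
have [N hN] := h (Num.sqrt e) (etrans (sqrtr_gt0 _) e0).
exists N => m n Nm Nn; have := hN _ _ Nm Nn; rewrite -qnorm_lt ?sqrtr_gt0//.
by rewrite sqr_sqrtr// ltW.
Qed.

(** The laws hold up to null vectors, and [sg_bounded] gives a constant for each single [s]; a bound
    uniform near 0 has to be proved. *)
Record semigroup (T : R -> V -> V) := Semigroup {
  sgL : forall (s a : R) f g, 0 <= s ->
    qnorm (T s (a *: f + g) - (a *: T s f + T s g)) = 0;
  sg_bounded : forall s : R, 0 <= s -> exists M : R, forall f, qnorm (T s f) <= M * qnorm f;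
  sg0 : forall f, qnorm (T 0 f - f) = 0;
  sgD : forall (s t : R) f, 0 <= s -> 0 <= t -> qnorm (T (s + t) f - T s (T t f)) = 0;
  sg_cvg : forall f (e : R), 0 < e -> exists2 dl : R, 0 < dl &
    forall s : R, 0 < s -> s < dl -> qnorm (T s f - f) < e }.

Definition generates (T : R -> V -> V) f g := forall e : R, 0 < e ->
  exists2 dl : R, 0 < dl &
    forall s : R, 0 < s -> s < dl -> qnorm (s^-1 *: (T s f - f) - g) < e.

Section Semigroup.
Context (T : R -> V -> V) (hT : semigroup T) (cq : qcomplete q).

Lemma sg_lin s a f g : 0 <= s -> qnorm (T s (a *: f + g)) = qnorm (a *: T s f + T s g).
Proof. by move=> s0; apply/qnorm_eq/(sgL hT). Qed.

Lemma sgB s f g : 0 <= s -> qnorm (T s (f - g)) = qnorm (T s f - T s g).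
Proof.
move=> s0; rewrite -[f - g]addrC -scaleN1r sg_lin//.
by rewrite scaleN1r addrC.
Qed.

Lemma sgZ s a f : 0 <= s -> qnorm (T s (a *: f)) = `|a| * qnorm (T s f).
Proof.
move=> s0; have [M hM] := sg_bounded hT s0.
rewrite -[a *: f]addr0 sg_lin// -qnormZ; apply: qnorm_eq.
rewrite addrC addKr; apply/eqP; rewrite eq_le qnorm_ge0 andbT.
by rewrite (le_trans (hM _))// qnorm0 mulr0.
Qed.

Definition opset s := [set qnorm (T s f) | f in [set f | qnorm f <= 1]].
Definition opnorm s := sup (opset s).

Lemma has_sup_opset s : 0 <= s -> has_sup (opset s).
Proof.
move=> s0; split; first by exists (qnorm (T s 0)), 0 => //=; rewrite qnorm0.
have [M hM] := sg_bounded hT s0.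
exists `|M| => _ [f /= f1 <-]; apply: (le_trans (hM f)).
rewrite (le_trans (ler_norm _))// normrM [X in _ * X]ger0_norm ?qnorm_ge0//.
by rewrite ler_piMr.
Qed.

Lemma opnorm_le s f : 0 <= s -> qnorm (T s f) <= opnorm s * qnorm f.
Proof.
move=> s0; have [M hM] := sg_bounded hT s0.
have [f0|fn0] := eqVneq (qnorm f) 0.
  by have := hM f; rewrite f0 !mulr0.
have fpos : 0 < qnorm f by rewrite lt_def fn0 qnorm_ge0.
rewrite -ler_pdivrMr//.
have -> : qnorm (T s f) / qnorm f = qnorm (T s ((qnorm f)^-1 *: f)).
  by rewrite sgZ// ger0_norm ?invr_ge0 ?qnorm_ge0// mulrC.
apply: sup_upper_bound; first exact: has_sup_opset.
by exists ((qnorm f)^-1 *: f) => //=; rewrite qnormZ ger0_norm ?invr_ge0 ?qnorm_ge0// mulVf.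
Qed.

(* Uniform boundedness near 0, after A. Sokal's gliding-hump proof: if
   [opnorm s_n] grew faster than [3 ^ n] along some [s_n -> 0], the orbit of
   [lim x_n] would be unbounded near 0. *)
Lemma opnorm_bounded_near0 : exists2 dl : R, 0 < dl &
  exists M : R, forall s, 0 <= s -> s < dl -> opnorm s <= M.
Proof.
apply: contrapT => hn.
have hs n : exists s : R, [/\ 0 <= s, s < n.+1%:R^-1 & 4 * n.+1%:R * 3 ^+ n < opnorm s].
  apply: contrapT => hs; apply: hn; exists (n.+1%:R^-1); first by rewrite invr_gt0.
  exists (4 * n.+1%:R * 3 ^+ n) => s s0 sn; rewrite leNgt; apply/negP => h.
  by apply: hs; exists s.
have {hs}/choice[sq hsq] := hs.
have hf n : exists f, qnorm f <= 1 /\ 3 / 4 * opnorm (sq n) <= qnorm (T (sq n) f).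
  have [s0 _ h] := hsq n.
  have op : 0 < opnorm (sq n).
    by apply: le_lt_trans h; rewrite mulr_ge0 ?mulr_ge0 ?exprn_ge0.
  have o4 : 0 < opnorm (sq n) / 4 by rewrite divr_gt0.
  have [_ [f /= f1 <-] hf] := sup_adherent o4 (has_sup_opset s0).
  by exists f; split => //; rewrite -/(opnorm _) in hf; lra.
have {hf}/choice[f hf] := hf.
pose p n : R := (3 ^+ n)^-1.
have p0 n : 0 < p n by rewrite invr_gt0 exprn_gt0.
have pS n : p n.+1 = p n / 3 by rewrite /p exprS invfM mulrC.
have ple n : p n <= n.+1%:R^-1.
  by rewrite lef_pV2 ?posrE ?exprn_gt0// -natrX ler_nat ltn_expl.
(* The images of [p f + x] and [- p f + x] differ by [2 p T f] up to null vectors, so one of them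
   has norm at least [p |T f|]; the sign is chosen accordingly. *)
pose step x n := if `|p n| * qnorm (T (sq n) (f n)) <= qnorm (T (sq n) (p n *: f n + x))
   then p n *: f n + x else (- p n) *: f n + x.
have hstep1 x n : p n * qnorm (T (sq n) (f n)) <= qnorm (T (sq n) (step x n)).
  have [s0 _ _] := hsq n.
  rewrite /step (gtr0_norm (p0 n)); case: ifPn => //; rewrite -ltNge !sg_lin// => h.
  have := qnorm_leD (p n *: T (sq n) (f n)) (- T (sq n) x) (- p n *: T (sq n) (f n)).
  rewrite opprK -opprD qnormN scaleNr opprK -scalerDl qnormZ addrC [_ + T _ x]addrC.
  rewrite gtr0_norm ?addr_gt0 ?p0// [T _ x - _]addrC; move: h.
  rewrite [T _ x + _]addrC.
  rewrite mulrDl => h h'; lra.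
have hstep2 x n : qnorm (step x n - x) <= p n.
  rewrite /step; case: ifP => _; rewrite addrK qnormZ ?normrN gtr0_norm// ler_piMr ?(ltW (p0 n))//.
    exact: (hf n).1.
  exact: (hf n).1.
pose x := fix x n := if n is n'.+1 then step (x n') n' else 0.
have hx n k : qnorm (x (n + k)%N - x n) <= 3 / 2 * (p n - p (n + k)%N).
  elim: k => [|k IH]; first by rewrite addn0 !subrr qnorm0 mulr0.
  rewrite addnS /=; apply: le_trans (qnorm_leD _ (x (n + k)%N) _) _.
  have := hstep2 (x (n + k)%N) (n + k)%N; rewrite pS; move: IH.
  move: (qnorm _) (qnorm _) (p n) (p (n + k)%N) => a b c e; lra.
have hx' n (m : nat) : (n <= m)%N -> qnorm (x m - x n) <= 3 / 2 * p n.
  move=> nm; rewrite -(subnKC nm); apply: (le_trans (hx _ _)).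
  by rewrite ler_pM2l ?divr_gt0// gerBl ltW.
have psmall (e : R) : 0 < e -> exists N, forall n, (N <= n)%N -> p n < e.
  move=> e0; have [N hN] := natSinv_small e0; exists N => n /hN.
  exact: le_lt_trans.
have [y hy] : exists y, qlim q x y.
  apply: cq; apply: qcauchyP => e e0.
  have [N hN] := psmall (e / 3) (divr_gt0 e0 (ltr0n _ 3)).
  exists N => m n Nm Nn; apply: (le_lt_trans (qnorm_leD _ (x N) _)).
  have := hN N (leqnn _); have := hx' _ _ Nm; have := hx' _ _ Nn.
  rewrite (qnorm_distC (x N)); lra.
move/qlimP in hy.
have hxy n : qnorm (y - x n) <= 3 / 2 * p n.
  apply/ler_addgt0Pr => e e0; have [N hN] := hy e e0.
  apply: (le_trans (qnorm_leD _ (x (maxn N n)) _)).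
  have := hN _ (leq_maxl N n); have := hx' _ _ (leq_maxr N n).
  rewrite (qnorm_distC y); lra.
(* Step [n] produces norm at least [3/4 p opnorm] with [p = p n], and all later steps move the point
   by at most [3/2 (p / 3) = p / 2]. What remains, [p opnorm / 4], exceeds [n + 1] by the growth
   [4 (n + 1) 3 ^ n] imposed along [sq n]. *)
have big n : n.+1%:R < qnorm (T (sq n) y).
  have [s0 _ h1] := hsq n.
  have := opnorm_le (y - x n.+1) s0; rewrite sgB//.
  have := hstep1 (x n) n; rewrite -[step _ _]/(x n.+1).
  have := hxy n.+1; rewrite pS.
  have := qnorm_leD (T (sq n) (x n.+1)) (T (sq n) y) 0.
  rewrite !subr0 (qnorm_distC (T _ (x _))).
  have [_ h2] := hf n.
  have op : 0 < opnorm (sq n).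
    by apply: le_lt_trans h1; rewrite mulr_ge0 ?mulr_ge0 ?exprn_ge0.
  have h3 : n.+1%:R < p n / 4 * opnorm (sq n).
    have e3 : 0 < (3 : R) ^+ n by rewrite exprn_gt0.
    have -> : n.+1%:R = p n / 4 * (4 * n.+1%:R * 3 ^+ n) :> R.
      by rewrite /p; field; rewrite gt_eqF.
    by rewrite ltr_pM2l// divr_gt0.
  move: (qnorm (y - x n.+1)) (qnorm (T _ (x _))) (qnorm (T _ y)) => a b c.
  move=> H1 H2 H3 H4.
  have H5 : p n * (3 / 4 * opnorm (sq n)) <= p n * qnorm (T (sq n) (f n)) by rewrite ler_pM2l.
  have H6 : opnorm (sq n) * a <= opnorm (sq n) * (3 / 2 * (p n / 3)) by rewrite ler_pM2l.
  move: h3; lra.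
have [dl dl0 hdl] := sg_cvg hT y ltr01.
have [N1 hN1] := natSinv_small dl0.
pose n := maxn N1 (Num.truncn (qnorm y + 1)).
have [s0 s1 _] := hsq n.
have h1 : qnorm (T (sq n) y - y) < 1.
  have [->|sn0] := eqVneq (sq n) 0; first by rewrite (sg0 hT).
  apply: hdl; first by rewrite lt_def sn0.
  by apply: (lt_trans s1); apply: hN1; exact: leq_maxl.
have h2 := big n.
have h3 : qnorm y + 1 < n.+1%:R.
  have := truncnS_gt (qnorm y + 1); move/lt_le_trans; apply.
  by rewrite ler_nat ltnS leq_maxr.
have := qnorm_leD (T (sq n) y) y 0; rewrite !subr0.
move: h1 h2 h3; move: (n.+1%:R : R) => N; lra.
Qed.

(** The time is cut into [n + 1] equal steps, each shorter than the [dl] of the bound near 0, and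
    the constants multiply. *)
Lemma sg_locally_bounded t : 0 <= t -> exists2 M : R, 0 < M &
  forall s f, 0 <= s -> s <= t -> qnorm (T s f) <= M * qnorm f.
Proof.
move=> t0; have [dl dl0 [M0 hM0]] := opnorm_bounded_near0.
pose M := Num.max 1 M0.
have M1 : 1 <= M by rewrite le_max lexx.
have hM s f : 0 <= s -> s < dl -> qnorm (T s f) <= M * qnorm f.
  move=> s0 sd; apply: (le_trans (opnorm_le f s0)); rewrite ler_wpM2r ?qnorm_ge0//.
  by rewrite (le_trans (hM0 _ s0 sd))// le_max lexx orbT.
pose n := Num.truncn (t / dl).
exists (M ^+ n.+1) => [|s f s0 st]; first by rewrite exprn_gt0// (lt_le_trans _ M1).
have : s / n.+1%:R < dl.
  rewrite ltr_pdivrMr// mulrC -ltr_pdivrMr//; apply: le_lt_trans (truncnS_gt (t / dl)).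
  by rewrite ler_pM2r ?invr_gt0.
set r := s / _ => rd.
have r0 : 0 <= r by rewrite divr_ge0.
have -> : s = r *+ n.+1 by rewrite -mulr_natr divfK.
elim: (n.+1) f => [|k IH] f.
  rewrite mulr0n expr0 mul1r.
  by rewrite (qnorm_eq (sg0 hT f)).
rewrite mulrS (qnorm_eq (sgD hT f r0 _)) ?mulrn_wge0//.
by rewrite exprS -mulrA (le_trans (hM _ _ r0 rd))// ler_wpM2l// (le_trans _ M1).
Qed.

(** [T s' f - T s f = T s (T (s' - s) f - f)] up to null vectors: right continuity at 0 becomes
    two-sided and uniform on [[0, t]] once [T s] is bounded there. *)
Lemma orbit_cont t f e : 0 <= t -> 0 < e -> exists2 dl : R, 0 < dl &
  forall s s', 0 <= s -> s <= t -> 0 <= s' -> s' <= t -> `|s' - s| < dl ->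
    qnorm (T s' f - T s f) < e.
Proof.
move=> t0 e0; have [M M0 hM] := sg_locally_bounded t0.
have [dl dl0 hdl] := sg_cvg hT f (divr_gt0 e0 M0).
exists dl => // s s'.
wlog ss : s s' / s < s' => [wl s0 st s'0 s't h|].
  have [] := ltgtP s s' => [ss|ss|->]; last by rewrite subrr qnorm0.
    exact: wl.
  by rewrite qnorm_distC; apply: wl => //; rewrite distrC.
move=> s0 st s'0 s't; rewrite gtr0_norm ?subr_gt0// => hd.
have d0 : 0 < s' - s by rewrite subr_gt0.
have -> : qnorm (T s' f - T s f) = qnorm (T s (T (s' - s) f - f)).
  rewrite sgB//; apply: qnorm_eq; rewrite opprB addrA subrK.
  by have := sgD hT f s0 (ltW d0); rewrite [s + _]addrC subrK.
apply: (le_lt_trans (hM _ _ s0 st)).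
by rewrite mulrC -ltr_pdivlMr// hdl.
Qed.

(** [T s] commutes with [T r] up to null vectors, hence with the difference quotients, and its
    boundedness carries the limit over. *)
Lemma generates_sg s f g : 0 <= s -> generates T f g -> generates T (T s f) (T s g).
Proof.
move=> s0 h e e0; have [M M0 hM] := sg_locally_bounded s0.
have [dl dl0 hdl] := h _ (divr_gt0 e0 M0).
exists dl => // r r0 rd.
suff -> : qnorm (r^-1 *: (T r (T s f) - T s f) - T s g)
        = qnorm (T s (r^-1 *: (T r f - f) - g)).
  apply: (le_lt_trans (hM _ _ s0 (lexx _))).
  by rewrite mulrC -ltr_pdivlMr// hdl.
rewrite sgB//; apply: qnorm_eq; rewrite opprB addrA subrK.
apply/eqP; rewrite eq_le qnorm_ge0 andbT.
apply: le_trans (qnorm_leD _ (r^-1 *: (T s (T r f) - T s f)) _) _.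
rewrite -scalerBr qnormZ opprB addrA subrK.
have -> : qnorm (T r (T s f) - T s (T r f)) = 0.
  apply/eqP; rewrite eq_le qnorm_ge0 andbT.
  apply: le_trans (qnorm_leD _ (T (r + s) f) _) _.
  by rewrite qnorm_distC (sgD hT) ?(ltW r0)// [r + s]addrC (sgD hT) ?(ltW r0)// addr0.
rewrite mulr0 add0r qnorm_distC.
apply: le_trans (qnorm_leD _ (r^-1 *: T s (T r f - f)) _) _.
have := sgL hT (r^-1) (T r f - f) 0 s0; rewrite addr0 => h1.
have := sgL hT (-1) f (T r f) s0; rewrite !scaleN1r => h2.
have h3 : qnorm (T s 0) = 0.
  have := sgZ 0 0 s0; by rewrite scale0r normr0 mul0r.
apply: (@le_trans _ _ (0 + `|r^-1| * 0)); last by rewrite mulr0 addr0.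
apply: lerD.
  apply: le_trans (qnorm_leD _ (r^-1 *: T s (T r f - f) + T s 0) _) _.
  rewrite [X in X + _]h1 [_ + T s 0]addrC addrK h3 addr0//.
rewrite -scalerBr qnormZ ler_wpM2l//.
by rewrite -h2 [T r f - f]addrC [T s (T r f) - _]addrC.
Qed.

(** The generator is only a right derivative at 0. A quotient between [r < s] is [T r] applied to a
    quotient at 0, hence close to [T r g]; for a left quotient at [s], [orbit_cont] then exchanges
    [T s' g] for [T s g]. *)
Lemma orbit_diff t f g e : 0 <= t -> 0 < e -> generates T f g ->
  exists2 dl : R, 0 < dl &
  forall s s', 0 <= s -> s <= t -> 0 <= s' -> s' <= t -> s' != s -> `|s' - s| < dl ->
    qnorm ((s' - s)^-1 *: (T s' f - T s f) - T s g) < e.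
Proof.
move=> t0 e0 hg; have [M M0 hM] := sg_locally_bounded t0.
have e20 : 0 < e / 2 by rewrite divr_gt0.
have [d1 d10 hd1] := hg _ (divr_gt0 e20 M0).
have [d2 d20 hd2] := orbit_cont g t0 e20.
have lem r s : 0 <= r -> r < s -> s <= t -> s - r < d1 ->
    qnorm ((s - r)^-1 *: (T s f - T r f) - T r g) < e / 2.
  move=> r0 rs st hd.
  have d0 : 0 < s - r by rewrite subr_gt0.
  have rt : r <= t by rewrite (le_trans (ltW rs)).
  suff -> : qnorm ((s - r)^-1 *: (T s f - T r f) - T r g)
          = qnorm (T r ((s - r)^-1 *: (T (s - r) f - f) - g)).
    apply: (le_lt_trans (hM _ _ r0 rt)).
    by rewrite mulrC -ltr_pdivlMr// hd1.
  rewrite sgB//; apply: qnorm_eq; rewrite opprB addrA subrK.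
  apply/eqP; rewrite eq_le qnorm_ge0 andbT.
  apply: le_trans (qnorm_leD _ ((s - r)^-1 *: (T r (T (s - r) f) - T r f)) _) _.
  rewrite -scalerBr qnormZ opprB addrA subrK.
  have := sgD hT f r0 (ltW d0); rewrite [r + _]addrC subrK => ->.
  rewrite mulr0 add0r.
  have h1 := sgL hT ((s - r)^-1) (T (s - r) f - f) 0 r0.
  have := sgL hT (-1) f (T (s - r) f) r0; rewrite !scaleN1r => h2.
  have h3 : qnorm (T r 0) = 0 by have := sgZ 0 0 r0; rewrite scale0r normr0 mul0r.
  rewrite addr0 in h1.
  rewrite qnorm_distC.
  apply: le_trans (qnorm_leD _ ((s - r)^-1 *: T r (T (s - r) f - f) + T r 0) _) _.
  rewrite h1 add0r.
  apply: le_trans (qnorm_leD _ ((s - r)^-1 *: T r (T (s - r) f - f)) _) _.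
  rewrite [X in X - _]addrC addrK h3 add0r -scalerBr qnormZ.
  by rewrite [T (s-r) f - f]addrC [T r (T _ f) - _]addrC h2 mulr0.
exists (Num.min d1 d2); first by rewrite lt_min d10.
move=> s s' s0 st s'0 s't ne; rewrite lt_min => /andP[h1 h2].
have [ss|ss|ee] := ltgtP s s'; last by rewrite ee eqxx in ne.
  rewrite (lt_le_trans (lem _ _ s0 ss s't _))//; last by lra.
  by move: h1; rewrite gtr0_norm ?subr_gt0.
apply: le_lt_trans (qnorm_leD _ (T s' g) _) _.
rewrite (splitr e); apply: ltrD; last exact: hd2.
rewrite -[s' - s]opprB invrN scaleNr -scalerN opprB; apply: lem => //.
by move: h1; rewrite distrC gtr0_norm ?subr_gt0.
Qed.

Lemma orbit_is_derive u f g (s : R) : 0 < s -> generates T f g ->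
  is_derive s 1 (fun r : R => q u (T r f) : R) (q u (T s g)).
Proof.
move=> s0 hg.
suff h : h^-1 *: (q u (T (h + s) f) - q u (T s f)) @[h --> 0^'] --> q u (T s g).
  have h' : h^-1 *: (q u (T (h *: (1:R) + s) f) - q u (T s f)) @[h --> 0^'] --> q u (T s g).
    by under eq_fun do rewrite [_ *: 1]mulr1.
  by split; [apply/cvg_ex; exists (q u (T s g))|apply/cvg_lim].
apply/cvgrPdist_lt => e e0.
have e1 : 0 < e / (qnorm u + 1) by rewrite divr_gt0// ltr_wpDl ?qnorm_ge0.
have t0 : 0 <= s + s by rewrite addr_ge0 ?(ltW s0).
have [dl dl0 hdl] := orbit_diff t0 e1 hg.
near=> h.
have h0 : h != 0 by near: h; exact: nbhs_dnbhs_neq.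
have hs : `|h| < s.
  by near: h; apply: dnbhs0_lt.
have hd : `|h| < dl.
  by near: h; apply: dnbhs0_lt.
have := hdl s (h + s); rewrite addrK => /(_ (ltW s0)) H.
have := hs; rewrite ltr_norml => /andP[hs1 hs2].
rewrite -phBr -[_ *: q _ _]phZr -phBr.
apply: (le_lt_trans (ph_CSnorm _ _)).
have k : qnorm (T s g - h^-1 *: (T (h + s) f - T s f)) < e / (qnorm u + 1).
  rewrite qnorm_distC; apply: H => //; try lra.
apply: (@le_lt_trans _ _ (qnorm u * (e / (qnorm u + 1)))).
  by rewrite ler_wpM2l ?qnorm_ge0// ltW.
rewrite mulrCA gtr_pMr// ltr_pdivrMr ?ltr_wpDl ?qnorm_ge0//.
by rewrite mul1r ltrDl.
Unshelve. all: by end_near. Qed.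

(** [|a|^2 - |b|^2 = 2 <b, a - b> + |a - b|^2] with [a], [b] the orbit at [h + s] and [s]. The first
    term is differentiated as a linear functional; the second is [o(h)], since its quotient by [h]
    pairs a bounded vector with one tending to 0. *)
Lemma orbit_sqr_is_derive f g (s : R) : 0 < s -> generates T f g ->
  is_derive s 1 (fun r : R => q (T r f) (T r f) : R) (2 * q (T s f) (T s g)).
Proof.
move=> s0 hg.
suff h : h^-1 *: (q (T (h + s) f) (T (h + s) f) - q (T s f) (T s f))
    @[h --> 0^'] --> 2 * q (T s f) (T s g).
  have h' : h^-1 *: (q (T (h *: (1:R) + s) f) (T (h *: (1:R) + s) f) - q (T s f) (T s f))
      @[h --> 0^'] --> 2 * q (T s f) (T s g).
    by under eq_fun do rewrite [_ *: 1]mulr1.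
  by split; [apply/cvg_ex; exists (2 * q (T s f) (T s g))|apply/cvg_lim].
have h1 : h^-1 *: (q (T s f) (T (h + s) f) - q (T s f) (T s f))
    @[h --> 0^'] --> q (T s f) (T s g).
  have [D1 D2] := orbit_is_derive (T s f) s0 hg.
  move: D1 D2; rewrite /derivable /derive.
  under eq_fun do rewrite [_ *: 1]mulr1.
  by move=> D1 <-.
have t0 : 0 <= s + s by rewrite addr_ge0 ?(ltW s0).
have h2 : h^-1 *: q (T (h + s) f - T s f) (T (h + s) f - T s f) @[h --> 0^'] --> (0 : R).
  apply/cvgrPdist_lt => e e0.
  pose A := qnorm (T s g) + 1.
  have A0 : 0 < A by rewrite /A ltr_wpDl ?qnorm_ge0.
  have eA : 0 < e / A by rewrite divr_gt0.
  have [d1 d10 hd1] := orbit_diff t0 ltr01 hg.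
  have [d2 d20 hd2] := orbit_cont f t0 eA.
  near=> h.
  have hn0 : h != 0 by near: h; exact: nbhs_dnbhs_neq.
  have hs : `|h| < s by near: h; apply: dnbhs0_lt.
  have hl1 : `|h| < d1 by near: h; apply: dnbhs0_lt.
  have hl2 : `|h| < d2 by near: h; apply: dnbhs0_lt.
  have := hs; rewrite ltr_norml => /andP[hs1 hs2].
  have H1 : qnorm (h^-1 *: (T (h + s) f - T s f) - T s g) < 1.
    have := hd1 s (h + s); rewrite addrK; apply => //; try lra.
  have H2 : qnorm (T (h + s) f - T s f) < e / A.
    have := hd2 s (h + s); rewrite addrK; apply => //; lra.
  rewrite sub0r normrN -[_ *: q _ _]phZl.
  apply: (le_lt_trans (ph_CSnorm _ _)).
  have H3 : qnorm (h^-1 *: (T (h + s) f - T s f)) <= A.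
    have := qnorm_leD (h^-1 *: (T (h + s) f - T s f)) (T s g) 0.
    by rewrite !subr0 /A; lra.
  apply: (@le_lt_trans _ _ (A * qnorm (T (h + s) f - T s f))).
    by rewrite ler_wpM2r ?qnorm_ge0.
  by rewrite mulrC -ltr_pdivlMr.
have -> : 2 * q (T s f) (T s g) = q (T s f) (T s g) + q (T s f) (T s g) + 0 by rewrite addr0 -mulr2n mulr_natl.
have -> : (fun h => h^-1 *: (q (T (h + s) f) (T (h + s) f) - q (T s f) (T s f))) =
  (fun h => h^-1 *: (q (T s f) (T (h + s) f) - q (T s f) (T s f))
    + h^-1 *: (q (T s f) (T (h + s) f) - q (T s f) (T s f))
    + h^-1 *: q (T (h + s) f - T s f) (T (h + s) f - T s f)).
  apply/funext => h; rewrite -!scalerDr; congr (_ *: _).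
  by rewrite phBB (phC hq (T (h + s) f) (T s f)); ring.
by apply: cvgD => //; apply: cvgD.
Unshelve. all: by end_near. Qed.

End Semigroup.
End Theory.
End PreHilbert.

(** * Square-integrable functions *)

Section Expectation.
Context {disp : measure_display} {Omega : measurableType disp} {R : realType}.
Variable P : probability Omega R.
Implicit Types f g h : Omega -> R.

Definition int1 f := P.-integrable setT (EFin \o f).
Definition Ex f : R := \int[P]_x f x.
Definition L2 f := f \in Lfun P 2%:E.

Lemma int1_meas f : int1 f -> measurable_fun setT f.
Proof. by move=> /integrableP[/measurable_EFinP]. Qed.

Lemma int1_le f g : measurable_fun setT f -> (forall x, `|f x| <= `|g x|) ->
  int1 g -> int1 f.
Proof.
move=> mf fg; apply: le_integrable => //; first exact/measurable_EFinP.
by move=> x _ /=; rewrite lee_fin.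
Qed.

Lemma int1_cst (r : R) : int1 (fun=> r).
Proof. exact: finite_measure_integrable_cst. Qed.

Lemma int1_bounded f (M : R) : measurable_fun setT f -> (forall x, `|f x| <= M) -> int1 f.
Proof.
move=> mf h; apply: (int1_le (g := fun=> M)) => //; last exact: int1_cst.
by move=> x; rewrite (le_trans (h x))// ler_norm.
Qed.

Lemma int1D f g : int1 f -> int1 g -> int1 (fun x => f x + g x).
Proof. by move=> hf hg; have := integrableD measurableT hf hg. Qed.

Lemma int1Z (r : R) f : int1 f -> int1 (fun x => r * f x).
Proof. by move=> hf; have := integrableZl measurableT r hf. Qed.

Lemma int1N f : int1 f -> int1 (fun x => - f x).
Proof. by move=> hf; have := integrableN hf. Qed.

Lemma int1B f g : int1 f -> int1 g -> int1 (fun x => f x - g x).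
Proof. by move=> hf hg; have := int1D hf (int1N hg). Qed.

Lemma int1_norm f : int1 f -> int1 (fun x => `|f x|).
Proof.
move=> hf; apply: int1_le (hf) => [|x]; last by rewrite normr_id.
exact: (measurableT_comp (@normr_measurable R setT) (int1_meas hf)).
Qed.

Lemma int1_sum (I : Type) (r : seq I) (F : I -> Omega -> R) :
  (forall i, int1 (F i)) -> int1 (fun x => \sum_(i <- r) F i x).
Proof.
move=> h; elim: r => [|i r IH].
  by under eq_fun do rewrite big_nil; exact: int1_cst.
by under eq_fun do rewrite big_cons; exact: int1D.
Qed.

Lemma eq_Ex f g : f =1 g -> Ex f = Ex g.
Proof. by move=> /funext ->. Qed.

Lemma ExD f g : int1 f -> int1 g -> Ex (fun x => f x + g x) = Ex f + Ex g.
Proof. exact: RintegralD. Qed.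

Lemma ExB f g : int1 f -> int1 g -> Ex (fun x => f x - g x) = Ex f - Ex g.
Proof. exact: RintegralB. Qed.

Lemma ExZ (r : R) f : int1 f -> Ex (fun x => r * f x) = r * Ex f.
Proof. exact: RintegralZl. Qed.

Lemma ExN f : int1 f -> Ex (fun x => - f x) = - Ex f.
Proof.
move=> hf; rewrite -mulN1r -ExZ//; apply: eq_Ex => x; by rewrite mulN1r.
Qed.

Lemma Ex_cst (r : R) : Ex (fun=> r) = r.
Proof.
by rewrite /Ex Rintegral_cst// [X in fine X](@probability_setT _ _ _ P) mulr1.
Qed.

Lemma Ex_sum (I : Type) (r : seq I) (F : I -> Omega -> R) :
  (forall i, int1 (F i)) -> Ex (fun x => \sum_(i <- r) F i x) = \sum_(i <- r) Ex (F i).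
Proof.
move=> h; elim: r => [|i r IH].
  by under eq_Ex do rewrite big_nil; rewrite Ex_cst big_nil.
under eq_Ex do rewrite big_cons.
by rewrite ExD// ?IH ?big_cons//; exact: int1_sum.
Qed.

Lemma le_Ex f g : int1 f -> int1 g -> (forall x, f x <= g x) -> Ex f <= Ex g.
Proof. by move=> hf hg h; apply: le_Rintegral. Qed.

Lemma Ex_ge0 f : (forall x, 0 <= f x) -> 0 <= Ex f.
Proof. by move=> h; apply: Rintegral_ge0. Qed.

Lemma normr_Ex f : int1 f -> `|Ex f| <= Ex (fun x => `|f x|).
Proof. by move=> h; apply: le_normr_Rintegral. Qed.

Lemma EFin_Ex f : int1 f -> (\int[P]_x (f x)%:E)%E = (Ex f)%:E.
Proof.
move=> h; rewrite /Ex /Rintegral fineK//.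
by have := integrable_fin_num measurableT h.
Qed.

Lemma ae_eq_Ex f g : int1 f -> int1 g -> {ae P, forall x, f x = g x} -> Ex f = Ex g.
Proof.
move=> hf hg h; congr fine; apply: ae_eq_integral => //.
- exact/measurable_EFinP/int1_meas.
- exact/measurable_EFinP/int1_meas.
by apply: filterS h => x -> _.
Qed.

Lemma ae_int1 f g : measurable_fun setT f -> int1 g -> {ae P, forall x, f x = g x} -> int1 f.
Proof.
move=> mf hg h; have /integrableP[mg fin] := hg.
apply/integrableP; split; first exact/measurable_EFinP.
rewrite (@ge0_ae_eq_integral _ _ _ _ _ _ (fun x => `|(g x)%:E|)%E)//.
- by apply: measurableT_comp => //; exact/measurable_EFinP.
- by apply: measurableT_comp => //.
by apply: filterS h => x /= -> _.
Qed.

Lemma Ex_eq0 f : int1 f -> (forall x, 0 <= f x) -> Ex f = 0 -> {ae P, forall x, f x = 0}.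
Proof.
move=> hf f0 e0.
have mf : measurable_fun setT (EFin \o f) by apply/measurable_EFinP/int1_meas.
have [+ _] := ae_eq_integral_abs P measurableT mf.
have -> : (\int[P]_x `|(EFin \o f) x|)%E = 0%E.
  under eq_integral do rewrite /= ger0_norm//.
  by rewrite EFin_Ex// e0.
by move=> /(_ erefl); apply: filterS => x /(_ I) /= [].
Qed.

Lemma L2_meas f : L2 f -> measurable_fun setT f.
Proof. by rewrite /L2 inE => /andP[]; rewrite inE. Qed.

Lemma L2_sqr f : L2 f -> int1 (fun x => f x ^+ 2).
Proof. exact: Lfun2_integrable_sqr. Qed.

Lemma L2_intro f : measurable_fun setT f -> int1 (fun x => f x ^+ 2) -> L2 f.
Proof.
move=> mf h; rewrite /L2 inE; apply/andP; split; rewrite inE//=.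
rewrite /finite_norm unlock poweR_lty//.
under eq_integral => x _ do rewrite /= powR_mulrn// -normrX.
by case/integrableP : h.
Qed.

Lemma L2_mul f g : L2 f -> L2 g -> int1 (fun x => f x * g x).
Proof. by move=> hf hg; apply/Lfun1_integrable; exact: Lfun2_mul_Lfun1. Qed.

Lemma L2_le f g : measurable_fun setT f -> (forall x, `|f x| <= `|g x|) -> L2 g -> L2 f.
Proof.
move=> mf h hg; apply: L2_intro => //.
apply: int1_le (L2_sqr hg) => [|x]; first exact: measurable_funX.
by rewrite !normrX lerXn2r ?nnegrE.
Qed.

Lemma L2_bounded f (M : R) : measurable_fun setT f -> (forall x, `|f x| <= M) -> L2 f.
Proof.
move=> mf h; apply: L2_intro => //; apply: (@int1_bounded _ (M ^+ 2)).
  exact: measurable_funX.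
by move=> x; rewrite normrX lerXn2r ?nnegrE// (le_trans _ (h x)).
Qed.

Lemma L2D f g : L2 f -> L2 g -> L2 (fun x => f x + g x).
Proof.
move=> hf hg; have mf := L2_meas hf; have mg := L2_meas hg.
apply: L2_intro; first exact: measurable_funD.
apply: (int1_le (g := fun x => 2 * f x ^+ 2 + 2 * g x ^+ 2)).
- by apply: measurable_funX; exact: measurable_funD.
- move=> x; rewrite (ger0_norm (sqr_ge0 _)) ger0_norm; last first.
    by rewrite addr_ge0// mulr_ge0// sqr_ge0.
  have := sqr_ge0 (f x - g x); rewrite sqrrB sqrrD; lra.
- by apply: int1D; apply: int1Z; exact: L2_sqr.
Qed.

Lemma L2Z (r : R) f : L2 f -> L2 (fun x => r * f x).
Proof.
move=> hf; have mf := L2_meas hf; apply: L2_intro; first exact: measurable_funM.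
under eq_fun do rewrite exprMn; exact: int1Z (L2_sqr hf).
Qed.

Lemma L2N f : L2 f -> L2 (fun x => - f x).
Proof. by move=> hf; have := L2Z (-1) hf; under eq_fun do rewrite mulN1r. Qed.

Lemma L2B f g : L2 f -> L2 g -> L2 (fun x => f x - g x).
Proof. by move=> hf hg; have := L2D hf (L2N hg). Qed.

Lemma L2_cst (r : R) : L2 (fun=> r).
Proof. exact: Lfun_cst. Qed.

Lemma L2_int1 f : L2 f -> int1 f.
Proof.
move=> hf; have := L2_mul hf (L2_cst 1); by under eq_fun do rewrite mulr1.
Qed.

Lemma L2_sum (I : Type) (r : seq I) (F : I -> Omega -> R) :
  (forall i, L2 (F i)) -> L2 (fun x => \sum_(i <- r) F i x).
Proof.
move=> h; elim: r => [|i r IH].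
  by under eq_fun do rewrite big_nil; exact: L2_cst.
by under eq_fun do rewrite big_cons; exact: L2D.
Qed.

Lemma Ex_CS f g : L2 f -> L2 g ->
  Ex (fun x => f x * g x) ^+ 2 <= Ex (fun x => f x ^+ 2) * Ex (fun x => g x ^+ 2).
Proof.
move=> hf hg; have hfg := L2_mul hf hg; have hf2 := L2_sqr hf; have hg2 := L2_sqr hg.
set a := Ex _; set b := Ex _; set c := Ex _.
have key t : 0 <= b - 2 * t * a + t ^+ 2 * c.
  have : 0 <= Ex (fun x => (f x - t * g x) ^+ 2) by apply: Ex_ge0 => x; exact: sqr_ge0.
  have -> : (fun x => (f x - t * g x) ^+ 2) =
     (fun x => f x ^+ 2 - (2 * t) * (f x * g x) + t ^+ 2 * g x ^+ 2).
    by apply/funext => x; ring.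
  rewrite ExD ?ExB ?ExZ//; [exact: int1Z|exact: int1B (int1Z _ _)|exact: int1Z].
have b0 : 0 <= b by apply: Ex_ge0 => x; exact: sqr_ge0.
have c0 : 0 <= c by apply: Ex_ge0 => x; exact: sqr_ge0.
have [y0|yn0] := eqVneq c 0.
  have [->|xyn0] := eqVneq a 0; first by rewrite expr0n/= mulr_ge0.
  have := key ((b + 1) / a); rewrite y0 mulr0 addr0.
  rewrite -mulrA divfK// => h; exfalso; lra.
have ypos : 0 < c by rewrite lt_def yn0.
have := key (a / c); rewrite -(pmulr_lge0 _ ypos) => h.
have e : (b - 2 * (a / c) * a + (a / c) ^+ 2 * c) * c = b * c - a ^+ 2 by field.
by rewrite e subr_ge0 in h.
Qed.

Lemma Ex_sqr_le f : L2 f -> Ex f ^+ 2 <= Ex (fun x => f x ^+ 2).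
Proof.
move=> hf; have := Ex_CS hf (L2_cst 1).
under eq_Ex do rewrite mulr1.
by under [X in _ <= _ * X -> _]eq_Ex do rewrite expr1n; rewrite Ex_cst mulr1.
Qed.

End Expectation.

(** * Completeness and density in spaces of square-integrable families *)

Section RieszFischer.
Context {disp : measure_display} {Omega : measurableType disp} {R : realType}.
Variable P : probability Omega R.
Implicit Types f g h : Omega -> R.
Local Notation L2 := (L2 P).
Local Notation Ex := (Ex P).
Local Notation int1 := (int1 P).

Lemma cvg_of_summable (v : nat -> R) :
  (\sum_(0 <= k <oo) `|v k.+1 - v k|%:E < +oo)%E -> cvgn v.
Proof.
move=> fin; have -> : v = (fun n => v 0%N + series (telescope v) n).
  by apply/funext => n; exact: eq_sum_telescope.
apply: is_cvgD; first exact: is_cvg_cst.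
apply: normed_cvg; apply: nondecreasing_is_cvgn.
  move=> m n mn; rewrite /= -subr_ge0 sub_series_geq//.
  by apply: sumr_ge0 => i _.
exists (fine (\sum_(0 <= k <oo) `|v k.+1 - v k|%:E)%E) => _ [n _ <-].
have fn : (\sum_(0 <= k <oo) `|v k.+1 - v k|%:E)%E \is a fin_num.
  by rewrite ge0_fin_numE// nneseries_ge0.
rewrite -lee_fin fineK// /series /= -sumEFin.
by have := @nneseries_lim_ge R (fun k => `|v k.+1 - v k|%:E) xpredT 0%N n; apply => k _ _; rewrite lee_fin.
Qed.

Lemma limn_einf_le (a : nat -> \bar R) (e : \bar R) (K : nat) :
  (forall k, (K <= k)%N -> a k <= e)%E -> (limn_einf a <= e)%E.
Proof.
move=> h; rewrite limn_einf_lim; apply: lime_le; first exact: is_cvg_einfs.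
apply: nearW => m; apply: le_trans (h (maxn m K) (leq_maxr _ _)).
by apply: ereal_inf_lbound; exists (maxn m K) => //=; exact: leq_maxl.
Qed.

(** Riesz-Fischer. Along a subsequence the increments are summable in [L^1], so it converges almost
    everywhere; Fatou's lemma turns the Cauchy condition into convergence of the whole sequence to
    that limit. *)
Lemma L2_complete (u : nat -> Omega -> R) : (forall n, L2 (u n)) ->
  (forall e, 0 < e -> exists N, forall m n : nat, (N <= m)%N -> (N <= n)%N ->
     Ex (fun x => (u m x - u n x) ^+ 2) < e) ->
  exists2 f, L2 f & forall e, 0 < e -> exists N, forall n, (N <= n)%N ->
     Ex (fun x => (u n x - f x) ^+ 2) < e.
Proof.
move=> L2u cu.
(* A mean square distance of [16 ^ -k] is an [L^1] distance of at most [4 ^ -k]. *)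
have e0 k : 0 < (16 ^+ k)^-1 :> R by rewrite invr_gt0 exprn_gt0.
have [Nk hNk] := choice (fun k => cu _ (e0 k)).
(* Summing makes the indices strictly increasing while [ph k] dominates [Nk k]. *)
pose ph k := (\sum_(i < k.+1) (Nk i).+1)%N.
have phS k : (Nk k <= ph k)%N by rewrite /ph big_ord_recr /= (leq_trans (leqnSn _))// leq_addl.
have phM k : (ph k <= ph k.+1)%N by rewrite /ph [leqRHS]big_ord_recr /= leq_addr.
have phL k m : (k <= m)%N -> (ph k <= ph m)%N.
  by move=> km; rewrite -(subnKC km); elim: (m - k)%N => [|j IH]; rewrite ?addn0// addnS (leq_trans IH).
pose v k := u (ph k).
have L2v k : L2 (v k) by exact: L2u.
have mv k : measurable_fun setT (v k) by exact: L2_meas (L2v k).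
have vd k : L2 (fun x => v k.+1 x - v k x) by exact: L2B.
have vs k : Ex (fun x => `|v k.+1 x - v k x|) <= (4 ^+ k)^-1.
  have L2n : L2 (fun x => `|v k.+1 x - v k x|).
    apply: L2_le (vd k) => [|x]; last by rewrite normr_id.
    exact: (measurableT_comp (@normr_measurable R setT) (L2_meas (vd k))).
  rewrite -ler_sqr ?nnegrE ?invr_ge0 ?exprn_ge0 ?Ex_ge0//.
  apply: le_trans (Ex_sqr_le L2n) _.
  have -> : (4 ^+ k)^-1 ^+ 2 = (16 ^+ k)^-1 :> R.
    by rewrite exprVn -exprM mulnC exprM -natrX.
  under eq_Ex do rewrite real_normK ?num_real//.
  by apply/ltW/hNk; [rewrite (leq_trans (phS k))|].
have sumfin : (\int[P]_x (\sum_(0 <= k <oo) `|v k.+1 x - v k x|%:E) < +oo)%E.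
  rewrite integral_nneseries//; last first.
    move=> k; apply/measurable_EFinP.
    exact: (measurableT_comp (@normr_measurable R setT) (L2_meas (vd k))).
  apply: (@le_lt_trans _ _ 2%:E); last exact: ltry.
  apply: le_trans (epsilon_trick0 xpredT (ler0n R 2)).
  apply: lee_nneseries => [k _ _|k _]; first exact: integral_ge0.
  rewrite EFin_Ex; last by apply: int1_norm; exact: L2_int1 (vd k).
  rewrite lee_fin (le_trans (vs k))// expnS natrM invfM mulrA divff// mul1r.
  by rewrite natrX lef_pV2 ?posrE ?exprn_gt0// lerXn2r ?nnegrE// ler_nat.
have aecv : {ae P, forall x, cvgn (v^~ x)}.
  have S0 x : (0 <= \sum_(0 <= k <oo) `|v k.+1 x - v k x|%:E)%E by exact: nneseries_ge0.
  have : P.-integrable setT (fun x => (\sum_(0 <= k <oo) `|v k.+1 x - v k x|%:E)%E).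
    apply/integrableP; split.
      apply: ge0_emeasurable_fun_sum => // k _.
      apply/measurable_EFinP.
      exact: (measurableT_comp (@normr_measurable R setT) (L2_meas (vd k))).
    by under eq_integral do rewrite gee0_abs//.
  move/(integrable_ae measurableT); apply: filterS => x /(_ I) fx.
  by apply: cvg_of_summable; rewrite -ge0_fin_numE.
(* The upper limit is measurable and defined everywhere, and [fine] sends its infinite values to 0;
   almost everywhere it is the limit. *)
pose f x := fine (limn_esup (fun k => (v k x)%:E)).
have mf : measurable_fun setT f.
  apply: measurableT_comp => //; apply: measurable_fun_limn_esup => k.
  exact/measurable_EFinP.
have aef : {ae P, forall x, v k x @[k --> \oo] --> f x}.
  apply: filterS aecv => x cx.
  have h : (v k x)%:E @[k --> \oo] --> (limn (v^~ x))%:E by apply: cvg_EFin; [exact: nearW|].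
  by rewrite /f (cvg_limn_einf_sup h).2.
have fat n K e : (forall k, (K <= k)%N -> Ex (fun x => (u n x - v k x) ^+ 2) <= e) ->
    int1 (fun x => (u n x - f x) ^+ 2) /\ Ex (fun x => (u n x - f x) ^+ 2) <= e.
  move=> hK.
  have md k : measurable_fun setT (fun x => ((u n x - v k x) ^+ 2)%:E).
    by apply/measurable_EFinP/measurable_funX/measurable_funB => //; exact: L2_meas.
  have mdf : measurable_fun setT (fun x => (u n x - f x) ^+ 2).
    by apply/measurable_funX/measurable_funB => //; exact: L2_meas.
  have H : (\int[P]_x ((u n x - f x) ^+ 2)%:E <= e%:E)%E.
    rewrite (@ge0_ae_eq_integral _ _ _ _ _ _ (fun x => limn_einf (fun k => ((u n x - v k x) ^+ 2)%:E)))//.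
    - apply: le_trans (fatou _ _ _ _) _ => //.
        by move=> k x _; rewrite lee_fin sqr_ge0.
      apply: (limn_einf_le (K := K)) => k Kk.
      by rewrite EFin_Ex ?lee_fin ?hK//; exact/L2_sqr/L2B.
    - exact/measurable_EFinP.
    - rewrite /limn_einf; apply: measurableT_comp => //.
      apply: measurable_fun_limn_esup => k /=.
      by apply/measurable_EFinP/measurable_funN/measurable_EFinP; exact: md.
    - by move=> x _; rewrite lee_fin sqr_ge0.
    - move=> x _; rewrite limn_einf_lim; apply: lime_ge; first exact: is_cvg_einfs.
      by apply: nearW => m; apply: le_ereal_inf_tmp => _ [k _ <-]; rewrite lee_fin sqr_ge0.
    - apply: filterS aef => x cx _; symmetry.
      apply: (cvg_limn_einf_sup _).1; apply: cvg_EFin; first exact: nearW.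
      by rewrite expr2; apply: cvgM; apply: cvgB => //; exact: cvg_cst.
  have I1 : int1 (fun x => (u n x - f x) ^+ 2).
    apply/integrableP; split; first exact/measurable_EFinP.
    apply: (@le_lt_trans _ _ e%:E); last exact: ltry.
    by under eq_integral do rewrite /= ger0_norm ?sqr_ge0//.
  by split => //; rewrite -lee_fin -EFin_Ex.
have tail e : 0 < e -> exists N, forall n, (N <= n)%N ->
   int1 (fun x => (u n x - f x) ^+ 2) /\ Ex (fun x => (u n x - f x) ^+ 2) < e.
  move=> e1; have e2 : 0 < e / 2 by rewrite divr_gt0.
  have [N hN] := cu _ e2; exists N => n Nn.
  have phk k : (k <= ph k)%N.
    by elim: k => // k /leq_ltn_trans; apply; rewrite /ph [ltnRHS]big_ord_recr /= -[ltnLHS]addn0 ltn_add2l.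
  have [] := fat n N (e / 2).
    by move=> k kN; apply/ltW/hN => //; exact: leq_trans (phk k).
  move=> ? h; split => //; apply: (le_lt_trans h); lra.
exists f; last by move=> e /tail[N hN]; exists N => n /hN[].
have [N /(_ N (leqnn _))[hN _]] := tail 1 ltr01.
have : L2 (fun x => u N x - (u N x - f x)).
  by apply: L2B => //; apply: L2_intro => //; exact/measurable_funB/mf/L2_meas.
by under eq_fun do rewrite opprB addrC subrK.
Qed.

Local Notation V := (LfunType P (lee1n 2)).

(* The value is [0] when [f] is not square-integrable. *)
Definition toL f : V :=
  match pselect (f \in Lfun P 2%:E) with
  | left p => Lfun_Sub (lee1n 2) p
  | right _ => 0
  end.

Lemma toLE f : L2 f -> toL f = f :> (Omega -> R).
Proof.
by move=> hf; rewrite /toL; case: pselect => // p; rewrite Lfun_valP.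
Qed.

Lemma V_L2 (f : V) : L2 f.
Proof. exact: (LfunP f). Qed.

Section Vector.
Variable I : finType.
Local Notation H := {ffun I -> V}.

(** Families are needed over three index types: a single index for the ergodic theorem, [bool] for
    real and imaginary parts, and [bool * option 'I_d] for functions together with vector fields. *)
Definition vinner (F G : H) : R := \sum_i Ex (fun x => F i x * G i x).

Lemma vinner_prehilbert : prehilbert vinner.
Proof.
split=> [F G|a F G K|F].
- by apply: eq_bigr => i _; apply: eq_Ex => x; rewrite mulrC.
- rewrite /vinner mulr_sumr -big_split /=; apply: eq_bigr => i _.
  rewrite -ExZ; last by apply: L2_mul; exact: V_L2.
  rewrite -ExD; [|by apply: int1Z; apply: L2_mul; exact: V_L2|by apply: L2_mul; exact: V_L2].
  by apply: eq_Ex => x; rewrite !ffunE /= mulrDl mulrA.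
- by apply: sumr_ge0 => i _; apply: Ex_ge0 => x; rewrite -expr2 sqr_ge0.
Qed.

Lemma vinnerBB (F G : H) : vinner (F - G) (F - G) = \sum_i Ex (fun x => (F i x - G i x) ^+ 2).
Proof.
by apply: eq_bigr => i _; apply: eq_Ex => x; rewrite !ffunE /= expr2.
Qed.

Lemma vinner_complete : qcomplete vinner.
Proof.
move=> u cu.
have hi i : exists2 f, L2 f & forall e, 0 < e -> exists N, forall n, (N <= n)%N ->
     Ex (fun x => (u n i x - f x) ^+ 2) < e.
  apply: L2_complete => [n|e e0]; first exact: V_L2.
  have [N hN] := cu e e0; exists N => m n Nm Nn.
  have := hN m n Nm Nn; rewrite vinnerBB; apply: le_lt_trans.
  rewrite (bigD1 i)//= lerDl; apply: sumr_ge0 => j _.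
  by apply: Ex_ge0 => x; exact: sqr_ge0.
have {hi}/choice[f hf] : forall i, exists f, L2 f /\ forall e, 0 < e ->
   exists N, forall n, (N <= n)%N -> Ex (fun x => (u n i x - f x) ^+ 2) < e.
  by move=> i; have [f h1 h2] := hi i; exists f.
exists [ffun i => toL (f i)] => e e0.
have e1 : 0 < e / #|I|.+1%:R by rewrite divr_gt0.
have /choice[N hN] := fun i => (hf i).2 _ e1.
exists (\max_i N i) => n Nn; rewrite vinnerBB.
apply: (@le_lt_trans _ _ (\sum_(i : I) e / #|I|.+1%:R)).
  apply: ler_sum => i _; rewrite ffunE toLE ?(hf i).1//.
  by apply/ltW/hN; apply: leq_trans Nn; exact: leq_bigmax.
rewrite sumr_const -[ltLHS]mulr_natr mulrAC ltr_pdivrMr// ltr_pM2l// ltr_nat.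
exact: ltnSn.
Qed.

Lemma L2_dense (M : set (I -> Omega -> R)) :
  (forall F, M F -> forall i, L2 (F i)) -> M (fun _ _ => 0) ->
  (forall a F G, M F -> M G -> M (fun i x => a * F i x + G i x)) ->
  (forall v, (forall i, L2 (v i)) ->
    (forall F, M F -> \sum_i Ex (fun x => v i x * F i x) = 0) ->
    \sum_i Ex (fun x => v i x ^+ 2) = 0) ->
  forall F, (forall i, L2 (F i)) -> forall e, 0 < e ->
  exists2 G, M G & \sum_i Ex (fun x => (F i x - G i x) ^+ 2) < e.
Proof.
move=> ML M0 Mlin orth F hF e e0.
pose M' : set H := [set G : H | M (fun i => G i : Omega -> R)].
have sM : subspace M'.
  split; first by rewrite /M' /=; under eq_fun do rewrite ffunE.
  move=> a F' G' hF' hG'; rewrite /M' /=.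
  suff -> : (fun i => (a *: F' + G') i : Omega -> R) =
            (fun i x => a * (F' i : V) x + (G' i : V) x) by exact: Mlin.
  by apply/funext => i; rewrite !ffunE.
have [|G MG hG] := dense_of_orthogonal vinner_prehilbert (M := M') [ffun i => toL (F i)]
   vinner_complete sM _ e0.
  move=> v hv; under [LHS]eq_bigr do under eq_Ex do rewrite -expr2.
  apply: orth => [i|G MG]; first exact: V_L2.
  have := hv [ffun i => toL (G i)] _; rewrite /vinner /=.
  under eq_bigr => i _ do rewrite ffunE toLE ?(ML _ MG)//.
  apply; rewrite /M' /=.
  suff -> : (fun i => [ffun i0 => toL (G i0)] i : Omega -> R) = G by [].
  by apply/funext => i; rewrite ffunE toLE//; exact: ML.
exists (fun i => (G i : V) : Omega -> R) => //.
move: hG; rewrite vinnerBB.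
by under eq_bigr => i _ do rewrite ffunE toLE ?hF//.
Qed.

End Vector.
End RieszFischer.

Section ExpectationMore.
Context {disp : measure_display} {Omega : measurableType disp} {R : realType}.
Variable P : probability Omega R.
Implicit Types f g h : Omega -> R.
Local Notation L2 := (L2 P).
Local Notation Ex := (Ex P).
Local Notation int1 := (int1 P).

Lemma ae_forall_count (T : countType) (Q : T -> Omega -> Prop) :
  (forall t, {ae P, forall x, Q t x}) -> {ae P, forall x, forall t, Q t x}.
Proof.
move=> h; have : {ae P, forall x, forall n, if unpickle n is Some t then Q t x else True}.
  apply/ae_foralln => n; case: (unpickle n) => [t|]; first exact: h.
  exact: aeW.
by apply: filterS => x hx t; have := hx (pickle t); rewrite pickleK.
Qed.

Lemma Ex_dct (f_ : nat -> Omega -> R) g : (forall n, measurable_fun setT (f_ n)) ->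
  int1 g -> (forall n x, `|f_ n x| <= g x) ->
  (forall x, f_ n x @[n --> \oo] --> 0) ->
  forall e : R, 0 < e -> exists N, forall n, (N <= n)%N -> `|Ex (f_ n)| < e.
Proof.
move=> mf ig fg f0 e e0.
have c0 : {ae P, forall x, setT x -> (f_ n x)%:E @[n --> \oo] --> 0%E}.
  by apply: aeW => x _; apply: cvg_EFin; [exact: nearW|exact: f0].
have cb : {ae P, forall x (n : nat), setT x -> (`|(f_ n x)%:E| <= (g x)%:E)%E}.
  by apply: aeW => x n _; rewrite lee_fin.
have mE n : measurable_fun setT (fun x => (f_ n x)%:E) by exact/measurable_EFinP.
have [_ _] := dominated_convergence measurableT mE (measurable_cst 0%E) c0 ig cb.
rewrite integral0 => /fine_cvgP[_] /cvgrPdist_lt/(_ _ e0)[N _ hN].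
by exists N => n /hN /=; rewrite sub0r normrN.
Qed.

Definition trunc (M r : R) := Num.max (- M) (Num.min r M).

Lemma trunc_meas M f : measurable_fun setT f -> measurable_fun setT (fun x => trunc M (f x)).
Proof.
by move=> mf; apply: measurable_maxr => //; apply: measurable_minr.
Qed.

Lemma trunc_bounded M r : 0 <= M -> `|trunc M r| <= M.
Proof.
move=> M0; rewrite /trunc ler_norml !maxEle !minEle; case: (leP r M) => h1.
  by case: (leP (- M) r) => h2; apply/andP; split; lra.
by case: (leP (- M) M) => h2; apply/andP; split; lra.
Qed.

Lemma trunc_id M r : `|r| <= M -> trunc M r = r.
Proof.
rewrite ler_norml => /andP[h1 h2]; rewrite /trunc min_l// max_r//.
Qed.

Lemma trunc_mono M a b : 0 <= (a - b) * (trunc M a - trunc M b).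
Proof.
wlog ab : a b / a <= b => [h|].
  have [/h//|/ltW/h] := leP a b.
  by rewrite -opprB mulNr -mulrN opprB.
have : trunc M a <= trunc M b.
{ rewrite /trunc !maxEle !minEle; case: (leP a M); case: (leP b M) => hb ha.
  all: case: (leP (- M) M) => h0; case: (leP (- M) a) => h1; case: (leP (- M) b) => h2; lra. }
by move=> h; rewrite mulr_le0 ?subr_le0.
Qed.

Lemma trunc_lip M a b : `|trunc M a - trunc M b| <= `|a - b|.
Proof.
wlog ab : a b / a <= b => [h|].
  have [/h//|/ltW/h] := leP a b.
  by rewrite distrC (distrC a).
rewrite distrC (distrC a) [leRHS]ger0_norm ?subr_ge0// ler_norml.
rewrite /trunc !maxEle !minEle; case: (leP a M); case: (leP b M) => hb ha.
all: case: (leP (- M) M) => h0; case: (leP (- M) a) => h1; case: (leP (- M) b) => h2;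
  apply/andP; split; lra.
Qed.

Lemma trunc0 M : 0 <= M -> trunc M 0 = 0.
Proof. by move=> M0; rewrite trunc_id// normr0. Qed.

Lemma trunc_le M r : 0 <= M -> `|trunc M r| <= `|r|.
Proof. by move=> M0; have := trunc_lip M r 0; rewrite trunc0// !subr0. Qed.

Lemma trunc_cvg r : trunc n%:R r @[n --> \oo] --> r.
Proof.
apply/cvgrPdist_lt => e e0; exists (Num.truncn `|r|).+1 => //= n hn.
rewrite trunc_id ?subrr ?normr0// ltW// (lt_le_trans (truncnS_gt _))//.
by rewrite ler_nat.
Qed.

Lemma trunc_L1 f : int1 f -> forall e : R, 0 < e -> exists N, forall n : nat, (N <= n)%N ->
  Ex (fun x => `|f x - trunc n%:R (f x)|) < e.
Proof.
move=> hf e e0.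
have mf := int1_meas hf.
have [||n x|x|N hN] := @Ex_dct (fun n x => `|f x - trunc n%:R (f x)|) (fun x => 2 * `|f x|) _ _ _ _ _ e0.
- move=> n; apply: (measurableT_comp (@normr_measurable R setT)).
  by apply: measurable_funB => //; exact: trunc_meas.
- by apply: int1Z; exact: int1_norm.
- rewrite normr_id (le_trans (ler_normB _ _))// mulr2n mulrDl mul1r lerD2l.
  exact: trunc_le.
- rewrite -(normr0 R) -(subrr (f x)); apply: cvg_norm; apply: cvgB; first exact: cvg_cst.
  exact: trunc_cvg.
exists N => n /hN; rewrite ger0_norm//.
exact: Ex_ge0.
Qed.

(** With the test function [u = trunc 1 f], the product [f u] is nonnegative, integrable, and zero
    only where [f] is. *)
Lemma ae0_of_orth f : int1 f ->
  (forall u : Omega -> R, measurable_fun setT u -> (forall x, `|u x| <= 1) -> Ex (fun x => f x * u x) = 0) ->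
  {ae P, forall x, f x = 0}.
Proof.
move=> hf orth; have mf := int1_meas hf.
have mt : measurable_fun setT (fun x => trunc 1 (f x)) by exact: trunc_meas.
have t0 x : 0 <= f x * trunc 1 (f x).
  by have := trunc_mono 1 (f x) 0; rewrite trunc0// !subr0.
have h := orth _ mt (fun x => trunc_bounded _ ler01).
have I : int1 (fun x => f x * trunc 1 (f x)).
  apply: int1_le hf; first exact: measurable_funM.
  by move=> x; rewrite normrM ler_piMr ?trunc_bounded.
have := Ex_eq0 I t0 h; apply: filterS => x /eqP.
rewrite mulf_eq0 => /orP[/eqP//|/eqP].
rewrite /trunc !maxEle !minEle; case: (leP (f x) 1) => ha.
  by case: (leP (-1) (f x)) => h1; lra.
by case: (leP (-1 : R) 1) => h1; lra.
Qed.

End ExpectationMore.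

(** * Measure-preserving actions *)

Section Action.
Context {disp : measure_display} {Omega : measurableType disp} {R : realType}.
Context {d : nat}.
Variables (P : probability Omega R) (tau : 'rV[int]_d -> Omega -> Omega).
Hypotheses (htau : is_action tau) (hstat : stationary P tau).
Implicit Types f g h : Omega -> R.
Local Notation L2 := (L2 P).
Local Notation Ex := (Ex P).
Local Notation int1 := (int1 P).

Lemma tauD (a b : 'rV[int]_d) x : tau a (tau b x) = tau (a + b) x.
Proof. by have [_ _ h] := htau; rewrite -(h a b). Qed.

Lemma tau0 x : tau 0 x = x.
Proof. by have [_ -> _] := htau. Qed.

Lemma tauK (a : 'rV[int]_d) : cancel (tau a) (tau (- a)).
Proof. by move=> x; rewrite tauD addNr tau0. Qed.

Lemma tauNK (a : 'rV[int]_d) : cancel (tau (- a)) (tau a).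
Proof. by move=> x; rewrite tauD addrN tau0. Qed.

Lemma tau_meas a : measurable_fun setT (tau a).
Proof. by have [h _ _] := htau. Qed.

Lemma tau_preimage a (A : set Omega) : tau a @^-1` A = tau (- a) @` A.
Proof.
apply/seteqP; split=> [x Ax|_ [x Ax <-]] /=; last by rewrite tauNK.
by exists (tau a x) => //; rewrite tauK.
Qed.

Lemma P_preimage a (A : set Omega) : measurable A -> P (tau a @^-1` A) = P A.
Proof. by move=> mA; rewrite tau_preimage hstat. Qed.

Lemma comp_meas a f : measurable_fun setT f -> measurable_fun setT (fun x => f (tau a x)).
Proof. by move=> mf; apply: (measurableT_comp mf); exact: tau_meas. Qed.

Lemma integral_comp a (f : Omega -> \bar R) : measurable_fun setT f -> (forall x, 0 <= f x)%E ->
  (\int[P]_x f (tau a x) = \int[P]_x f x)%E.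
Proof.
move=> mf f0; have := @ge0_integral_pushforward _ _ _ _ R _ (tau_meas a) P setT f measurableT mf
  (fun y _ => f0 y).
rewrite preimage_setT => <-; apply: eq_measure_integral; first exact: tau_meas.
by move=> ? A mA _; exact: (P_preimage a mA).
Qed.

Lemma int1_comp a f : int1 f -> int1 (fun x => f (tau a x)).
Proof.
move=> hf; apply/integrableP; split.
  by apply/measurable_EFinP/comp_meas; exact: int1_meas hf.
have /integrableP[mf] := hf.
by rewrite -(@integral_comp a (fun x => `|(f x)%:E|)%E)//; apply: measurableT_comp.
Qed.

Lemma Ex_comp a f : int1 f -> Ex (fun x => f (tau a x)) = Ex f.
Proof.
move=> hf; congr fine.
have := @integral_pushforward _ _ _ _ R _ (tau_meas a) P setT (EFin \o f).
rewrite preimage_setT => <- //.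
- apply: eq_measure_integral; first exact: tau_meas.
  by move=> ? A mA _; exact: (P_preimage a mA).
- by apply/measurable_EFinP; exact: int1_meas hf.
- exact: (int1_comp a hf).
Qed.

Lemma L2_comp a f : L2 f -> L2 (fun x => f (tau a x)).
Proof.
move=> hf; apply: L2_intro; first exact: comp_meas (L2_meas hf).
exact: (int1_comp a (L2_sqr hf)).
Qed.

Lemma ae_comp a (Q : Omega -> Prop) : {ae P, forall x, Q x} -> {ae P, forall x, Q (tau a x)}.
Proof.
move=> [A [mA A0 QA]]; exists (tau a @^-1` A); split.
- by rewrite -[X in measurable X]setTI; exact: tau_meas.
- by rewrite P_preimage.
- by move=> x /= hx; exact: QA.
Qed.

(** The [a] for which [f] is almost everywhere invariant under [tau a] form a subgroup containing
    every [unitv j], hence all of the lattice; countability puts the quantifier inside. *)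
Lemma ae_invariant f : (forall j, {ae P, forall x, f (tau (unitv j) x) = f x}) ->
  {ae P, forall x, forall a, f (tau a x) = f x}.
Proof.
move=> h; apply: ae_forall_count.
pose G := [set a : 'rV[int]_d | {ae P, forall x, f (tau a x) = f x}].
have G0 : G 0 by apply: aeW => x; rewrite tau0.
have GD a b : G a -> G b -> G (a + b).
  move=> Ga Gb; apply: filterS2 (ae_comp b Ga) (Gb) => x h1 h2.
  by rewrite -tauD h1.
have GN a : G a -> G (- a).
  move=> Ga; have := ae_comp (- a) Ga; apply: filterS => x.
  by rewrite tauNK.
move=> a; suff : G a by [].
rewrite (row_sum_delta a).
elim/big_ind : _ => // j _.
have Gn (n : nat) : G (n%:Z *: unitv j).
  elim: n => [|n IH]; first by rewrite scale0r.
  have -> : n.+1%:Z = n%:Z + 1 :> int by rewrite -addn1 PoszD.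
  by rewrite scalerDl scale1r; apply: GD => //; exact: h.
case: (a 0 j) => n; first exact: Gn.
by rewrite NegzE scaleNr; apply: GN.
Qed.

(* [A] is a strictly invariant version of [{f > 0}], so [f] has an a.e. sign. *)
Lemma ergodic_zero f : ergodic P tau -> L2 f -> Ex f = 0 ->
  (forall j, {ae P, forall x, f (tau (unitv j) x) = f x}) ->
  {ae P, forall x, f x = 0}.
Proof.
move=> herg hf E0 /ae_invariant inv; have mf := L2_meas hf.
pose A := \bigcap_(a in [set: 'rV[int]_d]) [set x | 0 < f (tau a x)].
have mA : measurable A.
  rewrite /A -[X in measurable X]setCK setC_bigcap; apply: measurableC.
  apply: countable_bigcupT_measurable; first exact: countableP.
  move=> a; apply: measurableC.
  by rewrite -[X in measurable X]setTI; apply: measurable_fun_ltr => //; exact: comp_meas.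
have tA a : tau a @` A = A.
  rewrite -[a in LHS]opprK -tau_preimage; apply/seteqP; split => x /= Ax b _ /=.
    by have := Ax (b + a) I; rewrite /= tauD addrK.
  by rewrite tauD; exact: Ax.
have int_f : int1 f by exact: L2_int1.
have sign (s : R) : `|s| = 1 -> {ae P, forall x, `|f x| = s * f x} -> {ae P, forall x, f x = 0}.
  move=> s1 h; have E1 : Ex (fun x => `|f x|) = 0.
    by rewrite (ae_eq_Ex (int1_norm int_f) (int1Z s int_f) h) ExZ// E0 mulr0.
  have := Ex_eq0 (int1_norm int_f) (fun x => normr_ge0 _) E1.
  by apply: filterS => x /eqP; rewrite normr_eq0 => /eqP.
case: (herg A mA tA) => PA.
- have nA : {ae P, forall x, ~ A x}.
    by exists A; split => // x /=; rewrite not_notE.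
  apply: (sign (-1)); first by rewrite normrN1.
  apply: filterS2 inv nA => x hx nA; rewrite mulN1r ler0_norm// leNgt.
  by apply/negP => fx; apply: nA => a _ /=; rewrite hx.
- have nA : {ae P, forall x, A x}.
    by exists (~` A); split => //; [exact: measurableC|rewrite probability_setC// PA subee].
  apply: (sign 1); first by rewrite normr1.
  apply: filterS2 inv nA => x hx /(_ 0 I) /=; rewrite tau0 => fx.
  by rewrite mul1r gtr0_norm.
Qed.

End Action.

(** * The ergodic theorem on boxes *)

Section Vitali.
Context {R : realType} {d L : nat}.
Local Notation X := {ffun 'I_d -> 'I_L}.

Lemma card_ord_itv (a b : nat) : (#|[set i : 'I_L | (a <= i < b)%N]%SET| <= b - a)%N.
Proof.
rewrite cardE -(size_map val) -(size_iota a (b - a)).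
apply: uniq_leq_size; first by rewrite map_inj_uniq ?enum_uniq//; exact: val_inj.
move=> _ /mapP[i + ->]; rewrite mem_enum inE mem_iota => /andP[h1 h2].
by rewrite h1 subnKC// (leq_trans h1)// ltnW.
Qed.

Lemma card_box (lo : 'I_d -> nat) (k : nat) (A : {set X}) :
  (forall y, y \in A -> forall j, lo j <= y j < lo j + k)%N -> (#|A| <= k ^ d)%N.
Proof.
move=> hA.
pose F (j : 'I_d) := [set i : 'I_L | (lo j <= i < lo j + k)%N]%SET.
apply: (@leq_trans #|family F|).
  by apply/subset_leq_card/fintype.subsetP => y /hA h; apply/familyP => j; rewrite inE.
rewrite card_family foldrE big_map big_enum /=.
rewrite -[leqRHS](@iter_muln_1 k d) -[d in leqRHS]card_ord -big_const.
by apply: leq_prod => j _; rewrite (leq_trans (card_ord_itv _ _))// addKn.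
Qed.

Definition cube (x : X) (k : nat) := [set y : X | [forall j, x j <= y j < x j + k]%N]%SET.

Lemma cubeP (x : X) (k : nat) (y : X) : reflect (forall j, x j <= y j < x j + k)%N (y \in cube x k).
Proof. by rewrite inE; exact: forallP. Qed.

(* Greedy selection of the largest cube; the corners of the cubes that meet it
   lie in a cube of twice its size. *)
Lemma vitali_sum (a : X -> R) (lam : R) (k : X -> nat) (A : {set X}) :
  (forall x, 0 <= a x) ->
  (forall x, x \in A -> (0 < k x)%N) ->
  (forall x, x \in A -> lam * (k x ^ d)%:R <= \sum_(y in cube x (k x)) a y) ->
  0 <= lam ->
  lam * #|A|%:R <= 2 ^+ d * \sum_(y in (\bigcup_(x in A) cube x (k x))%SET) a y.
Proof.
move=> a0 + + lam0; have [m] := ubnP #|A|; elim: m A => // m IH A Am kpos hA.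
have [->|[x0 x0A]] := set_0Vmem A.
  by rewrite cards0 mulr0 mulr_ge0 ?exprn_ge0// sumr_ge0.
have [x xA xmax] := @arg_maxnP _ x0 (mem A) k x0A.
pose A' := [set y in A | [disjoint cube y (k y) & cube x (k x)]]%SET.
have A'A : A' \subset A by apply/fintype.subsetP => y; rewrite inE => /andP[].
have D : (#|(A :\: A')%SET| <= (2 * k x) ^ d)%N.
  (* If the cube at [y] meets the cube at [x] and is not larger, then [x - k + 1 <= y < x + k] in
     each coordinate, with [k = k x]. Truncation of the subtraction at 0 is harmless. *)
  apply: (card_box (lo := fun j => (x j).+1 - k x)%N) => y.
  rewrite !inE => /andP[+ yA] j; rewrite yA /=.
  have kyx := xmax y yA.
  case/pred0Pn => w /= /andP[/cubeP/(_ j)/andP[h1 h2] /cubeP/(_ j)/andP[h3 h4]].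
  by apply/andP; split; lia.
have xA' : x \notin A'.
  rewrite inE negb_and; apply/orP; right; apply/pred0Pn; exists x => /=.
  by rewrite andbb; apply/cubeP => j; rewrite leqnn -[ltnLHS]addn0 ltn_add2l kpos.
have A'm : (#|A'| < m)%N.
  rewrite -ltnS; apply: leq_ltn_trans Am; apply: proper_card.
  by rewrite properE A'A; apply/fintype.subsetPn; exists x.
have hA' y : y \in A' -> lam * (k y ^ d)%:R <= \sum_(w in cube y (k y)) a w.
  by move=> yA'; apply: hA; exact: (fintype.subsetP A'A).
have kA' y : y \in A' -> (0 < k y)%N.
  by move=> yA'; apply: kpos; exact: (fintype.subsetP A'A).
have IHA := IH A' A'm kA' hA'.
have -> : #|A| = (#|A'| + #|(A :\: A')%SET|)%N by rewrite -(cardsID A' A) (finset.setIidPr A'A).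
(* The cubes kept in [A'] are disjoint from the cube at [x], so the two masses add up inside the
   union. *)
have U : \sum_(y in (\bigcup_(x in A') cube x (k x))%SET) a y + \sum_(y in cube x (k x)) a y
    <= \sum_(y in (\bigcup_(x in A) cube x (k x))%SET) a y.
  rewrite [X in X + _]big_mkcond [X in _ + X]big_mkcond [leRHS]big_mkcond -big_split /=.
  apply: ler_sum => y _.
  case: ifPn => [/finset.bigcupP[w wA' yw]|_]; last first.
    rewrite add0r; case: ifPn => [yx|_]; last by case: ifP.
    by rewrite (_ : y \in _)//; apply/finset.bigcupP; exists x.
  have -> : y \in (\bigcup_(x in A) cube x (k x))%SET.
    by apply/finset.bigcupP; exists w => //; exact: (fintype.subsetP A'A).
  rewrite ifN ?addr0//; apply: contraL wA' => yx.
  rewrite inE negb_and; apply/orP; right; apply/pred0Pn; exists y => /=.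
  by rewrite yw yx.
apply: le_trans (ler_wpM2l _ U); last by rewrite exprn_ge0.
rewrite natrD mulrDr mulrDr; apply: lerD => //.
apply: (@le_trans _ _ (2 ^+ d * (lam * (k x ^ d)%:R))); last first.
  by rewrite ler_wpM2l ?exprn_ge0// hA.
rewrite mulrCA ler_wpM2l// -natrX -natrM ler_nat -expnMn.
exact: D.
Qed.
End Vitali.

(** * The maximal inequality for box averages *)

Section Maximal.
Context {disp : measure_display} {Omega : measurableType disp} {R : realType}.
Context {d : nat}.
Variables (P : probability Omega R) (tau : 'rV[int]_d -> Omega -> Omega).
Hypotheses (htau : is_action tau) (hstat : stationary P tau).
Implicit Types f g h : Omega -> R.
Local Notation L2 := (L2 P).
Local Notation Ex := (Ex P).
Local Notation int1 := (int1 P).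

Definition zpt {n} (x : {ffun 'I_d -> 'I_n}) : 'rV[int]_d := \row_j (x j : nat)%:Z.

Definition bsum n f (xi : Omega) : R := \sum_(x : {ffun 'I_d -> 'I_n}) f (tau (zpt x) xi).

Lemma bsum_cube L (x : {ffun 'I_d -> 'I_L}) n f xi : (forall y, 0 <= f y) ->
  (forall j, x j + n <= L)%N ->
  bsum n f (tau (zpt x) xi) <= \sum_(y in cube x n) f (tau (zpt y) xi).
Proof.
move=> f0 hL.
pose h (w : {ffun 'I_d -> 'I_n}) : {ffun 'I_d -> 'I_L} := [ffun j => insubd (x j) (x j + w j)%N].
have hE w j : h w j = (x j + w j)%N :> nat.
  by rewrite ffunE val_insubd (leq_trans _ (hL j)) ?ltn_add2l.
have hI : injective h.
  move=> w w' ww; apply/ffunP => j; apply: val_inj => /=.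
  by apply: (@addnI (x j)); rewrite -!hE ww.
rewrite /bsum (eq_bigr (fun w => f (tau (zpt (h w)) xi))); last first.
  move=> w _; rewrite (tauD htau); congr (f (tau _ _)).
  by apply/rowP => j; rewrite !mxE hE PoszD addrC.
rewrite (eq_bigl (fun w => w \in [set: {ffun 'I_d -> 'I_n}]%SET)); last by move=> w; rewrite inE.
rewrite -(big_imset (fun y => f (tau (zpt y) xi)) (h := h)) /=; last first.
  by move=> ? ? _ _; exact: hI.
rewrite big_mkcond [leRHS]big_mkcond; apply: ler_sum => y _.
case: ifPn => [/imsetP[w _ ->]|_]; last by case: ifP.
rewrite ifT//; apply/cubeP => j; rewrite hE leq_addr /=.
by rewrite ltn_add2l.
Qed.

(** Superlevel set of the maximal function over cubes of side at most [K]. Under this cap, cubes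
    with corner in a box of side [K] stay in a box of side [K + K]. *)
Definition exceed K lam f : set Omega :=
  \bigcup_(n in [set n | 0 < n <= K]%N) [set xi | lam * (n ^ d)%:R < bsum n f xi].

Lemma bsum_meas n f : measurable_fun setT f -> measurable_fun setT (bsum n f).
Proof.
move=> mf; apply: measurable_sum => x; exact: (comp_meas htau).
Qed.

Lemma exceed_meas K lam f : measurable_fun setT f -> measurable (exceed K lam f).
Proof.
move=> mf; apply: bigcup_measurable => n _.
rewrite -[X in measurable X]setTI; apply: measurable_fun_ltr => //.
exact: bsum_meas.
Qed.

(** Transference: along a single orbit, the points of the box that fall in [exceed] are corners of
    cubes with large sums, and [vitali_sum] counts them. *)
Lemma exceed_pointwise K lam f xi : 0 <= lam -> (forall y, 0 <= f y) ->
  lam * bsum K (\1_(exceed K lam f)) xi <= 2 ^+ d * bsum (K + K) f xi.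
Proof.
move=> lam0 f0.
pose T := {ffun 'I_d -> 'I_(K + K)}.
pose bad y := tau y xi \in exceed K lam f.
pose emb (x : {ffun 'I_d -> 'I_K}) : T := [ffun j => lshift K (x j)].
have zE x : zpt (emb x) = zpt x.
  by apply/rowP => j; rewrite !mxE ffunE.
pose A : {set T} := [set y : T | [forall j, (y : {ffun 'I_d -> 'I_(K + K)}) j < K]%N && bad (zpt y)]%SET.
have hk (y : T) : exists n, bad (zpt y) ->
    (0 < n <= K)%N /\ lam * (n ^ d)%:R < bsum n f (tau (zpt y) xi).
  have [|nb] := boolP (bad (zpt y)); last by exists 0%N.
  by rewrite /bad inE => -[n /= h1 h2]; exists n.
have {hk}[k hk] := choice hk.
have AA : bsum K (\1_(exceed K lam f)) xi <= #|A|%:R.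
  rewrite /bsum; under eq_bigr do rewrite indicE -/(bad _).
  rewrite -natr_sum ler_nat (eq_bigr (fun x => if bad (zpt x) then 1 else 0)%N); last first.
    by move=> x _; case: (bad _).
  rewrite -big_mkcond sum1dep_card -(card_imset _ (_ : injective emb)); last first.
    move=> x x' xx; apply/ffunP => j; have /ffunP/(_ j) := xx.
    by rewrite !ffunE => /lshift_inj.
  apply/subset_leq_card/fintype.subsetP => _ /imsetP[x hx ->].
  have hb : bad (zpt x) by move: hx; rewrite finset.in_set.
  by rewrite finset.in_set zE hb andbT; apply/forallP => j; rewrite ffunE /=.
apply: le_trans (ler_wpM2l lam0 AA) _.
apply: le_trans (@vitali_sum R d _ (fun y : T => f (tau (zpt y) xi)) lam k A _ _ _ lam0) _ => //.
- by move=> x; rewrite finset.in_set => /andP[_ /hk[/andP[]]].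
- move=> x; rewrite finset.in_set => /andP[/forallP xK /hk[/andP[k0 kK] h]].
  apply: le_trans (ltW h) _; apply: bsum_cube => // j.
  by apply: leq_add => //; exact: ltnW.
- rewrite ler_wpM2l ?exprn_ge0// /bsum [leRHS](bigID (fun y => y \in (\bigcup_(x in A) cube x (k x))%SET)) /=.
  by rewrite lerDl sumr_ge0.
Qed.

Lemma Ex_bsum n f : int1 f -> Ex (bsum n f) = (n ^ d)%:R * Ex f.
Proof.
move=> hf; rewrite /bsum Ex_sum; last by move=> x; exact: (int1_comp htau hstat).
under eq_bigr do rewrite (Ex_comp htau hstat)//.
by rewrite sumr_const card_ffun !card_ord mulr_natl.
Qed.

Lemma int1_bsum n f : int1 f -> int1 (bsum n f).
Proof. by move=> hf; apply: int1_sum => x; exact: (int1_comp htau hstat). Qed.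

Lemma Ex_indic (A : set Omega) : measurable A -> Ex (\1_A) = fine (P A).
Proof. by move=> mA; rewrite /Ex /Rintegral integral_indic// setIT. Qed.

Lemma int1_indic (A : set Omega) : measurable A -> int1 (\1_A).
Proof.
move=> mA; apply: (@int1_bounded _ _ _ _ _ 1); first exact: measurable_indic.
by move=> x; rewrite indicE; case: (x \in A); rewrite ?normr1 ?normr0.
Qed.

(** Stationarity turns both sums of [exceed_pointwise] into expectations. The covering gives
    [2 ^ d], and the ratio of the volumes of the boxes of sides [2 K] and [K] gives another
    [2 ^ d]. *)
Lemma exceed_le K lam f : 0 <= lam -> (forall y, 0 <= f y) -> int1 f ->
  lam * fine (P (exceed K lam f)) <= 4 ^+ d * Ex f.
Proof.
move=> lam0 f0 hf; have mE := exceed_meas K lam (int1_meas hf).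
case: K mE => [|K] mE.
  rewrite (_ : exceed 0 lam f = set0) ?measure0 ?mulr0 ?mulr_ge0 ?exprn_ge0 ?Ex_ge0//.
  by apply/seteqP; split => // x [n /= /andP[n0 nK]]; lia.
have := le_Ex (int1Z lam (int1_bsum K.+1 (int1_indic mE)))
  (int1Z (2 ^+ d) (int1_bsum (K.+1 + K.+1) hf)) (fun xi => exceed_pointwise K.+1 xi lam0 f0).
rewrite !ExZ; [|exact: int1_bsum|exact/int1_bsum/int1_indic].
rewrite !Ex_bsum//; last exact: int1_indic.
rewrite Ex_indic// addnn -muln2 expnMn natrM mulrCA.
rewrite (_ : 2 ^+ d * _ = (K.+1 ^ d)%:R * (4 ^+ d * Ex f)); last first.
  rewrite (_ : 4 = 2 * 2 :> R) ?exprMn ?natrX; last by rewrite -natrM.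
  by ring.
by rewrite ler_pM2l// ltr0n expn_gt0.
Qed.

Lemma maximal_ineq lam f : 0 <= lam -> (forall y, 0 <= f y) -> int1 f ->
  lam * fine (P (\bigcup_K exceed K lam f)) <= 4 ^+ d * Ex f.
Proof.
move=> lam0 f0 hf; have mE K := exceed_meas K lam (int1_meas hf).
have mU : measurable (\bigcup_K exceed K lam f) by exact: bigcupT_measurable.
have nd : nondecreasing_seq (fun K => exceed K lam f).
  move=> m n mn; apply/subsetPset => x [k /= /andP[k0 km] h].
  by exists k => //=; rewrite k0 (leq_trans km).
have cv := @nondecreasing_cvg_mu _ _ _ P _ mE mU nd.
have fc : lam * fine (P (exceed K lam f)) @[K --> \oo] --> lam * fine (P (\bigcup_K exceed K lam f)).
  apply: cvgM; first exact: cvg_cst.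
  apply: fine_cvg; rewrite fineK; first exact: cv.
  exact: fin_num_measure.
rewrite -(cvg_lim _ fc)//; apply: limr_le; first by apply/cvg_ex; eexists; exact: fc.
by apply: nearW => K; exact: exceed_le.
Qed.

End Maximal.

(** * Averages over the torus *)

Section TorusAverage.
Context {R : realType} {d : nat}.

Definition te {N} (j : 'I_d) : @torus d N := torus_proj N (unitv j).

(* [x] and [x + e_j] are not lifted to neighbouring points. *)
Definition wraps {N} (j : 'I_d) (x : @torus d N) : bool := (x 0 j : nat).+1 == N.

Definition tavg {N} (F : @torus d N -> R) : R :=
  (#|{: @torus d N}|%:R)^-1 * \sum_x F x.

Lemma lift_add N (j : 'I_d) (x : @torus d N) : (1 < N)%N -> ~~ wraps j x ->
  torus_lift (x + te j) = torus_lift x + unitv j.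
Proof.
case: N x => [|[|n]]// x _ nw; apply/rowP => i; rewrite !mxE /= /Zp_trunc /=.
have [ij|nij] := eqVneq i j; last first.
  by rewrite /= !mulr0n modn_small ?addn0 ?addr0// ?modn_small//; exact: ltn_ord.
have xi : ((x 0%R i : nat) + 1 < n.+2)%N.
  move: nw; rewrite /wraps -ij; have := ltn_ord (x 0 i); rewrite /Zp_trunc /=; lia.
by rewrite -[RHS]PoszD -[in RHS](modn_small xi).
Qed.

Lemma tavg_shift N (j : 'I_d) (F : @torus d N -> R) :
  tavg (fun x => F (x + te j)) = tavg F.
Proof.
by rewrite /tavg [in RHS](reindex_inj (addIr (te j))).
Qed.

Lemma tavgD N (F G : @torus d N -> R) : tavg (fun x => F x + G x) = tavg F + tavg G.
Proof. by rewrite /tavg big_split mulrDr. Qed.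

Lemma tavgZ N a (F : @torus d N -> R) : tavg (fun x => a * F x) = a * tavg F.
Proof. by rewrite /tavg -mulr_sumr mulrCA. Qed.

Lemma tavgB N (F G : @torus d N -> R) : tavg (fun x => F x - G x) = tavg F - tavg G.
Proof. by rewrite /tavg sumrB mulrBr. Qed.

Lemma tavg_sum N (I : Type) (r : seq I) (F : I -> @torus d N -> R) :
  tavg (fun x => \sum_(i <- r) F i x) = \sum_(i <- r) tavg (F i).
Proof. by rewrite /tavg exchange_big mulr_sumr. Qed.

Lemma tavg_ge0 N (F : @torus d N -> R) : (forall x, 0 <= F x) -> 0 <= tavg F.
Proof. by move=> h; rewrite mulr_ge0 ?invr_ge0// sumr_ge0. Qed.

Lemma ler_tavg N (F G : @torus d N -> R) : (forall x, F x <= G x) -> tavg F <= tavg G.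
Proof. by move=> h; rewrite ler_wpM2l ?invr_ge0// ler_sum. Qed.

Lemma eq_tavg N (F G : @torus d N -> R) : F =1 G -> tavg F = tavg G.
Proof. by move=> h; congr (_ * _); apply: eq_bigr. Qed.

Lemma normr_tavg N (F : @torus d N -> R) : `|tavg F| <= tavg (fun x => `|F x|).
Proof.
by rewrite normrM ger0_norm ?invr_ge0// ler_wpM2l ?invr_ge0// ler_norm_sum.
Qed.

Lemma card_torus N : (1 < N)%N -> #|{: @torus d N}| = (N ^ d)%N.
Proof. by case: N => [|[|n]]// _; rewrite card_mx card_ord mul1n. Qed.

Lemma card_torus_gt0 N : (0 < #|{: @torus d N}|)%N.
Proof. by apply/card_gt0P; exists 0. Qed.

Lemma tavg_cst N (a : R) : @tavg N (fun=> a) = a :> R.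
Proof.
by rewrite /tavg sumr_const -[a *+ _]mulr_natr mulrCA mulVf ?mulr1// pnatr_eq0 -lt0n card_torus_gt0.
Qed.

(** The [N] slices [x_j = t] partition the torus and have equal averages by translation invariance;
    the wrapping points form the slice [t = -1]. *)
Lemma tavg_wraps N (j : 'I_d) : (1 < N)%N ->
  tavg (fun x : @torus d N => (wraps j x)%:R) = N%:R^-1.
Proof.
case: N => [|[|n]]// _.
pose S (t : 'Z_n.+2) := tavg (fun x : @torus d n.+2 => (x 0 j == t)%:R).
have S1 t : S t = S (t + 1).
  rewrite /S -[RHS](tavg_shift j); apply: eq_tavg => x.
  congr (_%:R); rewrite !mxE /= eqxx.
  by rewrite -[in LHS](inj_eq (addIr 1)).
have Sn (k : nat) : S k%:R = S 0.
  by elim: k => // k <-; rewrite -natr1 -S1.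
have St t : S t = S 0 by rewrite -[t]natr_Zp Sn.
have tot : \sum_t S t = 1.
  rewrite -tavg_sum -[RHS](tavg_cst n.+2); apply: eq_tavg => x.
  rewrite (bigD1 (x 0 j))//= eqxx big1 ?addr0// => t.
  by rewrite eq_sym => /negPf ->.
have -> : tavg (fun x : @torus d n.+2 => (wraps j x)%:R) = S (-1).
  apply: eq_tavg => x; congr (_%:R).
  rewrite /wraps -val_eqE /= /Zp_trunc /= [(1 %% _)%N]modn_small// subn1 modn_small//.
have h : S 0 * n.+2%:R = 1.
  apply: etrans tot; rewrite (eq_bigr (fun=> S 0))// sumr_const card_ord.
  by rewrite -[RHS]mulr_natr.
rewrite St -div1r.
by apply: (canRL (mulfK _)); rewrite ?pnatr_eq0.
Qed.

Lemma tsum_bsum N (F : 'rV[int]_d -> R) : (1 < N)%N ->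
  \sum_(x : @torus d N) F (torus_lift x) = \sum_(x : {ffun 'I_d -> 'I_N}) F (zpt x).
Proof.
case: N => [|[|n]]// _.
pose h (x : {ffun 'I_d -> 'I_n.+2}) : @torus d n.+2 := \row_j x j.
rewrite (reindex h); last first.
  exists (fun x : @torus d n.+2 => [ffun j => x 0 j]) => x _.
    by apply/ffunP => j; rewrite ffunE mxE.
  by apply/rowP => j; rewrite mxE ffunE.
by apply: eq_bigr => x _; congr F; apply/rowP => j; rewrite !mxE.
Qed.

End TorusAverage.

(** * Almost sure convergence of averages along an orbit *)

Section Ergodic.
Context {disp : measure_display} {Omega : measurableType disp} {R : realType}.
Context {d : nat}.
Variables (P : probability Omega R) (tau : 'rV[int]_d -> Omega -> Omega).
Hypotheses (htau : is_action tau) (hstat : stationary P tau) (herg : ergodic P tau).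
Implicit Types f g h : Omega -> R.
Local Notation L2 := (L2 P).
Local Notation Ex := (Ex P).
Local Notation int1 := (int1 P).

Definition oavg (N : nat) f (xi : Omega) : R :=
  tavg (fun x : @torus d N => f (tau (torus_lift x) xi)).

Lemma oavg_bsum N f xi : (1 < N)%N -> oavg N f xi = (N ^ d)%:R^-1 * bsum tau N f xi.
Proof.
by move=> N1; rewrite /oavg /tavg card_torus// (tsum_bsum (fun z => f (tau z xi))).
Qed.

(** Constants plus coboundaries: for bounded [u], the averages converge at every point by
    telescoping. *)
Definition cob (a : R) (u : 'I_d -> Omega -> R) (x : Omega) :=
  a + \sum_j (u j (tau (unitv j) x) - u j x).

Lemma cob_L2 a (u : 'I_d -> Omega -> R) (C : R) : (forall j, measurable_fun setT (u j)) ->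
  (forall j x, `|u j x| <= C) -> L2 (cob a u).
Proof.
move=> mu uC; apply: L2D; first exact: L2_cst.
apply: L2_sum => j; have L2u : L2 (u j) by exact: (@L2_bounded _ _ _ _ _ C).
by apply: L2B => //; exact: (L2_comp htau hstat).
Qed.

Lemma Ex_cob a (u : 'I_d -> Omega -> R) (C : R) : (forall j, measurable_fun setT (u j)) ->
  (forall j x, `|u j x| <= C) -> Ex (cob a u) = a.
Proof.
move=> mu uC.
have I j : int1 (u j) by exact: (@int1_bounded _ _ _ _ _ C).
have I' j : int1 (fun x => u j (tau (unitv j) x)) by exact: (int1_comp htau hstat).
rewrite ExD; [|exact: int1_cst|by apply: int1_sum => j; exact: int1B].
rewrite Ex_cst Ex_sum; last by move=> j; exact: int1B.
rewrite big1 ?addr0// => j _.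
by rewrite ExB// (Ex_comp htau hstat)// subrr.
Qed.

(** A function orthogonal to the constants has mean zero, and one orthogonal to the coboundaries of
    bounded functions is invariant under each [unitv j]; ergodicity makes it null. *)
Lemma cob_dense_L2 f (e : R) : L2 f -> 0 < e -> exists (a : R) (u : 'I_d -> Omega -> R) (C : R),
  [/\ forall j, measurable_fun setT (u j), forall j x, `|u j x| <= C &
   Ex (fun x => (f x - cob a u x) ^+ 2) < e].
Proof.
move=> hf e0.
pose M : set ('I_1 -> Omega -> R) := [set F | exists (a : R) (u : 'I_d -> Omega -> R) (C : R),
  [/\ forall j, measurable_fun setT (u j), forall j x, `|u j x| <= C & F = (fun _ => cob a u)]].
have [||a F G|v L2v orth|//|G [a [u [C [mu uC ->]]]]] := @L2_dense _ _ _ P 'I_1 M _ _ _ _ (fun=> f) _ e e0.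
- by move=> F [a [u [C [mu uC ->]]]] _; exact: (cob_L2 _ mu uC).
- exists 0, (fun _ _ => 0), 0; split => // [j x|]; first by rewrite normr0.
  by apply/funext => i; apply/funext => x; rewrite /cob big1 ?addr0// => j _; rewrite subrr.
- move=> [b [u [C [mu uC ->]]]] [c [w [D [mw wD ->]]]].
  exists (a * b + c), (fun j x => a * u j x + w j x), (`|a| * C + D); split.
  + by move=> j; apply: measurable_funD => //; exact: measurable_funM.
  + move=> j x; rewrite (le_trans (ler_normD _ _))// lerD// normrM ler_wpM2l//.
  + apply/funext => i; apply/funext => x; rewrite /cob mulrDr mulr_sumr.
    rewrite addrACA; congr (_ + _); rewrite -big_split /=; apply: eq_bigr => j _.
    by ring.
- rewrite big_ord1; set g := v ord0; have L2g : L2 g by exact: L2v.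
  have o a (u : 'I_d -> Omega -> R) (C : R) : (forall j, measurable_fun setT (u j)) -> (forall j x, `|u j x| <= C) ->
      Ex (fun x => g x * cob a u x) = 0.
    move=> mu uC; have := orth (fun _ => cob a u); rewrite big_ord1; apply.
    by exists a, u, C.
  have E0 : Ex g = 0.
    rewrite -(@o 1 (fun _ _ => 0) 0) => [|//|j x]; last by rewrite normr0.
    apply: eq_Ex => x; rewrite /cob big1 ?addr0 ?mulr1// => j _.
    by rewrite subrr.
  have inv j : {ae P, forall x, g (tau (unitv j) x) = g x}.
    have L2c b : L2 (fun x => g (tau b x)) by exact: (L2_comp htau hstat).
    have : {ae P, forall x, g (tau (- unitv j) x) - g x = 0}.
      apply: ae0_of_orth; first by apply: L2_int1; exact: L2B.
      move=> u mu u1.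
      have L2u : L2 u by exact: (@L2_bounded _ _ _ _ _ 1).
      have L2uc : L2 (fun x => u (tau (unitv j) x)) by exact: (L2_comp htau hstat).
      have H : Ex (fun x => g x * (u (tau (unitv j) x) - u x)) = 0.
        rewrite -(@o 0 (fun i => if i == j then u else (fun=> 0)) 1).
        - apply: eq_Ex => x; rewrite /cob (bigD1 j)//= eqxx big1 ?addr0 ?add0r// => i.
          by move=> /negPf ->; rewrite subrr.
        - by move=> i; case: ifP.
        - by move=> i x; case: ifP => // _; rewrite normr0.
      have -> : Ex (fun x => (g (tau (- unitv j) x) - g x) * u x)
              = Ex (fun x => g (tau (- unitv j) x) * u x) - Ex (fun x => g x * u x).
        rewrite -ExB; [|exact: L2_mul|exact: L2_mul].
        by apply: eq_Ex => x; rewrite mulrBl.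
      rewrite -(Ex_comp htau hstat (unitv j) (L2_mul (L2c (- unitv j)) L2u)).
      rewrite -ExB; [|exact: (int1_comp htau hstat (unitv j) (L2_mul (L2c (- unitv j)) L2u))|exact: L2_mul].
      rewrite -[RHS]H; apply: eq_Ex => x.
      by rewrite (tauK htau) mulrBr.
    move/(ae_comp htau hstat (unitv j)); apply: filterS => x /=.
    by rewrite (tauK htau) => /eqP; rewrite subr_eq0 => /eqP <-.
  have g0 := ergodic_zero htau hstat herg L2g E0 inv.
  rewrite -[RHS](Ex_cst P); apply: ae_eq_Ex; [exact: L2_sqr|exact: int1_cst|].
  by apply: filterS g0 => x ->; rewrite expr0n.
- by rewrite big_ord1 => h; exists a, u, C.
Qed.

(** Truncation brings [f] into [L^2], and on a probability space the [L^2] norm bounds the [L^1]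
    norm. *)
Lemma cob_dense f (e : R) : int1 f -> 0 < e -> exists (a : R) (u : 'I_d -> Omega -> R) (C : R),
  [/\ forall j, measurable_fun setT (u j), forall j x, `|u j x| <= C &
   Ex (fun x => `|f x - cob a u x|) < e].
Proof.
move=> hf e0; have e2 : 0 < e / 2 by rewrite divr_gt0.
have [N hN] := trunc_L1 hf e2.
have h1 := hN N (leqnn _); set g := fun x => trunc N%:R (f x) in h1.
have mg : measurable_fun setT g by apply: trunc_meas; exact: int1_meas hf.
have L2g : L2 g by apply: (@L2_bounded _ _ _ _ _ N%:R) => // x; exact: trunc_bounded.
have [a [u [C [mu uC h2]]]] := cob_dense_L2 L2g (exprn_gt0 2 e2).
exists a, u, C; split => //.
have L2w : L2 (fun x => g x - cob a u x) by apply: L2B => //; exact: (cob_L2 _ mu uC).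
have mn : measurable_fun setT (fun x => `|g x - cob a u x|).
  exact: (measurableT_comp (@normr_measurable R setT) (L2_meas L2w)).
have L2n : L2 (fun x => `|g x - cob a u x|).
  by apply: L2_le L2w => // x; rewrite normr_id.
have h3 : Ex (fun x => `|g x - cob a u x|) < e / 2.
  rewrite -ltr_sqr ?nnegrE ?Ex_ge0 ?(ltW e2)//.
  apply: le_lt_trans (Ex_sqr_le L2n) _.
  by under eq_Ex do rewrite real_normK ?num_real//.
have I1 : int1 (fun x => `|f x - g x|).
  by apply/int1_norm/int1B => //; exact: L2_int1.
apply: le_lt_trans (_ : _ <= Ex (fun x => `|f x - g x| + `|g x - cob a u x|)) _.
  apply: le_Ex => [||x].
  - by apply/int1_norm/int1B => //; exact/L2_int1/(cob_L2 _ mu uC).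
  - by apply: int1D => //; exact: L2_int1.
  - by rewrite -[f x - cob a u x](subrKA (g x)) ler_normD.
by rewrite ExD//; [rewrite (splitr e) ltrD|exact: L2_int1].
Qed.

(** By invariance of the average under [te j], [u j] at the lift of [x] plus [unitv j] can be
    compared with [u j] at the lift of [x + te j]. They agree except at the wrapping points, a
    fraction [1 / N] of the torus for each direction. *)
Lemma oavg_cob N a (u : 'I_d -> Omega -> R) (C : R) xi : (1 < N)%N -> (forall j x, `|u j x| <= C) ->
  `|oavg N (cob a u) xi - a| <= (2 * C * d%:R) / N%:R.
Proof.
move=> N1 uC.
have -> : oavg N (cob a u) xi - a = \sum_j tavg (fun x : @torus d N =>
    u j (tau (torus_lift x + unitv j) xi) - u j (tau (torus_lift (x + te j)) xi)).
  rewrite -[X in _ - X = _](@tavg_cst R d N a) -tavgB -tavg_sum.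
  rewrite (@eq_tavg _ _ _ _ (fun x : @torus d N => \sum_j
    (u j (tau (torus_lift x + unitv j) xi) - u j (tau (torus_lift x) xi)))); last first.
    move=> x; rewrite /cob addrAC subrr add0r; apply: eq_bigr => j _.
    by rewrite (tauD htau) [unitv j + _]addrC.
  rewrite !tavg_sum; apply: eq_bigr => j _; rewrite !tavgB; congr (_ - _).
  by rewrite (tavg_shift j (fun x => u j (tau (torus_lift x) xi))).
apply: (le_trans (ler_norm_sum _ _ _)).
have -> : 2 * C * d%:R / N%:R = \sum_(j < d) 2 * C / N%:R.
  by rewrite sumr_const card_ord -[RHS]mulr_natr mulrAC.
apply: ler_sum => j _; apply: (le_trans (normr_tavg _)).
rewrite -(tavg_wraps (R := R) j N1) -tavgZ; apply: ler_tavg => x.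
have [w|nw] := boolP (wraps j x).
  rewrite mulr1 (le_trans (ler_normB _ _))// mulr2n mulrDl mul1r.
  by apply: lerD.
by rewrite lift_add// subrr normr0 mulr0.
Qed.

(** Banach's principle: the maximal inequality extends almost sure convergence from the dense class
    of constants plus coboundaries to every integrable [f]. *)
Theorem ergodic_theorem f : int1 f ->
  {ae P, forall xi, oavg N f xi @[N --> \oo] --> Ex f}.
Proof.
move=> hf.
(* An [L^1] error [1 / ((k + 1) (n + 1))] against the level [lam = 1 / (k + 1)] leaves probability
   at most [4 ^ d / (n + 1)], so the exceptional sets [E n] have a null intersection. The [n] that
   works may depend on [xi]. *)
have ek k n : 0 < (k.+1%:R * n.+1%:R : R)^-1 by rewrite invr_gt0 mulr_gt0.
have bad0 k : {ae P, forall xi, exists (a : R) (u : 'I_d -> Omega -> R) (C : R),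
   [/\ `|a - Ex f| <= k.+1%:R^-1, forall j x, `|u j x| <= C &
    forall N, (1 < N)%N -> oavg N (fun x => `|f x - cob a u x|) xi <= k.+1%:R^-1]}.
  have h n := cob_dense hf (ek k n).
  have [a ha] := choice h; have [u hu] := choice ha; have [C {}h] := choice hu.
  pose w n x := `|f x - cob (a n) (u n) x|.
  have Iw' n : int1 (fun x => f x - cob (a n) (u n) x).
    by have [mu uC _] := h n; apply: int1B => //; exact/L2_int1/(cob_L2 _ mu uC).
  have Iw n : int1 (w n) by exact: int1_norm.
  pose lam : R := k.+1%:R^-1.
  pose E n := \bigcup_K exceed tau K lam (w n).
  have mE n : measurable (E n).
    by apply: bigcupT_measurable => K; apply: (exceed_meas htau); exact: int1_meas (Iw n).
  have mEE : measurable (\bigcap_n E n) by exact: bigcapT_measurable.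
  exists (\bigcap_n E n); split => //.
    apply/eqP; rewrite eq_le measure_ge0 andbT -(fineK (fin_num_measure P _ mEE)) lee_fin.
    apply/ler_addgt0Pr => e e0; rewrite add0r.
    have e4 : 0 < e / 4 ^+ d by rewrite divr_gt0 ?exprn_gt0.
    have [n hn] := natSinv_small e4; have {}hn := hn n (leqnn n).
    have [mu uC hw] := h n.
    have lam0 : 0 < lam by rewrite invr_gt0.
    have := maximal_ineq htau hstat (ltW lam0) (fun y => normr_ge0 _) (Iw n).
    rewrite -/(E n) => hm.
    have le1 : fine (P (\bigcap_n E n)) <= fine (P (E n)).
      rewrite fine_le ?fin_num_measure//; apply: le_measure; rewrite ?inE//.
      by move=> x hx; exact: hx.
    apply: (le_trans le1).
    have hm2 : lam * fine (P (E n)) <= lam * e.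
      apply: (le_trans hm); rewrite mulrC -ler_pdivlMr ?exprn_gt0// -mulrA.
      apply: le_trans (ltW hw) _; rewrite invfM ler_wpM2l// ltW//.
    by rewrite ler_pM2l in hm2.
  move=> xi /= nb; apply: contrapT => nE0; apply: nb.
  have [n nE] : exists n, ~ E n xi.
    apply: contrapT => hE; apply: nE0 => n _; apply: contrapT => nE; apply: hE.
    by exists n.
  have [mu uC hw] := h n.
  exists (a n), (u n), (C n); split => //.
    rewrite -(Ex_cob (a n) mu uC) distrC -ExB//; last exact/L2_int1/(cob_L2 _ mu uC).
    apply: (le_trans (normr_Ex (Iw' n))); apply: (le_trans (ltW hw)).
    by rewrite invfM ler_piMr// invf_le1// ler1n.
  move=> N N1; rewrite oavg_bsum// mulrC ler_pdivrMr ?ltr0n ?expn_gt0 ?(ltnW N1)//.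
  rewrite leNgt; apply/negP => hb; apply: nE; exists N => //; exists N => //=.
  by rewrite leqnn (ltnW N1).
have := ae_foralln bad0; apply: filterS => xi hxi.
apply/cvgrPdist_lt => e e0.
have [k hk] := natSinv_small (divr_gt0 e0 (ltr0n R 3)).
have {}hk := hk k (leqnn k).
have [a [u [C [ha uC hw]]]] := hxi k.
have C0 : 0 <= `|2 * C * d%:R| + 1 by rewrite addr_ge0.
have e3 : 0 < e / 3 / (`|2 * C * d%:R| + 1).
  by rewrite divr_gt0 ?divr_gt0// ltr_wpDl.
have [N0 hN0] := natSinv_small e3.
exists (maxn 2 N0.+1) => // N /=; rewrite geq_max => /andP[N2 NN0].
have h1 := hw N N2; have h2 := oavg_cob a xi N2 uC.
have h3 : `|oavg N f xi - oavg N (cob a u) xi| <= k.+1%:R^-1.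
  apply: le_trans h1; rewrite /oavg -tavgB; exact: normr_tavg.
have h4 : 2 * C * d%:R / N%:R < e / 3.
  apply: (@le_lt_trans _ _ ((`|2 * C * d%:R| + 1) / N%:R)).
    by rewrite ler_wpM2r ?invr_ge0// (le_trans (ler_norm _))// lerDl.
  case: N N2 NN0 {h1 h2 h3} => // N _ NN0.
  by rewrite mulrC -ltr_pdivlMr ?hN0// ltr_wpDl.
rewrite distrC.
have -> : oavg N f xi - Ex f = (oavg N f xi - oavg N (cob a u) xi)
   + (oavg N (cob a u) xi - a) + (a - Ex f) by ring.
apply: (le_lt_trans (ler_normD _ _)); move: (ler_normD (oavg N f xi - oavg N (cob a u) xi)
  (oavg N (cob a u) xi - a)); move: hk h2 h3 h4 ha.
move: (k.+1%:R^-1 : R) => r; lra.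
Qed.

End Ergodic.

(** * The Dirichlet form of the environment *)

Section Neighbours.
Context {d : nat}.

Lemma unitvE (j i : 'I_d) : unitv j 0 i = (i == j)%:R.
Proof. by rewrite mxE eqxx. Qed.

Lemma unitv_nbr (j : 'I_d) : nbr d (unitv j).
Proof.
rewrite /nbr /= (bigD1 j)//= unitvE eqxx big1 ?addr0 ?expr1n// => i.
by rewrite unitvE => /negPf ->; rewrite expr0n.
Qed.

Lemma opp_nbr (z : 'rV[int]_d) : nbr d z -> nbr d (- z).
Proof.
by rewrite /nbr /= => <-; apply: eq_bigr => j _; rewrite mxE sqrrN.
Qed.

Lemma nbrP (z : 'rV[int]_d) : nbr d z -> exists j, z = unitv j \/ z = - unitv j.
Proof.
rewrite /nbr /= => h.
have [j zj] : exists j, z 0 j != 0.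
  apply: contrapT => hn; move: h; rewrite big1// => j _.
  by apply/eqP; rewrite sqrf_eq0; apply/negPn/negP => zj; apply: hn; exists j.
exists j; move: h; rewrite (bigD1 j)//=.
set S := \sum_(i < d | _) _ => h.
have S0 : 0 <= S by apply: sumr_ge0 => i _; exact: sqr_ge0.
have z1 : 1 <= z 0 j ^+ 2 by rewrite -gtz0_ge1 exprn_even_gt0.
have Sz : S = 0 by lia.
have zz i : i != j -> z 0 i = 0.
  move=> ij; apply/eqP; rewrite -sqrf_eq0; apply/eqP.
  by move/eqP: Sz; rewrite psumr_eq0 => [/allP/(_ i)|k _]; [rewrite mem_index_enum ij => /(_ isT)/eqP|exact: sqr_ge0].
have : z 0 j ^+ 2 = 1 by lia.
move/eqP; rewrite sqrf_eq1 => /orP[/eqP zj1|/eqP zj1]; [left|right]; apply/rowP => i.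
  by rewrite unitvE; case: eqVneq => [->|/zz].
by rewrite [RHS]mxE unitvE; case: eqVneq => [->|/zz ->]; rewrite ?oppr0.
Qed.

Lemma unitv_inj : injective (@unitv d).
Proof.
move=> i j /rowP/(_ i); rewrite !unitvE eqxx; by case: eqVneq.
Qed.

Lemma unitv_neq_opp (i j : 'I_d) : unitv i <> - unitv j.
Proof.
move=> /rowP/(_ i); rewrite unitvE [RHS]mxE unitvE eqxx; by case: (i == j).
Qed.

Lemma big_nbr (T : Type) (idx : T) (op : Monoid.com_law idx) (F : 'rV[int]_d -> T) :
  \big[op/idx]_(z \in nbr d) F z = \big[op/idx]_(j < d) op (F (unitv j)) (F (- unitv j)).
Proof.
pose r := [seq unitv j | j <- enum 'I_d] ++ [seq - unitv j | j <- enum 'I_d].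
have ur : uniq r.
  have u2 : injective (fun j : 'I_d => - unitv j) by move=> i j /oppr_inj/unitv_inj.
  rewrite cat_uniq (map_inj_uniq unitv_inj) (map_inj_uniq u2) enum_uniq andbT.
  apply/hasPn => _ /mapP[j _ ->]; apply/negP => /mapP[i _] /esym.
  exact: unitv_neq_opp.
have -> : nbr d = [set` r].
  apply/seteqP; split => z /=.
    move=> /nbrP[j [->|->]]; rewrite mem_cat; apply/orP; [left|right].
      by apply/mapP; exists j; rewrite ?mem_enum.
    by apply/mapP; exists j; rewrite ?mem_enum.
  rewrite mem_cat => /orP[] /mapP[j _ ->]; first exact: unitv_nbr.
  exact/opp_nbr/unitv_nbr.
rewrite -fsbig_seq// big_cat !big_map big_split /=.
by congr (op _ _); rewrite enumT.
Qed.

End Neighbours.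

Section ExpectationLinear.
Context {disp : measure_display} {Omega : measurableType disp} {R : realType}.
Variable P : probability Omega R.

Lemma ExZD (a : R) (f g : Omega -> R) : int1 P f -> int1 P g ->
  Ex P (fun x => a * f x + g x) = a * Ex P f + Ex P g.
Proof. by move=> hf hg; rewrite -ExZ// -ExD//; exact: int1Z. Qed.

End ExpectationLinear.

(** Common algebra of the two energy estimates: [f1], [f2], [f12] are the forms and [r1], [r2],
    [r12] the inner products of the two errors, and the four identities test two equations against
    two errors. The first plus the fourth gives [f1 + f2], the third minus the second gives
    [w (r1 + r2)]. The Young weights [w / 4] and [1 / 4] let half of the left side be absorbed. *)
Lemma energy_arith (R : realFieldType) (w f1 f2 f12 r1 r2 r12 A1 A2 B1 B2 a11 a12 a21 a22 b11 b12 b21 b22 : R) :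
  0 < w -> 0 <= f1 -> 0 <= f2 -> 0 <= r1 -> 0 <= r2 -> 0 <= A1 -> 0 <= A2 -> 0 <= B1 -> 0 <= B2 ->
  f1 - w * r12 = - a11 - b11 -> f12 - w * r2 = - a12 - b12 ->
  f12 + w * r1 = - a21 - b21 -> f2 + w * r12 = - a22 - b22 ->
  `|a11| <= A1 / w + w / 4 * r1 -> `|a12| <= A1 / w + w / 4 * r2 ->
  `|a21| <= A2 / w + w / 4 * r1 -> `|a22| <= A2 / w + w / 4 * r2 ->
  `|b11| <= B1 + 1 / 4 * f1 -> `|b12| <= B1 + 1 / 4 * f2 ->
  `|b21| <= B2 + 1 / 4 * f1 -> `|b22| <= B2 + 1 / 4 * f2 ->
  f1 + f2 + w * (r1 + r2) <= 4 * (w^-1 + 1) * (A1 + A2 + B1 + B2).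
Proof.
move=> w0 F1 F2 R1 R2 hA1 hA2 hB1 hB2 i1 i2 i3 i4; rewrite !ler_norml.
move=> /andP[y1 y1'] /andP[y2 y2'] /andP[y3 y3'] /andP[y4 y4'].
move=> /andP[z1 z1'] /andP[z2 z2'] /andP[z3 z3'] /andP[z4 z4'].
have w' : 0 < w^-1 by rewrite invr_gt0.
have T : f1 + f2 + w * (r1 + r2) <= 4 * (A1 / w + A2 / w + B1 + B2) by rewrite mulrDr; lra.
apply: (le_trans T).
have p1 : 0 <= w^-1 * B1 by rewrite mulr_ge0// ltW.
have p2 : 0 <= w^-1 * B2 by rewrite mulr_ge0// ltW.
have -> : 4 * (w^-1 + 1) * (A1 + A2 + B1 + B2) =
  4 * (A1 / w + A2 / w + B1 + B2) + 4 * (w^-1 * B1 + w^-1 * B2 + A1 + A2) by ring.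
by rewrite lerDl mulr_ge0// !addr_ge0.
Qed.

Lemma big_option (R : zmodType) (T : finType) (F : option T -> R) :
  \sum_o F o = F None + \sum_t F (Some t).
Proof.
rewrite (bigD1 None)//=; congr (_ + _).
rewrite (reindex_omap Some id); last by case.
by apply: eq_bigl => t; rewrite /= eqxx.
Qed.

Section Environment.
Context {disp : measure_display} {Omega : measurableType disp} {R : realType}.
Context {d : nat}.
Variables (P : probability Omega R) (tau : 'rV[int]_d -> Omega -> Omega).
Variable c : 'rV[int]_d -> 'rV[int]_d -> Omega -> R.
Hypotheses (htau : is_action tau) (hstat : stationary P tau).
Hypotheses (hc : is_conductance c) (hcov : covariant tau c).
Hypothesis hc2 : forall z, nbr d z -> ('E_P[fun xi => (c 0 z xi ^+ 2)%R] < +oo)%E.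
Implicit Types f g h : Omega -> R.
Local Notation L2 := (L2 P).
Local Notation Ex := (Ex P).
Local Notation int1 := (int1 P).

Definition cnd j : Omega -> R := c 0 (unitv j).
(** With the square root as weight of the differences, the Dirichlet form is an unweighted sum of
    [L^2] products, to which completeness and Cauchy-Schwarz apply directly. *)
Definition sq j (x : Omega) : R := Num.sqrt (cnd j x).
Definition gr j f (x : Omega) := sq j x * (f (tau (unitv j) x) - f x).
Definition domE f := L2 f /\ forall j, L2 (gr j f).

Lemma cnd_gt0 j x : 0 < cnd j x.
Proof. by have [_ h _] := hc 0 (unitv_nbr j); rewrite add0r in h; exact: h. Qed.

Lemma cnd_meas j : measurable_fun setT (cnd j).
Proof. by have [h _ _] := hc 0 (unitv_nbr j); rewrite add0r in h; exact: h. Qed.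

Lemma sq_meas j : measurable_fun setT (sq j).
Proof. exact: (measurableT_comp (continuous_measurable_fun (@sqrt_continuous R)) (cnd_meas j)). Qed.

Lemma sq_ge0 j x : 0 <= sq j x. Proof. exact: sqrtr_ge0. Qed.

Lemma sqr_sq j x : sq j x ^+ 2 = cnd j x.
Proof. by rewrite sqr_sqrtr// ltW// cnd_gt0. Qed.

Lemma cndN j x : c 0 (- unitv j) x = cnd j (tau (- unitv j) x).
Proof.
have [_ _ h] := hc 0 (opp_nbr (unitv_nbr j)); rewrite add0r in h; rewrite h.
have := @hcov 0 (unitv j) (- unitv j) x; rewrite add0r addrN subr0 => -> //.
exact: unitv_nbr.
Qed.

Lemma cnd_shift (z : 'rV[int]_d) j x : c z (z + unitv j) x = cnd j (tau z x).
Proof.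
have := @hcov 0 (unitv j) z x; rewrite add0r subr0 addrC => -> //.
exact: unitv_nbr.
Qed.

Lemma cnd_L2 j : L2 (cnd j).
Proof.
apply: L2_intro; first exact: cnd_meas.
apply/integrableP; split; first by apply/measurable_EFinP/measurable_funX/cnd_meas.
under eq_integral do rewrite /= ger0_norm ?sqr_ge0//.
by have := hc2 (unitv_nbr j); rewrite unlock.
Qed.

Lemma cnd_int1 j : int1 (cnd j). Proof. exact: L2_int1 (cnd_L2 j). Qed.

Lemma sq_L2 j : L2 (sq j).
Proof.
apply: L2_intro; first exact: sq_meas.
by under eq_fun do rewrite sqr_sq; exact: cnd_int1.
Qed.

Lemma gr_meas j f : measurable_fun setT f -> measurable_fun setT (gr j f).
Proof.
move=> mf; apply: measurable_funM; first exact: sq_meas.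
by apply: measurable_funB => //; exact: (comp_meas htau).
Qed.

Lemma gr_lin j a f g x : gr j (fun y => a * f y + g y) x = a * gr j f x + gr j g x.
Proof. by rewrite /gr; ring. Qed.

Lemma domE_lin a f g : domE f -> domE g -> domE (fun x => a * f x + g x).
Proof.
move=> [f1 f2] [g1 g2]; split; first by apply: L2D => //; exact: L2Z.
move=> j; rewrite (_ : gr j _ = (fun x => a * gr j f x + gr j g x)); last first.
  by apply/funext => x; exact: gr_lin.
by apply: L2D => //; exact: L2Z.
Qed.

Lemma domE_bounded f (C : R) : measurable_fun setT f -> (forall x, `|f x| <= C) -> domE f.
Proof.
move=> mf fC; split; first exact: (L2_bounded _ mf fC).
move=> j; apply: (L2_le (g := fun x => 2 * C * sq j x)); first exact: gr_meas.
  move=> x; rewrite /gr mulrC !normrM; apply: ler_wpM2r => //.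
  rewrite -normrM (le_trans (ler_normB _ _))//.
  have C0 : 0 <= C by rewrite (le_trans _ (fC x)).
  by rewrite ger0_norm ?mulr_ge0// mulr2n mulrDl mul1r; apply: lerD.
exact/L2Z/sq_L2.
Qed.

(** By stationarity the terms of [- unitv j] and [unitv j] have the same expectation, and the
    resulting factor 2 cancels the one half of the form. *)
Lemma form_diag_ereal f : measurable_fun setT f ->
  dirichlet_form P tau c f f = (\sum_(j < d) \int[P]_x (gr j f x ^+ 2)%:E)%E.
Proof.
move=> mf; rewrite /dirichlet_form big_nbr.
have h j : ('E_P[fun xi => (c 0 (- unitv j) xi * (f (tau (- unitv j) xi) - f xi) * (f (tau (- unitv j) xi) - f xi))%R])%E
   = (\int[P]_x (gr j f x ^+ 2)%:E)%E.
  rewrite unlock -(integral_comp htau hstat (- unitv j) (f := fun x => (gr j f x ^+ 2)%:E)).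
  - apply: eq_integral => x _; congr EFin.
    by rewrite cndN /gr (tauNK htau) exprMn sqr_sq; ring.
  - by apply/measurable_EFinP/measurable_funX/gr_meas.
  - by move=> x; rewrite lee_fin sqr_ge0.
have h' j : ('E_P[fun xi => (c 0 (unitv j) xi * (f (tau (unitv j) xi) - f xi) * (f (tau (unitv j) xi) - f xi))%R])%E
   = (\int[P]_x (gr j f x ^+ 2)%:E)%E.
  rewrite unlock; apply: eq_integral => x _; congr EFin.
  by rewrite /gr exprMn sqr_sq /cnd; ring.
rewrite (eq_bigr (fun j => (\int[P]_x (gr j f x ^+ 2)%:E) *+ 2)%E); last first.
  by move=> j _; rewrite h h'.
rewrite ge0_sume_distrr; last first.
  by move=> j _; rewrite mule2n adde_ge0// integral_ge0// => x _; rewrite lee_fin sqr_ge0.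
apply: eq_bigr => j _; rewrite -mule_natl muleA -EFinM mulVf// mul1e//.
Qed.

Lemma gr_L2P j f : measurable_fun setT f ->
  L2 (gr j f) <-> (\int[P]_x (gr j f x ^+ 2)%:E < +oo)%E.
Proof.
move=> mf; have mg := gr_meas j mf; split.
  by move=> /L2_sqr h; rewrite EFin_Ex// ltry.
move=> h; apply: L2_intro => //; apply/integrableP; split.
  exact/measurable_EFinP/measurable_funX.
by under eq_integral do rewrite /= ger0_norm ?sqr_ge0//.
Qed.

Lemma dirichlet_domainE f : dirichlet_domain P tau c f <-> domE f.
Proof.
rewrite /dirichlet_domain /= big_nbr /=.
have I0 j : (0 <= \int[P]_x (gr j f x ^+ 2)%:E)%E.
  by apply: integral_ge0 => x _; rewrite lee_fin sqr_ge0.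
have hE : measurable_fun setT f -> forall j,
   ('E_P[fun xi => (c 0 (unitv j) xi * (f (tau (unitv j) xi) - f xi) ^+ 2)%R]
   + 'E_P[fun xi => (c 0 (- unitv j) xi * (f (tau (- unitv j) xi) - f xi) ^+ 2)%R])%E
   = ((\int[P]_x (gr j f x ^+ 2)%:E) + (\int[P]_x (gr j f x ^+ 2)%:E))%E.
  move=> mf j; rewrite unlock; congr (_ + _)%E.
    by apply: eq_integral => x _; congr EFin; rewrite /gr exprMn sqr_sq.
  rewrite -[RHS](integral_comp htau hstat (- unitv j)).
  - apply: eq_integral => x _; congr EFin.
    by rewrite cndN /gr (tauNK htau) exprMn sqr_sq -(sqrrN (_ - f x)) opprB.
  - by apply/measurable_EFinP/measurable_funX/gr_meas.
  - by move=> x; rewrite lee_fin sqr_ge0.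
split=> [[L2f h]|[L2f h]].
  split=> // j; have mf := L2_meas L2f; apply/(gr_L2P _ mf).
  move: h; under eq_bigr do rewrite hE//.
  rewrite (bigD1 j)//=; apply: le_lt_trans; rewrite -[leLHS]adde0.
  apply: leeD; first by rewrite leeDl.
  by apply: sume_ge0 => i _; rewrite adde_ge0.
split=> //; have mf := L2_meas L2f; under eq_bigr do rewrite hE//.
by apply: lte_sum_pinfty => j _; rewrite lte_add_pinfty//; apply/(gr_L2P _ mf).
Qed.

Definition form f g : R := \sum_(j < d) Ex (fun x => gr j f x * gr j g x).

Lemma form_diag f : domE f -> dirichlet_form P tau c f f = (form f f)%:E.
Proof.
move=> [L2f h]; rewrite form_diag_ereal; last exact: L2_meas L2f.
rewrite -sumEFin; apply: eq_bigr => j _.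
rewrite EFin_Ex; last exact: L2_sqr.
by congr EFin; apply: eq_Ex => x; rewrite expr2.
Qed.

Lemma formC f g : form f g = form g f.
Proof. by apply: eq_bigr => j _; apply: eq_Ex => x; rewrite mulrC. Qed.

Lemma formL a f g h : domE f -> domE g -> domE h ->
  form (fun x => a * f x + g x) h = a * form f h + form g h.
Proof.
move=> [_ hf] [_ hg] [_ hh]; rewrite /form mulr_sumr -big_split /=.
apply: eq_bigr => j _; rewrite -ExZD; try exact: L2_mul.
by apply: eq_Ex => x; rewrite gr_lin; ring.
Qed.

Lemma form_ge0 f : 0 <= form f f.
Proof. by apply: sumr_ge0 => j _; apply: Ex_ge0 => x; rewrite -expr2 sqr_ge0. Qed.

(** * Self-adjoint operators and their resolvents *)

Section SelfAdjoint.
Variable A : (Omega -> R) -> (Omega -> R) -> Prop.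
Hypothesis hA : selfadjoint P A.

Lemma sa_L2 f g : A f g -> L2 f /\ L2 g.
Proof. by have [h _ _] := hA; exact: h. Qed.

Lemma sa_sym f g f' g' : A f g -> A f' g' -> Ex (fun x => g x * f' x) = Ex (fun x => f x * g' x).
Proof.
move=> fg fg'; have [h1 h2] := sa_L2 fg'; have [_ _ h] := hA.
by have /(h _ _ h1 h2) := fg'; apply.
Qed.

Lemma sa_intro u v : L2 u -> L2 v ->
  (forall f g, A f g -> Ex (fun x => g x * u x) = Ex (fun x => f x * v x)) -> A u v.
Proof. by move=> h1 h2 H; have [_ _ h] := hA; apply/(h _ _ h1 h2). Qed.

Lemma sa_lin a f g f' g' : A f g -> A f' g' ->
  A (fun x => a * f x + f' x) (fun x => a * g x + g' x).
Proof.
move=> fg fg'; have [h1 h2] := sa_L2 fg; have [h1' h2'] := sa_L2 fg'.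
apply: sa_intro => [||u v uv]; [by apply: L2D => //; exact: L2Z..|].
have [hu hv] := sa_L2 uv.
transitivity (a * Ex (fun x => v x * f x) + Ex (fun x => v x * f' x)).
  rewrite -ExZD; try exact: L2_mul.
  by apply: eq_Ex => x; ring.
rewrite (sa_sym uv fg) (sa_sym uv fg') -ExZD; try exact: L2_mul.
by apply: eq_Ex => x; ring.
Qed.

End SelfAdjoint.

Lemma L2_weak0 (u : nat -> Omega -> R) g : L2 g -> (forall n, L2 (u n)) ->
  (forall e : R, 0 < e -> exists N, forall n, (N <= n)%N -> Ex (fun x => u n x ^+ 2) < e) ->
  forall e : R, 0 < e -> exists N, forall n, (N <= n)%N -> `|Ex (fun x => g x * u n x)| < e.
Proof.
move=> Lg Lu h e e0.
have G0 : 0 <= Ex (fun x => g x ^+ 2) by apply: Ex_ge0 => x; exact: sqr_ge0.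
have e1 : 0 < e ^+ 2 / (Ex (fun x => g x ^+ 2) + 1) by rewrite divr_gt0 ?exprn_gt0// ltr_wpDl.
have [N hN] := h _ e1; exists N => n /hN hn.
rewrite -ltr_sqr ?nnegrE// ?(ltW e0)// real_normK ?num_real//.
apply: le_lt_trans (Ex_CS Lg (Lu n)) _.
apply: (@le_lt_trans _ _ ((Ex (fun x => g x ^+ 2) + 1) * Ex (fun x => u n x ^+ 2))).
  by rewrite ler_wpM2r ?lerDl// Ex_ge0// => x; exact: sqr_ge0.
by rewrite mulrC -ltr_pdivlMr// ltr_wpDl.
Qed.

Lemma Ex_young (w : R) f g : 0 < w -> L2 f -> L2 g ->
  `|Ex (fun x => f x * g x)| <= Ex (fun x => f x ^+ 2) / w + w / 4 * Ex (fun x => g x ^+ 2).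
Proof.
move=> w0 Lf Lg; apply: (le_trans (normr_Ex (L2_mul Lf Lg))).
rewrite [X in _ <= X + _]mulrC -!ExZ ?L2_sqr// -ExD; try by apply/int1Z/L2_sqr.
apply: le_Ex => [||x]; first exact/int1_norm/L2_mul.
  by apply: int1D; apply/int1Z/L2_sqr.
have h (t : R) : 0 <= w^-1 * f x ^+ 2 - t * (f x * g x) + t ^+ 2 * (w / 4 * g x ^+ 2).
  have -> : w^-1 * f x ^+ 2 - t * (f x * g x) + t ^+ 2 * (w / 4 * g x ^+ 2)
      = w^-1 * (f x - t * (w / 2) * g x) ^+ 2 by field; rewrite gt_eqF.
  by rewrite mulr_ge0 ?sqr_ge0// invr_ge0 ltW.
have h1 := h 1; have h2 := h (-1).
by rewrite ler_norml; apply/andP; split; lra.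
Qed.

Section Resolvent.
Variables (A : (Omega -> R) -> (Omega -> R) -> Prop) (omega : R).
Hypotheses (hA : selfadjoint P A) (homega : 0 < omega).

Lemma sa0 : A (fun=> 0) (fun=> 0).
Proof.
apply: (sa_intro hA); [exact: L2_cst|exact: L2_cst|move=> f g fg].
by congr fine; under eq_integral do rewrite mulr0; under [RHS]eq_integral do rewrite mulr0.
Qed.

(** Testing the real part of [(i omega - A) u] against [u2] and the imaginary part against [u1], the
    two terms in [A] agree by symmetry and cancel in the difference, leaving
    [omega (|u1|^2 + |u2|^2)]. *)
Lemma resolvent_bound u1 w1 u2 w2 : A u1 w1 -> A u2 w2 ->
  omega ^+ 2 * (Ex (fun x => u1 x ^+ 2) + Ex (fun x => u2 x ^+ 2)) <=
  4 * (Ex (fun x => (- omega * u2 x - w1 x) ^+ 2) + Ex (fun x => (omega * u1 x - w2 x) ^+ 2)).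
Proof.
move=> A1 A2; have [Lu1 Lw1] := sa_L2 hA A1; have [Lu2 Lw2] := sa_L2 hA A2.
have Ly1 : L2 (fun x => - omega * u2 x - w1 x) by apply: L2B => //; exact: L2Z.
have Ly2 : L2 (fun x => omega * u1 x - w2 x) by apply: L2B => //; exact: L2Z.
have E2 : Ex (fun x => (omega * u1 x - w2 x) * u1 x) = omega * Ex (fun x => u1 x ^+ 2) - Ex (fun x => w2 x * u1 x).
  rewrite -ExZ ?L2_sqr// -ExB; [|exact/int1Z/L2_sqr|exact: L2_mul].
  by apply: eq_Ex => x; ring.
have E1 : Ex (fun x => (- omega * u2 x - w1 x) * u2 x) = - omega * Ex (fun x => u2 x ^+ 2) - Ex (fun x => w1 x * u2 x).
  rewrite -ExZ ?L2_sqr// -ExB; [|exact/int1Z/L2_sqr|exact: L2_mul].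
  by apply: eq_Ex => x; ring.
have S : Ex (fun x => w2 x * u1 x) = Ex (fun x => w1 x * u2 x).
  by rewrite (sa_sym hA A2 A1); apply: eq_Ex => x; rewrite mulrC.
have := Ex_young homega Ly1 Lu2; have := Ex_young homega Ly2 Lu1.
rewrite E1 E2 S !ler_norml => /andP[_ h2] /andP[h1 _].
move: h1 h2; set y1 := Ex (fun x => (_ - w1 x) ^+ 2); set y2 := Ex (fun x => (_ - w2 x) ^+ 2).
set a := Ex (fun x => u1 x ^+ 2); set b := Ex (fun x => u2 x ^+ 2) => h1 h2.
have a0 : 0 <= a by apply: Ex_ge0 => x; exact: sqr_ge0.
have b0 : 0 <= b by apply: Ex_ge0 => x; exact: sqr_ge0.
have h3 : omega * (a + b) <= 4 * ((y1 + y2) / omega).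
  have : 0 <= omega * (a + b) by rewrite mulr_ge0 ?addr_ge0// ltW.
  rewrite !mulrDl; lra.
have := ler_wpM2l (ltW homega) h3.
have -> : omega * (4 * ((y1 + y2) / omega)) = 4 * (y1 + y2) by field; rewrite gt_eqF.
by rewrite mulrA -expr2.
Qed.

(** [A] is an adjoint, so its graph is cut out by linear conditions that are continuous in [L^2]. *)
Lemma sa_closed (u w : nat -> Omega -> R) v z : (forall n, A (u n) (w n)) -> L2 v -> L2 z ->
  (forall e : R, 0 < e -> exists N, forall n, (N <= n)%N -> Ex (fun x => (u n x - v x) ^+ 2) < e) ->
  (forall e : R, 0 < e -> exists N, forall n, (N <= n)%N -> Ex (fun x => (w n x - z x) ^+ 2) < e) ->
  A v z.
Proof.
move=> hn Lv Lz cu cw; apply: (sa_intro hA) => // f l fl; have [Lf Ll] := sa_L2 hA fl.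
have Ln n := sa_L2 hA (hn n).
apply/eqP; rewrite -subr_eq0 -normr_le0; apply/ler_addgt0Pr => e e0; rewrite add0r.
have e2 : 0 < e / 2 by rewrite divr_gt0.
have [N1 h1] := L2_weak0 Ll (fun n => L2B (Ln n).1 Lv) cu e2.
have [N2 h2] := L2_weak0 Lf (fun n => L2B (Ln n).2 Lz) cw e2.
pose n := maxn N1 N2; have {}h1 := h1 n (leq_maxl _ _); have {}h2 := h2 n (leq_maxr _ _).
have -> : Ex (fun x => l x * v x) - Ex (fun x => f x * z x) =
    Ex (fun x => f x * (w n x - z x)) - Ex (fun x => l x * (u n x - v x)).
  have E g h h' : L2 g -> L2 h -> L2 h' -> Ex (fun x => g x * (h x - h' x)) = Ex (fun x => g x * h x) - Ex (fun x => g x * h' x).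
    by move=> Lg Lh Lh'; rewrite -ExB; [apply: eq_Ex => x; ring|exact: L2_mul|exact: L2_mul].
  have [Lu Lw] := Ln n; rewrite !E// (sa_sym hA fl (hn n)); ring.
by apply: (le_trans (ler_normB _ _)); move: h1 h2; lra.
Qed.

(* The range of [i omega - A] is dense, because its orthogonal complement is
   the kernel of [- i omega - A], and closed, by [resolvent_bound]. *)
Theorem sa_resolvent g : L2 g -> exists u1 w1 u2 w2, [/\ A u1 w1, A u2 w2,
  forall x, g x = - omega * u2 x - w1 x & forall x, 0 = omega * u1 x - w2 x].
Proof.
move=> Lg.
pose F (u1 w1 u2 w2 : Omega -> R) (i : bool) : Omega -> R :=
  if i then fun x => - omega * u2 x - w1 x else fun x => omega * u1 x - w2 x.
pose M : set (bool -> Omega -> R) :=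
  [set H | exists u1 w1 u2 w2, [/\ A u1 w1, A u2 w2 & H = F u1 w1 u2 w2]].
have LF u1 w1 u2 w2 i : A u1 w1 -> A u2 w2 -> L2 (F u1 w1 u2 w2 i).
  move=> /(sa_L2 hA)[Lu1 Lw1] /(sa_L2 hA)[Lu2 Lw2].
  by case: i; apply: L2B => //; exact: L2Z.
pose F0 (i : bool) : Omega -> R := if i then g else fun=> 0.
have app n : exists u1 w1 u2 w2, [/\ A u1 w1, A u2 w2 &
    Ex (fun x => (g x - (- omega * u2 x - w1 x)) ^+ 2) + Ex (fun x => (0 - (omega * u1 x - w2 x)) ^+ 2) < n.+1%:R^-1].
  have n0 : 0 < n.+1%:R^-1 :> R by rewrite invr_gt0.
  have [||a H H'|v L2v orth|[]|G [u1 [w1 [u2 [w2 [A1 A2 ->]]]]]] := @L2_dense _ _ _ P bool M _ _ _ _ F0 _ _ n0.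
  - by move=> H [u1 [w1 [u2 [w2 [A1 A2 ->]]]]] i; exact: LF.
  - exists (fun=> 0), (fun=> 0), (fun=> 0), (fun=> 0); split; [exact: sa0|exact: sa0|].
    by apply/funext => -[]; apply/funext => x /=; rewrite mulr0 subr0.
  - move=> [u1 [w1 [u2 [w2 [A1 A2 ->]]]]] [u1' [w1' [u2' [w2' [A1' A2' ->]]]]].
    exists (fun x => a * u1 x + u1' x), (fun x => a * w1 x + w1' x),
      (fun x => a * u2 x + u2' x), (fun x => a * w2 x + w2' x); split; [exact: sa_lin|exact: sa_lin|].
    by apply/funext => -[]; apply/funext => x /=; ring.
  - rewrite big_bool /=; set v1 := v true; set v2 := v false.
    have Lv1 : L2 v1 by exact: L2v. have Lv2 : L2 v2 by exact: L2v.
    have o u1 w1 u2 w2 : A u1 w1 -> A u2 w2 ->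
        Ex (fun x => v1 x * (- omega * u2 x - w1 x)) + Ex (fun x => v2 x * (omega * u1 x - w2 x)) = 0.
      by move=> A1 A2; have := orth (F u1 w1 u2 w2); rewrite big_bool; apply; exists u1, w1, u2, w2.
    (* Pairs [(f, 0)] and [(0, f)] give [A v1 = omega v2] and [A v2 = - omega v1], since [A] is its
       own adjoint; symmetry then yields [omega (|v1|^2 + |v2|^2) = 0]. *)
    have V1 : A v1 (fun x => omega * v2 x).
      apply: (sa_intro hA) => [//||f h fh]; first exact: L2Z.
      have [Lf Lh] := sa_L2 hA fh; have := o _ _ _ _ fh sa0.
      rewrite (_ : Ex (fun x => v1 x * _) = - Ex (fun x => h x * v1 x)); last first.
        by rewrite -ExN ?L2_mul//; apply: eq_Ex => x; ring.
      rewrite (_ : Ex (fun x => v2 x * _) = Ex (fun x => f x * (omega * v2 x))); last first.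
        by apply: eq_Ex => x; ring.
      lra.
    have V2 : A v2 (fun x => - omega * v1 x).
      apply: (sa_intro hA) => [//||f h fh]; first exact: L2Z.
      have [Lf Lh] := sa_L2 hA fh; have := o _ _ _ _ sa0 fh.
      rewrite (_ : Ex (fun x => v2 x * _) = - Ex (fun x => h x * v2 x)); last first.
        by rewrite -ExN ?L2_mul//; apply: eq_Ex => x; ring.
      rewrite (_ : Ex (fun x => v1 x * _) = Ex (fun x => f x * (- omega * v1 x))); last first.
        by apply: eq_Ex => x; ring.
      lra.
    have := sa_sym hA V1 V2.
    rewrite (_ : Ex (fun x => omega * v2 x * v2 x) = omega * Ex (fun x => v2 x ^+ 2)); last first.
      by rewrite -ExZ ?L2_sqr//; apply: eq_Ex => x; ring.
    rewrite (_ : Ex (fun x => v1 x * (- omega * v1 x)) = - omega * Ex (fun x => v1 x ^+ 2)); last first.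
      by rewrite -ExZ ?L2_sqr//; apply: eq_Ex => x; ring.
    move=> h; have : omega * (Ex (fun x => v1 x ^+ 2) + Ex (fun x => v2 x ^+ 2)) = 0 by lra.
    by move/eqP; rewrite mulf_eq0 gt_eqF//= => /eqP.
  - exact: Lg.
  - exact: L2_cst.
  - by rewrite big_bool /= => h; exists u1, w1, u2, w2.
have [u1 hu1] := choice app; have [w1 hw1] := choice hu1; have [u2 hu2] := choice hw1.
have {app hu1 hw1 hu2}[w2 h] := choice hu2.
have A1 n : A (u1 n) (w1 n) by have [] := h n.
have A2 n : A (u2 n) (w2 n) by have [] := h n.
have Lu1 n := (sa_L2 hA (A1 n)).1; have Lw1 n := (sa_L2 hA (A1 n)).2.
have Lu2 n := (sa_L2 hA (A2 n)).1; have Lw2 n := (sa_L2 hA (A2 n)).2.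
pose y1 n x := g x - (- omega * u2 n x - w1 n x).
pose y2 n x := 0 - (omega * u1 n x - w2 n x).
have Ly1 n : L2 (y1 n) by apply: L2B => //; exact: (LF (u1 n) (w1 n) (u2 n) (w2 n) true).
have Ly2 n : L2 (y2 n) by apply: L2B; [exact: L2_cst|exact: (LF (u1 n) (w1 n) (u2 n) (w2 n) false)].
have sq0 f : 0 <= Ex (fun x => f x ^+ 2) by apply: Ex_ge0 => x; exact: sqr_ge0.
have y1s n : Ex (fun x => y1 n x ^+ 2) < n.+1%:R^-1.
  by have [_ _] := h n; apply: le_lt_trans; rewrite lerDl.
have y2s n : Ex (fun x => y2 n x ^+ 2) < n.+1%:R^-1.
  by have [_ _] := h n; apply: le_lt_trans; rewrite lerDr.
have diff2 f f' : L2 f -> L2 f' -> Ex (fun x => (f x - f' x) ^+ 2) <= 2 * Ex (fun x => f x ^+ 2) + 2 * Ex (fun x => f' x ^+ 2).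
  move=> Lf Lf'; rewrite -!ExZ ?L2_sqr// -ExD; try exact/int1Z/L2_sqr.
  apply: le_Ex => [||x]; first exact/L2_sqr/L2B.
    by apply: int1D; exact/int1Z/L2_sqr.
  by have := sqr_ge0 (f x + f' x); rewrite sqrrB sqrrD; lra.
have cau e : 0 < e -> exists N, forall m n : nat, (N <= m)%N -> (N <= n)%N ->
    Ex (fun x => (u1 m x - u1 n x) ^+ 2) + Ex (fun x => (u2 m x - u2 n x) ^+ 2) < e.
  move=> e0; have e1 : 0 < e * omega ^+ 2 / 32 by rewrite divr_gt0 ?mulr_gt0 ?exprn_gt0.
  have [N hN] := natSinv_small e1; exists N => m n Nm Nn.
  have := resolvent_bound (sa_lin hA (-1) (A1 n) (A1 m)) (sa_lin hA (-1) (A2 n) (A2 m)).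
  rewrite (_ : Ex (fun x => (-1 * u1 n x + u1 m x) ^+ 2) = Ex (fun x => (u1 m x - u1 n x) ^+ 2)); last first.
    by apply: eq_Ex => x; ring.
  rewrite (_ : Ex (fun x => (-1 * u2 n x + u2 m x) ^+ 2) = Ex (fun x => (u2 m x - u2 n x) ^+ 2)); last first.
    by apply: eq_Ex => x; ring.
  rewrite (_ : Ex (fun x => (- omega * (-1 * u2 n x + u2 m x) - _) ^+ 2) = Ex (fun x => (y1 n x - y1 m x) ^+ 2)); last first.
    by apply: eq_Ex => x; rewrite /y1; ring.
  rewrite (_ : Ex (fun x => (omega * (-1 * u1 n x + u1 m x) - _) ^+ 2) = Ex (fun x => (y2 n x - y2 m x) ^+ 2)); last first.
    by apply: eq_Ex => x; rewrite /y2; ring.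
  move=> hb; rewrite -(ltr_pM2l (exprn_gt0 2 homega)); apply: (le_lt_trans hb).
  have := diff2 _ _ (Ly1 n) (Ly1 m); have := diff2 _ _ (Ly2 n) (Ly2 m).
  have := lt_trans (y1s n) (hN _ Nn); have := lt_trans (y1s m) (hN _ Nm).
  have := lt_trans (y2s n) (hN _ Nn); have := lt_trans (y2s m) (hN _ Nm).
  rewrite mulrC; lra.
have [|v1 Lv1 c1] := @L2_complete _ _ _ P u1 Lu1.
  move=> e /cau[N hN]; exists N => m n Nm Nn; apply: le_lt_trans (hN m n Nm Nn).
  by rewrite lerDl.
have [|v2 Lv2 c2] := @L2_complete _ _ _ P u2 Lu2.
  move=> e /cau[N hN]; exists N => m n Nm Nn; apply: le_lt_trans (hN m n Nm Nn).
  by rewrite lerDr.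
have y1c e : 0 < e -> exists N, forall n, (N <= n)%N -> Ex (fun x => y1 n x ^+ 2) < e.
  by move=> /natSinv_small[N hN]; exists N => n /hN; exact: lt_trans.
have y2c e : 0 < e -> exists N, forall n, (N <= n)%N -> Ex (fun x => y2 n x ^+ 2) < e.
  by move=> /natSinv_small[N hN]; exists N => n /hN; exact: lt_trans.
(* The images under [A] are read off the equations, which therefore hold at every point; [sa_closed]
   puts the pairs in the graph. *)
exists v1, (fun x => - omega * v2 x - g x), v2, (fun x => omega * v1 x).
have near_lin (w : R) (y a b : nat -> Omega -> R) v : (forall n, L2 (y n)) -> (forall n, L2 (a n)) -> L2 v ->
    (forall n x, b n x = y n x + w * (a n x - v x)) ->
    (forall e : R, 0 < e -> exists N, forall n, (N <= n)%N -> Ex (fun x => y n x ^+ 2) < e) ->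
    (forall e : R, 0 < e -> exists N, forall n, (N <= n)%N -> Ex (fun x => (a n x - v x) ^+ 2) < e) ->
    forall e : R, 0 < e -> exists N, forall n, (N <= n)%N -> Ex (fun x => b n x ^+ 2) < e.
  move=> Ly La Lv bE cy ca e e0.
  have wp : 0 < w ^+ 2 + 1 by rewrite ltr_wpDl ?sqr_ge0.
  have [N1 h1] := cy _ (divr_gt0 e0 (ltr0n R 4)).
  have [N2 h2] := ca _ (divr_gt0 (divr_gt0 e0 (ltr0n R 4)) wp).
  exists (maxn N1 N2) => n; rewrite geq_max => /andP[/h1 {}h1 /h2].
  rewrite ltr_pdivlMr// => {}h2.
  have Lav : L2 (fun x => a n x - v x) by exact: L2B.
  have := diff2 (y n) (fun x => - w * (a n x - v x)) (Ly n) (L2Z _ Lav).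
  rewrite (_ : Ex (fun x => (y n x - _) ^+ 2) = Ex (fun x => b n x ^+ 2)); last first.
    by apply: eq_Ex => x; rewrite bE; ring.
  rewrite (_ : Ex (fun x => (- w * _) ^+ 2) = w ^+ 2 * Ex (fun x => (a n x - v x) ^+ 2)); last first.
    by rewrite -ExZ ?L2_sqr//; apply: eq_Ex => x; ring.
  have := sq0 (fun x => a n x - v x); move: h2; rewrite mulrDr mulr1 mulrC; lra.
split=> [||x|x]; [| |by ring|by rewrite subrr].
- apply: (sa_closed A1 Lv1 _ c1); first by apply: L2B => //; exact: L2Z.
  apply: (near_lin (- omega) _ _ _ _ Ly1 Lu2 Lv2 _ y1c c2) => n x; rewrite /y1; ring.
- apply: (sa_closed A2 Lv2 (L2Z _ Lv1) c2).
  apply: (near_lin omega _ _ _ _ Ly2 Lu1 Lv1 _ y2c c1) => n x; rewrite /y2; ring.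
Qed.

End Resolvent.

Section DirichletOperator.
Variable L : (Omega -> R) -> (Omega -> R) -> Prop.
Hypothesis hL : is_dirichlet_operator P tau c L.

Lemma L_selfadjoint : selfadjoint P L. Proof. by case: hL. Qed.

(** The square root [B] is tied to the form only on the diagonal. Expanding [|B (f + g)|^2]
    polarizes this to [<B f, B g> = form f g], and the symmetry of [B] moves it from [g] onto [B f],
    where [B (B f) = - L f]. *)
Lemma L_weak f w : L f w -> domE f /\ forall g, domE g -> form f g = - Ex (fun x => w x * g x).
Proof.
move=> fw; have [sL nL [B [[sB pB sq] dB eB]]] := hL.
have BE f0 g0 : B f0 g0 -> form f0 f0 = Ex (fun x => g0 x * g0 x).
  move=> h; have := eB _ _ h; rewrite form_diag; first by move=> [].
  by apply/dirichlet_domainE; rewrite -dB; exists g0.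
have BD f0 g0 : B f0 g0 -> domE f0.
  by move=> h; apply/dirichlet_domainE; rewrite -dB; exists g0.
have /sq [k fk kw] := fw; have Df := BD _ _ fk; split => // g Dg.
have [g' gg'] : exists g', B g g'.
  by have /dirichlet_domainE : domE g by []; rewrite -dB.
have [L2f L2k] := sa_L2 sB fk; have [L2g L2g'] := sa_L2 sB gg'.
have := BE _ _ (sa_lin sB 1 fk gg').
have Dfg := domE_lin 1 Df Dg.
rewrite formL// (formC f) (formC g (fun _ => _)) !formL// !mul1r (BE _ _ fk) (BE _ _ gg') (formC g f).
have -> : Ex (fun x => (1 * k x + g' x) * (1 * k x + g' x)) =
   Ex (fun x => k x * k x) + 2 * Ex (fun x => k x * g' x) + Ex (fun x => g' x * g' x).
  transitivity (2 * Ex (fun x => k x * g' x) +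
    (Ex (fun x => k x * k x) + Ex (fun x => g' x * g' x))); last by ring.
  rewrite -ExD; try exact: L2_mul.
  rewrite -ExZD; [|exact: L2_mul|by apply: int1D; exact: L2_mul].
  by apply: eq_Ex => x; ring.
have -> : Ex (fun x => k x * g' x) = - Ex (fun x => w x * g x).
  have := sa_sym sB kw gg' => <-; rewrite -ExN; last by apply: L2_mul => //; exact: (sa_L2 sL fw).2.
  by apply: eq_Ex => x; rewrite mulNr.
lra.
Qed.

End DirichletOperator.

(** * Bounded approximations of the solution on [Omega] *)

Section Approximation.
Variables (omega : R) (k : 'I_d).
Hypothesis homega : 0 < omega.
Implicit Types Q : 'I_d -> Omega -> R.

(* A divergence: minus the adjoint of the weighted gradient [gr]. *)
Definition dv Q (x : Omega) : R :=
  \sum_(j < d) (sq j x * Q j x - sq j (tau (- unitv j) x) * Q j (tau (- unitv j) x)).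

Definition tame (C : R) f := measurable_fun setT f /\ forall x, `|f x| <= C.

(** The bound on [sq j * Q j] controls the divergence, also across the wrap-around of the torus. The
    bound on [Q j] makes the field square-integrable, as [sq j] has no positive lower bound. *)
Definition nice (C : R) Q := forall j, tame C (Q j) /\ tame C (fun x => sq j x * Q j x).

Lemma tame_L2 C f : tame C f -> L2 f.
Proof. by move=> [mf fC]; exact: L2_bounded mf fC. Qed.

Lemma tame_le (C C' : R) f : C <= C' -> tame C f -> tame C' f.
Proof. by move=> CC [mf fC]; split => // x; exact: le_trans (fC x) CC. Qed.

Lemma tame0 (C : R) : 0 <= C -> tame C (fun=> 0).
Proof. by move=> C0; split => // x; rewrite normr0. Qed.

Lemma tame_lin (C C' a : R) f g : tame C f -> tame C' g ->
  tame (`|a| * C + C') (fun x => a * f x + g x).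
Proof.
move=> [mf fC] [mg gC]; split.
  by apply: measurable_funD => //; exact: measurable_funM.
by move=> x; rewrite (le_trans (ler_normD _ _))// lerD// normrM ler_wpM2l.
Qed.

Lemma nice0 (C : R) : 0 <= C -> nice C (fun _ _ => 0).
Proof.
move=> C0 j; split; first exact: tame0.
by under eq_fun do rewrite mulr0; exact: tame0.
Qed.

Lemma nice_le (C C' : R) Q : C <= C' -> nice C Q -> nice C' Q.
Proof. by move=> CC h j; have [h1 h2] := h j; split; exact: tame_le CC _. Qed.

Lemma nice_lin (C C' a : R) Q Q' : nice C Q -> nice C' Q' ->
  nice (`|a| * C + C') (fun j x => a * Q j x + Q' j x).
Proof.
move=> h h' j; have [h1 h2] := h j; have [h1' h2'] := h' j; split.
  exact: tame_lin.
under eq_fun do rewrite mulrDr mulrCA; exact: tame_lin.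
Qed.

Lemma nice_single (C : R) j f : 0 <= C -> tame C f -> tame C (fun x => sq j x * f x) ->
  nice C (fun i => if i == j then f else (fun=> 0)).
Proof.
move=> C0 h1 h2 i; have [->|_] := eqVneq i j; first by [].
have [h3 h4] := nice0 C0 i; by split.
Qed.

Lemma dv_lin a Q Q' x : dv (fun j x => a * Q j x + Q' j x) x = a * dv Q x + dv Q' x.
Proof.
by rewrite /dv mulr_sumr -big_split /=; apply: eq_bigr => j _; ring.
Qed.

Lemma dv0 x : dv (fun _ _ => 0) x = 0.
Proof. by rewrite /dv big1// => j _; rewrite !mulr0 subrr. Qed.

Lemma dv_L2 C Q : nice C Q -> L2 (dv Q).
Proof.
move=> hQ; apply: L2_sum => j; have [_ h] := hQ j; have L := tame_L2 h.
by apply: L2B => //; exact: (L2_comp htau hstat (- unitv j) L).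
Qed.

Lemma Ex_dv C Q f : nice C Q -> L2 f ->
  Ex (fun x => f x * dv Q x) =
  - \sum_(j < d) Ex (fun x => (f (tau (unitv j) x) - f x) * (sq j x * Q j x)).
Proof.
move=> hQ L2f.
have Lc a : L2 (fun x => f (tau a x)) by exact: (L2_comp htau hstat).
have Lp j : L2 (fun x => sq j x * Q j x) by have [_ h] := hQ j; exact: tame_L2 h.
have Lpc j a : L2 (fun x => sq j (tau a x) * Q j (tau a x)) by exact: (L2_comp htau hstat a (Lp j)).
rewrite /dv; under eq_Ex do rewrite mulr_sumr.
rewrite Ex_sum; last by move=> j; apply: L2_mul => //; exact: L2B.
rewrite -sumrN; apply: eq_bigr => j _.
transitivity (Ex (fun x => f x * (sq j x * Q j x)) - Ex (fun x => f (tau (unitv j) x) * (sq j x * Q j x))).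
  rewrite -[X in _ = _ - X](Ex_comp htau hstat (- unitv j)); last exact: L2_mul.
  rewrite -ExB; [|exact: L2_mul|]; last first.
    exact: (int1_comp htau hstat (- unitv j) (L2_mul (Lc (unitv j)) (Lp j))).
  by apply: eq_Ex => x; rewrite (tauNK htau) mulrBr.
rewrite -opprB -ExB; try exact: L2_mul.
by congr (- _); apply: eq_Ex => x; rewrite mulrBl.
Qed.

Lemma grE j f x : sq j x * (f (tau (unitv j) x) - f x) = gr j f x. Proof. by []. Qed.

(* Truncations of [f] converge to [f] in the form norm. *)
Lemma trunc_form f : domE f -> forall (u : Omega -> R) (w : 'I_d -> Omega -> R),
  L2 u -> (forall j, L2 (w j)) ->
  (forall C g, tame C g -> Ex (fun x => u x * g x) + \sum_(j < d) Ex (fun x => w j x * gr j g x) = 0) ->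
  Ex (fun x => u x * f x) + \sum_(j < d) Ex (fun x => w j x * gr j f x) = 0.
Proof.
move=> [L2f Lg] u w L2u L2w h.
have mf := L2_meas L2f.
pose T (n : nat) x := trunc n%:R (f x).
have tT n : tame n%:R (T n).
  by split; [exact: trunc_meas|move=> x; exact: trunc_bounded].
have [DT1 DT2] : (forall n, L2 (T n)) /\ (forall n j, L2 (gr j (T n))).
  by split => [n|n]; have [mT bT] := tT n; have [] := domE_bounded mT bT.
have grT n j x : `|gr j (T n) x| <= `|gr j f x|.
  by rewrite /gr !normrM ler_wpM2l// trunc_lip.
have cT x : T n x @[n --> \oo] --> f x by exact: trunc_cvg.
have cgr j x : gr j (T n) x @[n --> \oo] --> gr j f x.
  by apply: cvgM; [exact: cvg_cst|apply: cvgB; exact: trunc_cvg].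
apply/eqP; rewrite -normr_le0; apply/ler_addgt0Pr => e e0; rewrite add0r.
have e1 : 0 < e / d.+1%:R by rewrite divr_gt0.
have [||n x|x|N0 hN0] := @Ex_dct _ _ _ P (fun n x => u x * (f x - T n x)) (fun x => 2 * `|u x * f x|) _ _ _ _ _ e1.
- move=> n; apply: measurable_funM; first exact: L2_meas L2u.
  by apply: measurable_funB => //; have [] := tT n.
- by apply/int1Z/int1_norm/L2_mul.
- rewrite !normrM mulrCA ler_wpM2l// (le_trans (ler_normB _ _))// mulr2n mulrDl mul1r lerD2l.
  exact: trunc_le.
- rewrite -(mulr0 (u x)) -(subrr (f x)); apply: cvgM; first exact: cvg_cst.
  by apply: cvgB; [exact: cvg_cst|exact: cT].
have hj j : exists N, forall n, (N <= n)%N -> `|Ex (fun x => w j x * (gr j f x - gr j (T n) x))| < e / d.+1%:R.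
  apply: (@Ex_dct _ _ _ P (fun n x => w j x * (gr j f x - gr j (T n) x)) (fun x => 2 * `|w j x * gr j f x|)) => //.
  - move=> n; apply: measurable_funM; first exact: L2_meas (L2w j).
    by apply: measurable_funB; [exact: L2_meas (Lg j)|exact: L2_meas (DT2 n j)].
  - by apply/int1Z/int1_norm/L2_mul.
  - move=> n x; rewrite !(normrM (w j x)) mulrCA ler_wpM2l// (le_trans (ler_normB _ _))// mulr2n mulrDl mul1r lerD2l.
    exact: grT.
  - move=> x; rewrite -(mulr0 (w j x)) -(subrr (gr j f x)); apply: cvgM; first exact: cvg_cst.
    by apply: cvgB; [exact: cvg_cst|exact: cgr].
have [Nj hNj] := choice hj.
pose n := maxn N0 (\max_j Nj j).
have H1 := hN0 n (leq_maxl _ _).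
have H2 j := hNj j n (leq_trans (leq_bigmax j) (leq_maxr _ _)).
have -> : Ex (fun x => u x * f x) + \sum_(j < d) Ex (fun x => w j x * gr j f x) =
   Ex (fun x => u x * (f x - T n x)) + \sum_(j < d) Ex (fun x => w j x * (gr j f x - gr j (T n) x)).
  rewrite -[LHS]subr0 -[X in _ - X](h _ _ (tT n)) opprD addrACA; congr (_ + _).
    rewrite -ExB; try exact: L2_mul.
    by apply: eq_Ex => x; rewrite mulrBr.
  rewrite -sumrB; apply: eq_bigr => j _; rewrite -ExB; try exact: L2_mul.
  by apply: eq_Ex => x; rewrite mulrBr.
apply: (le_trans (ler_normD _ _)).
apply: (@le_trans _ _ (e / d.+1%:R + \sum_(j < d) e / d.+1%:R)).
  apply: lerD; first exact: ltW.
  by apply: (le_trans (ler_norm_sum _ _ _)); apply: ler_sum => j _; exact/ltW/H2.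
rewrite sumr_const card_ord -[X in _ + X]mulr_natr -[X in X + _]mulr1 -mulrDr.
by rewrite nat1r divfK// pnatr_eq0.
Qed.

(* With [t = 1] (real part) or [t = 0] (imaginary part), the solution [h1 + i h2]
   has [approx_err t h Q = 0] for a field [Q] with [dv Q1 = - omega h2] and
   [dv Q2 = omega h1]. *)
Definition approx_err (t : R) G Q j x := gr j G x + t * (j == k)%:R * sq j x - Q j x.

(** Weakly, [b] is minus the gradient of [a], but [gr j a] is not known to be square-integrable. The
    cut-off [chi K] to [sq j <= K] makes it so and produces nice test fields; every point satisfies
    [sq j <= K] for some [K], which removes the cut-off. *)
Lemma orth_grad a (b : 'I_d -> Omega -> R) : L2 a -> (forall j, L2 (b j)) ->
  (forall C Q, nice C Q -> \sum_(j < d) Ex (fun x => b j x * Q j x) = Ex (fun x => a x * dv Q x)) ->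
  forall j, {ae P, forall x, b j x = - gr j a x}.
Proof.
move=> L2a L2b h j.
have ma := L2_meas L2a; have mg := gr_meas j ma.
have La : L2 (fun x => a (tau (unitv j) x)) by exact: (L2_comp htau hstat).
pose D x := a (tau (unitv j) x) - a x; have LD : L2 D by exact: L2B.
pose chi (K : nat) x : R := (sq j x <= K%:R)%R%:R.
have mchi K : measurable_fun setT (chi K).
  rewrite (_ : chi K = \1_[set x | sq j x <= K%:R]); last first.
    by apply/funext => x; rewrite indicE /chi; congr ((nat_of_bool _)%:R); apply/idP/idP; rewrite inE.
  apply: measurable_indic; rewrite -[X in measurable X]setTI.
  by apply: measurable_fun_ler => //; exact: sq_meas.
have chi1 K x : `|chi K x| <= 1.
  by rewrite /chi; case: (sq j x <= K%:R); rewrite ?normr1 ?normr0.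
have chiK K x : `|sq j x * chi K x| <= K%:R.
  rewrite /chi; case: (leP (sq j x)) => h1; last by rewrite mulr0 normr0.
  by rewrite mulr1 ger0_norm// sq_ge0.
have Lbc K : L2 (fun x => (b j x + gr j a x) * chi K x).
  have L1 : L2 (fun x => b j x * chi K x).
    apply: (L2_le (g := b j)) => //.
      by apply: measurable_funM => //; exact: L2_meas (L2b j).
    by move=> x; rewrite normrM ler_piMr.
  have L2' : L2 (fun x => gr j a x * chi K x).
    apply: (L2_le (g := fun x => K%:R * D x)); last exact: L2Z.
      exact: measurable_funM.
    move=> x; rewrite /gr mulrAC !normrM [`|K%:R|]ger0_norm// -normrM ler_wpM2r//.
  by under eq_fun do rewrite mulrDl; exact: L2D.
have z K : {ae P, forall x, (b j x + gr j a x) * chi K x = 0}.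
  apply: ae0_of_orth; first exact: L2_int1.
  move=> u mu u1.
  have tu : tame 1 (fun x => chi K x * u x).
    by split; [exact: measurable_funM|move=> x; rewrite normrM mulr_ile1].
  have tsu : tame K%:R (fun x => sq j x * (chi K x * u x)).
    split; first by apply: measurable_funM; [exact: sq_meas|exact: measurable_funM].
    move=> x; rewrite mulrA normrM -[leRHS]mulr1; exact: ler_pM.
  have C0 : 0 <= 1 + K%:R :> R by rewrite addr_ge0.
  have nQ : nice (1 + K%:R) (fun i => if i == j then (fun x => chi K x * u x) else (fun=> 0)).
    apply: nice_single => //.
      by apply: tame_le tu; rewrite lerDl.
    by apply: tame_le tsu; rewrite lerDr.
  have := h _ _ nQ; rewrite (Ex_dv nQ L2a).
  rewrite (bigD1 j)//= [in X in _ = X](bigD1 j)//= eqxx.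
  rewrite big1 ?addr0; last by move=> i /negPf ->; under eq_Ex do rewrite mulr0; exact: Ex_cst.
  rewrite big1 ?addr0; last by move=> i /negPf ->; under eq_Ex do rewrite !mulr0; exact: Ex_cst.
  have Lt := tame_L2 tu; have Lts := tame_L2 tsu.
  move/eqP; rewrite -addr_eq0 -ExD; try exact: L2_mul.
  move/eqP => <-; apply: eq_Ex => x; rewrite /gr; ring.
have := ae_foralln z; apply: filterS => x hx.
have /eqP := hx (Num.truncn (sq j x)).+1.
rewrite /chi (ltW (truncnS_gt _)) mulr1 addr_eq0 => /eqP; exact.
Qed.

(** Let a vector with function part [a] and field part [b] be orthogonal to all candidates. Varying
    [Q] alone shows that [b] is minus the gradient of [a]; varying [G] alone then gives a
    homogeneous resolvent system for [a], which forces [a = 0]. *)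
Theorem approximation e : 0 < e -> exists (C : R) G1 G2 Q1 Q2,
  [/\ 0 <= C, tame C G1, tame C G2, nice C Q1 & nice C Q2] /\
  Ex (fun x => (- (omega * G2 x) - dv Q1 x) ^+ 2)
   + Ex (fun x => (omega * G1 x - dv Q2 x) ^+ 2)
   + \sum_(j < d) Ex (fun x => approx_err 1 G1 Q1 j x ^+ 2)
   + \sum_(j < d) Ex (fun x => approx_err 0 G2 Q2 j x ^+ 2) < e.
Proof.
move=> e0.
(* Up to sign, the components of [F0 - F] are the four residuals. The source [sq k] sits in the real
   field part of [F0] only, as [gamma_k] is real. *)
pose F G1 G2 Q1 Q2 (i : bool * option 'I_d) : Omega -> R :=
  match i with
  | (true, None) => fun x => - (omega * G2 x) - dv Q1 x
  | (false, None) => fun x => omega * G1 x - dv Q2 x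
  | (true, Some j) => fun x => Q1 j x - gr j G1 x
  | (false, Some j) => fun x => Q2 j x - gr j G2 x
  end.
pose M : set (bool * option 'I_d -> Omega -> R) := [set H | exists (C : R) G1 G2 Q1 Q2,
  [/\ 0 <= C, tame C G1, tame C G2, nice C Q1 & nice C Q2] /\ H = F G1 G2 Q1 Q2].
pose F0 (i : bool * option 'I_d) : Omega -> R :=
  match i with
  | (true, Some j) => fun x => 1 * (j == k)%:R * sq j x
  | _ => fun=> 0
  end.
have sumE (H : bool * option 'I_d -> R) : \sum_i H i =
    H (true, None) + H (false, None) + \sum_(j < d) H (true, Some j) + \sum_(j < d) H (false, Some j).
  rewrite (eq_bigr (fun i => H (i.1, i.2))); last by case.
  rewrite -(pair_bigA _ (fun b o => H (b, o))) /= big_bool !big_option /=.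
  by rewrite addrACA addrA.
have Lgr C G j : tame C G -> L2 (gr j G).
  by move=> [mG bG]; have [] := domE_bounded mG bG.
have LF C G1 G2 Q1 Q2 i : tame C G1 -> tame C G2 -> nice C Q1 -> nice C Q2 -> L2 (F G1 G2 Q1 Q2 i).
  move=> t1 t2 n1 n2; case: i => -[] [j|] /=.
  - by apply: L2B; [have [h _] := n1 j; exact: tame_L2 h|exact: Lgr t1].
  - by apply: L2B; [apply/L2N/L2Z; exact: tame_L2 t2|exact: dv_L2 n1].
  - by apply: L2B; [have [h _] := n2 j; exact: tame_L2 h|exact: Lgr t2].
  - by apply: L2B; [apply/L2Z; exact: tame_L2 t1|exact: dv_L2 n2].
have gr0 j x : gr j (fun=> 0) x = 0 by rewrite /gr subrr mulr0.
have [||a H H'|v L2v orth|[] [] [j|]|G [C [G1 [G2 [Q1 [Q2 [hn ->]]]]]]] :=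
  @L2_dense _ _ _ P (bool * option 'I_d)%type M _ _ _ _ F0 _ e e0.
- by move=> H [C [G1 [G2 [Q1 [Q2 [[? ? ? ? ?] ->]]]]]] i; exact: (LF C).
- exists 0, (fun=> 0), (fun=> 0), (fun _ _ => 0), (fun _ _ => 0); split.
    by split => //; [exact: tame0|exact: tame0|exact: nice0|exact: nice0].
  apply/funext => -[[] [j|]]; apply/funext => x /=.
  + by rewrite gr0 subrr.
  + by rewrite dv0 mulr0 subr0 oppr0.
  + by rewrite gr0 subrr.
  + by rewrite dv0 mulr0 subr0.
- move=> [C [G1 [G2 [Q1 [Q2 [[C0 t1 t2 n1 n2] ->]]]]]] [C' [G1' [G2' [Q1' [Q2' [[C0' t1' t2' n1' n2'] ->]]]]]].
  exists (`|a| * C + C'), (fun x => a * G1 x + G1' x), (fun x => a * G2 x + G2' x),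
    (fun j x => a * Q1 j x + Q1' j x), (fun j x => a * Q2 j x + Q2' j x); split.
    split; [by rewrite addr_ge0 ?mulr_ge0|exact: tame_lin|exact: tame_lin|exact: nice_lin|exact: nice_lin].
  apply/funext => -[[] [j|]]; apply/funext => x /=; rewrite ?gr_lin ?dv_lin; ring.
- pose a1 := v (true, None); pose a2 := v (false, None).
  pose b1 j := v (true, Some j); pose b2 j := v (false, Some j).
  have o C G1 G2 Q1 Q2 : 0 <= C -> tame C G1 -> tame C G2 -> nice C Q1 -> nice C Q2 ->
      Ex (fun x => a1 x * (- (omega * G2 x) - dv Q1 x)) +
      Ex (fun x => a2 x * (omega * G1 x - dv Q2 x)) +
      \sum_(j < d) Ex (fun x => b1 j x * (Q1 j x - gr j G1 x)) +
      \sum_(j < d) Ex (fun x => b2 j x * (Q2 j x - gr j G2 x)) = 0.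
    move=> C0 t1 t2 n1 n2; rewrite -[RHS](orth (F G1 G2 Q1 Q2)) ?sumE//.
    by exists C, G1, G2, Q1, Q2.
  have La1 : L2 a1 by exact: L2v. have La2 : L2 a2 by exact: L2v.
  have Lb1 j : L2 (b1 j) by exact: L2v. have Lb2 j : L2 (b2 j) by exact: L2v.
  have z0 f : Ex (fun x => f x * 0) = 0 by under eq_Ex do rewrite mulr0; exact: Ex_cst.
  have zd f : Ex (fun x => f x * dv (fun _ _ => 0) x) = 0.
    by under eq_Ex do rewrite dv0; exact: z0.
  have zg j f : Ex (fun x => f x * gr j (fun=> 0) x) = 0.
    by under eq_Ex do rewrite gr0; exact: z0.
  have zs0 (b : 'I_d -> Omega -> R) : \sum_(j < d) Ex (fun x => b j x * 0) = 0.
    by rewrite big1.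
  have zsg (b : 'I_d -> Omega -> R) : \sum_(j < d) Ex (fun x => b j x * gr j (fun=> 0) x) = 0.
    by rewrite big1.
  have o' C G1 G2 Q1 Q2 : 0 <= C -> tame C G1 -> tame C G2 -> nice C Q1 -> nice C Q2 ->
      - omega * Ex (fun x => a1 x * G2 x) - Ex (fun x => a1 x * dv Q1 x) +
      (omega * Ex (fun x => a2 x * G1 x) - Ex (fun x => a2 x * dv Q2 x)) +
      (\sum_(j < d) Ex (fun x => b1 j x * Q1 j x) - \sum_(j < d) Ex (fun x => b1 j x * gr j G1 x)) +
      (\sum_(j < d) Ex (fun x => b2 j x * Q2 j x) - \sum_(j < d) Ex (fun x => b2 j x * gr j G2 x)) = 0.
    move=> C0 t1 t2 n1 n2; rewrite -[RHS](o C G1 G2 Q1 Q2)//.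
    have LG1 := tame_L2 t1; have LG2 := tame_L2 t2.
    have LQ1 j : L2 (Q1 j) by have [h _] := n1 j; exact: tame_L2 h.
    have LQ2 j : L2 (Q2 j) by have [h _] := n2 j; exact: tame_L2 h.
    have Ld1 := dv_L2 n1; have Ld2 := dv_L2 n2.
    have Lg1 j := Lgr _ _ j t1; have Lg2 j := Lgr _ _ j t2.
    congr (_ + _ + _ + _).
    - rewrite -ExZ; last exact: L2_mul.
      rewrite -ExB; [|by apply: int1Z; exact: L2_mul|exact: L2_mul].
      by apply: eq_Ex => x; ring.
    - rewrite -ExZ; last exact: L2_mul.
      rewrite -ExB; [|by apply: int1Z; exact: L2_mul|exact: L2_mul].
      by apply: eq_Ex => x; ring.
    - rewrite -sumrB; apply: eq_bigr => j _; rewrite -ExB; try exact: L2_mul.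
      by apply: eq_Ex => x; ring.
    - rewrite -sumrB; apply: eq_bigr => j _; rewrite -ExB; try exact: L2_mul.
      by apply: eq_Ex => x; ring.
  have ae1 : forall j, {ae P, forall x, b1 j x = - gr j a1 x}.
    apply: orth_grad => // C Q n.
    have {}n : nice `|C| Q by exact: nice_le (ler_norm _) n.
    have := o' _ _ _ _ _ (normr_ge0 C) (tame0 (normr_ge0 C)) (tame0 (normr_ge0 C)) n (nice0 (normr_ge0 C)).
    rewrite !zs0 !zsg !z0 zd !mulr0; lra.
  have ae2 : forall j, {ae P, forall x, b2 j x = - gr j a2 x}.
    apply: orth_grad => // C Q n.
    have {}n : nice `|C| Q by exact: nice_le (ler_norm _) n.
    have := o' _ _ _ _ _ (normr_ge0 C) (tame0 (normr_ge0 C)) (tame0 (normr_ge0 C)) (nice0 (normr_ge0 C)) n.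
    rewrite !zs0 !zsg !z0 zd !mulr0; lra.
  have dom a b : L2 a -> (forall j, L2 (b j)) -> (forall j, {ae P, forall x, b j x = - gr j a x}) ->
      domE a /\ forall j, Ex (fun x => b j x * gr j a x) = - Ex (fun x => b j x ^+ 2).
    move=> La Lb ba; have ma := L2_meas La.
    have Lga j : L2 (gr j a).
      apply: L2_intro; first exact: gr_meas.
      apply: ae_int1 (L2_sqr (Lb j)) _; first exact/measurable_funX/gr_meas.
      by apply: filterS (ba j) => x ->; rewrite sqrrN.
    split => // j; rewrite -ExN; last exact: L2_sqr.
    apply: ae_eq_Ex; [exact: L2_mul|exact/int1N/L2_sqr|].
    by apply: filterS (ba j) => x ->; ring.
  have [D1 S1] := dom _ _ La1 Lb1 ae1; have [D2 S2] := dom _ _ La2 Lb2 ae2.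
  (* [a1] and [a2] will serve as test functions and need not be bounded, hence the extension to the
     whole form domain. *)
  have ext w a b : L2 a -> (forall j, L2 (b j)) ->
      (forall C g, 0 <= C -> tame C g -> w * Ex (fun x => a x * g x) - \sum_(j < d) Ex (fun x => b j x * gr j g x) = 0) ->
      forall f, domE f -> w * Ex (fun x => a x * f x) - \sum_(j < d) Ex (fun x => b j x * gr j f x) = 0.
    move=> La Lb hw.
    have E g : domE g -> w * Ex (fun x => a x * g x) - \sum_(j < d) Ex (fun x => b j x * gr j g x) =
        Ex (fun x => w * a x * g x) + \sum_(j < d) Ex (fun x => - b j x * gr j g x).
      move=> [Lg Lgg]; rewrite -ExZ; last exact: L2_mul.
      rewrite -sumrN; congr (_ + _); first by apply: eq_Ex => x; ring.
      by apply: eq_bigr => j _; rewrite -ExN; [apply: eq_Ex => x; ring|exact: L2_mul].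
    move=> f Df; rewrite E//; apply: (trunc_form Df) => [|j|C g tg]; [exact: L2Z|exact: L2N|].
    have {}tg : tame `|C| g by exact: tame_le (ler_norm _) tg.
    by rewrite -E; [exact: hw tg|have [mg bg] := tg; exact: domE_bounded mg bg].
  have T1 : forall f, domE f -> omega * Ex (fun x => a2 x * f x) - \sum_(j < d) Ex (fun x => b1 j x * gr j f x) = 0.
    apply: ext => // C g C0 tg; have := o' _ _ _ _ _ C0 tg (tame0 C0) (nice0 C0) (nice0 C0).
    rewrite !zs0 !zsg !z0 !zd !mulr0; lra.
  have T2 : forall f, domE f -> - omega * Ex (fun x => a1 x * f x) - \sum_(j < d) Ex (fun x => b2 j x * gr j f x) = 0.
    apply: ext => // C g C0 tg; have := o' _ _ _ _ _ C0 (tame0 C0) tg (nice0 C0) (nice0 C0).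
    rewrite !zs0 !zsg !z0 !zd !mulr0; lra.
  have sq_ge f : 0 <= Ex (fun x => f x ^+ 2) by apply: Ex_ge0 => x; exact: sqr_ge0.
  have SS1 : \sum_(j < d) Ex (fun x => b1 j x * gr j a1 x) = - \sum_(j < d) Ex (fun x => b1 j x ^+ 2).
    by rewrite -sumrN; apply: eq_bigr => j _; exact: S1.
  have SS2 : \sum_(j < d) Ex (fun x => b2 j x * gr j a2 x) = - \sum_(j < d) Ex (fun x => b2 j x ^+ 2).
    by rewrite -sumrN; apply: eq_bigr => j _; exact: S2.
  have B1_ge0 : 0 <= \sum_(j < d) Ex (fun x => b1 j x ^+ 2) by apply: sumr_ge0.
  have B2_ge0 : 0 <= \sum_(j < d) Ex (fun x => b2 j x ^+ 2) by apply: sumr_ge0.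
  have a12 : Ex (fun x => a2 x * a1 x) = Ex (fun x => a1 x * a2 x) by apply: eq_Ex => x; rewrite mulrC.
  (* [T1] at [a1] and [T2] at [a2] contain opposite mixed terms [omega <a1, a2>], so their sum shows
     that both fields vanish. Then [T1] at [a2] and [T2] at [a1] reduce to the norms of [a2] and
     [a1]. *)
  have := T1 _ D1; have := T2 _ D2; rewrite SS1 SS2 a12 => t2 t1.
  have B1 : \sum_(j < d) Ex (fun x => b1 j x ^+ 2) = 0 by lra.
  have B2 : \sum_(j < d) Ex (fun x => b2 j x ^+ 2) = 0 by lra.
  have kill b f : (forall j, L2 (b j)) -> domE f -> \sum_(j < d) Ex (fun x => b j x ^+ 2) = 0 ->
      \sum_(j < d) Ex (fun x => b j x * gr j f x) = 0.
    move=> Lb [_ Lf] b0; apply: big1 => j _.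
    have bj : Ex (fun x => b j x ^+ 2) = 0.
      apply/eqP; rewrite eq_le sq_ge andbT -b0 (bigD1 j)//= lerDl.
      by apply: sumr_ge0.
    apply/eqP; rewrite -sqrf_eq0 eq_le sqr_ge0 andbT.
    by apply: le_trans (Ex_CS (Lb j) (Lf j)) _; rewrite bj mul0r.
  have A2 : Ex (fun x => a2 x ^+ 2) = 0.
    have := T1 _ D2; rewrite (kill b1 a2)// subr0 => /eqP.
    rewrite mulf_eq0 gt_eqF//= => /eqP h.
    by rewrite -[RHS]h; apply: eq_Ex => x; rewrite expr2.
  have A1 : Ex (fun x => a1 x ^+ 2) = 0.
    have := T2 _ D1; rewrite (kill b2 a1)// subr0 => /eqP.
    rewrite mulf_eq0 oppr_eq0 gt_eqF//= => /eqP h.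
    by rewrite -[RHS]h; apply: eq_Ex => x; rewrite expr2.
  by rewrite sumE [X in X + _ + _ + _]A1 [X in _ + X + _ + _]A2 [X in _ + _ + X + _]B1 [X in _ + _ + _ + X]B2 !addr0.
- by apply: L2Z; exact: sq_L2.
- exact: L2_cst.
- exact: L2_cst.
- exact: L2_cst.
- move=> hlt; exists C, G1, G2, Q1, Q2; split => //.
  move: hlt; rewrite sumE /=; congr (_ < _).
  congr (_ + _ + _ + _).
  + by apply: eq_Ex => x; rewrite sub0r sqrrN.
  + by apply: eq_Ex => x; rewrite sub0r sqrrN.
  + by apply: eq_bigr => j _; apply: eq_Ex => x; rewrite /approx_err; congr (_ ^+ 2); ring.
  + by apply: eq_bigr => j _; apply: eq_Ex => x; rewrite /approx_err; congr (_ ^+ 2); ring.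
Qed.

(** By the identity [I] below, [(G1, G2)] solves the weak system up to the residuals. Subtraction
    leaves two equations for the errors, each tested against both errors as [energy_arith]
    requires. *)
Lemma env_energy C G1 G2 Q1 Q2 h1 h2 : tame C G1 -> tame C G2 -> nice C Q1 -> nice C Q2 ->
  domE h1 -> domE h2 ->
  (forall g, domE g -> form h1 g - omega * Ex (fun x => h2 x * g x) = - Ex (fun x => sq k x * gr k g x)) ->
  (forall g, domE g -> form h2 g + omega * Ex (fun x => h1 x * g x) = 0) ->
  forall r1 r2, r1 = (fun x => h1 x - G1 x) -> r2 = (fun x => h2 x - G2 x) ->
  form r1 r1 + form r2 r2 + omega * (Ex (fun x => r1 x ^+ 2) + Ex (fun x => r2 x ^+ 2)) <=
  4 * (omega^-1 + 1) * (Ex (fun x => (- (omega * G2 x) - dv Q1 x) ^+ 2)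
   + Ex (fun x => (omega * G1 x - dv Q2 x) ^+ 2)
   + \sum_(j < d) Ex (fun x => approx_err 1 G1 Q1 j x ^+ 2)
   + \sum_(j < d) Ex (fun x => approx_err 0 G2 Q2 j x ^+ 2)).
Proof.
move=> t1 t2 n1 n2 D1 D2 W1 W2 ? ? -> ->.
set r1 := (fun x => h1 x - G1 x); set r2 := (fun x => h2 x - G2 x).
have DG1 : domE G1 by have [? ?] := t1; apply: domE_bounded.
have DG2 : domE G2 by have [? ?] := t2; apply: domE_bounded.
have rE h G : (fun x => h x - G x) = (fun x => -1 * G x + h x) by apply/funext => x; ring.
have Dr1 : domE r1 by rewrite /r1 rE; exact: domE_lin.
have Dr2 : domE r2 by rewrite /r2 rE; exact: domE_lin.
have [Lr1 Lgr1] := Dr1; have [Lr2 Lgr2] := Dr2.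
have [LG1 LgG1] := DG1; have [LG2 LgG2] := DG2; have [Lh1 _] := D1; have [Lh2 _] := D2.
pose al1 x := - (omega * G2 x) - dv Q1 x; pose al2 x := omega * G1 x - dv Q2 x.
pose be1 j x := approx_err 1 G1 Q1 j x; pose be2 j x := approx_err 0 G2 Q2 j x.
have Ld1 := dv_L2 n1; have Ld2 := dv_L2 n2.
have Lal1 : L2 al1 by apply: L2B => //; exact/L2N/L2Z.
have Lal2 : L2 al2 by apply: L2B => //; exact: L2Z.
have LQ1 j : L2 (Q1 j) by have [h _] := n1 j; exact: tame_L2 h.
have LQ2 j : L2 (Q2 j) by have [h _] := n2 j; exact: tame_L2 h.
have Lbe (t : R) G Q j : L2 (gr j G) -> L2 (Q j) -> L2 (approx_err t G Q j).
  by move=> LG LQ; apply: L2B => //; apply: L2D => //; apply: L2Z; exact: sq_L2.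
have I (t : R) G Q g : (forall j, L2 (gr j G)) -> (forall j, L2 (Q j)) -> nice C Q -> domE g ->
  \sum_(j < d) Ex (fun x => approx_err t G Q j x * gr j g x) =
  form G g + t * Ex (fun x => sq k x * gr k g x) + Ex (fun x => dv Q x * g x).
  move=> LG LQ n [Lg Lgg].
  have -> : Ex (fun x => dv Q x * g x) = - \sum_(j < d) Ex (fun x => Q j x * gr j g x).
    rewrite (_ : Ex _ = Ex (fun x => g x * dv Q x)); last by apply: eq_Ex => x; rewrite mulrC.
    rewrite (Ex_dv n Lg); congr (- _); apply: eq_bigr => j _; apply: eq_Ex => x.
    by rewrite /gr; ring.
  have -> : t * Ex (fun x => sq k x * gr k g x) =
      \sum_(j < d) Ex (fun x => t * (j == k)%:R * (sq j x * gr j g x)).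
    rewrite (bigD1 k)//= eqxx big1 ?addr0.
      by rewrite -ExZ; [apply: eq_Ex => x; rewrite mulr1|apply: L2_mul => //; exact: sq_L2].
    by move=> j /negPf ->; rewrite -[RHS](Ex_cst P); apply: eq_Ex => x; rewrite mulr0 mul0r.
  rewrite /form -sumrN -!big_split /=; apply: eq_bigr => j _.
  have L1 : int1 (fun x => gr j G x * gr j g x) by exact: L2_mul.
  have L2' : int1 (fun x => t * (j == k)%:R * (sq j x * gr j g x)).
    by apply: int1Z; apply: L2_mul => //; exact: sq_L2.
  have L3 : int1 (fun x => Q j x * gr j g x) by exact: L2_mul.
  rewrite -ExD// -ExB//; last exact: int1D.
  by apply: eq_Ex => x; rewrite /approx_err; ring.
have formB h G g : domE h -> domE G -> domE g -> form (fun x => h x - G x) g = form h g - form G g.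
  by move=> Dh DG Dg; rewrite rE formL//; ring.
have I1 g : domE g -> form r1 g - omega * Ex (fun x => r2 x * g x) =
    - Ex (fun x => al1 x * g x) - \sum_(j < d) Ex (fun x => be1 j x * gr j g x).
  move=> Dg; have [Lg _] := Dg; rewrite formB// I//.
  have -> : Ex (fun x => r2 x * g x) = Ex (fun x => h2 x * g x) - Ex (fun x => G2 x * g x).
    by rewrite -ExB; try exact: L2_mul; apply: eq_Ex => x; rewrite /r2; ring.
  have -> : Ex (fun x => al1 x * g x) = - omega * Ex (fun x => G2 x * g x) - Ex (fun x => dv Q1 x * g x).
    rewrite -ExZ; last exact: L2_mul.
    rewrite -ExB; [|by apply: int1Z; exact: L2_mul|exact: L2_mul].
    by apply: eq_Ex => x; rewrite /al1; ring.
  have := W1 _ Dg; lra.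
have I2 g : domE g -> form r2 g + omega * Ex (fun x => r1 x * g x) =
    - Ex (fun x => al2 x * g x) - \sum_(j < d) Ex (fun x => be2 j x * gr j g x).
  move=> Dg; have [Lg _] := Dg; rewrite formB// I//.
  have -> : Ex (fun x => r1 x * g x) = Ex (fun x => h1 x * g x) - Ex (fun x => G1 x * g x).
    by rewrite -ExB; try exact: L2_mul; apply: eq_Ex => x; rewrite /r1; ring.
  have -> : Ex (fun x => al2 x * g x) = omega * Ex (fun x => G1 x * g x) - Ex (fun x => dv Q2 x * g x).
    rewrite -ExZ; last exact: L2_mul.
    rewrite -ExB; [|by apply: int1Z; exact: L2_mul|exact: L2_mul].
    by apply: eq_Ex => x; rewrite /al2; ring.
  have := W2 _ Dg; lra.
have Y a r : L2 a -> L2 r -> `|Ex (fun x => a x * r x)| <= Ex (fun x => a x ^+ 2) / omega + omega / 4 * Ex (fun x => r x ^+ 2).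
  exact: Ex_young.
have Z (b : 'I_d -> Omega -> R) r : (forall j, L2 (b j)) -> (forall j, L2 (gr j r)) ->
   `|\sum_(j < d) Ex (fun x => b j x * gr j r x)| <= \sum_(j < d) Ex (fun x => b j x ^+ 2) + 1 / 4 * form r r.
  move=> Lb Lr; apply: (le_trans (ler_norm_sum _ _ _)).
  rewrite /form mulr_sumr -big_split /=; apply: ler_sum => j _.
  have := Ex_young ltr01 (Lb j) (Lr j); rewrite divr1.
  rewrite (_ : Ex (fun x => gr j r x * gr j r x) = Ex (fun x => gr j r x ^+ 2))//.
have Lbe1 j : L2 (be1 j) by exact: Lbe.
have Lbe2 j : L2 (be2 j) by exact: Lbe.
have sq0 f : 0 <= Ex (fun x => f x ^+ 2) by apply: Ex_ge0 => x; exact: sqr_ge0.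
have sB (b : 'I_d -> Omega -> R) : 0 <= \sum_(j < d) Ex (fun x => b j x ^+ 2) by apply: sumr_ge0.
have i2 := I2 _ Dr2.
have r21 : Ex (fun x => r2 x * r1 x) = Ex (fun x => r1 x * r2 x) by apply: eq_Ex => x; rewrite mulrC.
have i3 := I2 _ Dr1; rewrite formC in i3; have i1 := I1 _ Dr1; rewrite r21 in i1.
exact: (energy_arith homega (form_ge0 r1) (form_ge0 r2) (sq0 r1) (sq0 r2) (sq0 al1) (sq0 al2) (sB be1) (sB be2)
  i1 (I1 _ Dr2) i3 i2 (Y _ _ Lal1 Lr1) (Y _ _ Lal1 Lr2) (Y _ _ Lal2 Lr1) (Y _ _ Lal2 Lr2)
  (Z _ _ Lbe1 Lgr1) (Z _ _ Lbe1 Lgr2) (Z _ _ Lbe2 Lgr1) (Z _ _ Lbe2 Lgr2)).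
Qed.

End Approximation.

End Environment.

(** * The periodized walk *)

Section TorusForm.
Context {R : realType} {d N : nat}.
Local Notation T := (@torus d N).
Variable s : 'I_d -> T -> R.
Implicit Types (f g : T -> R) (q : 'I_d -> T -> R).

(** [s j x] stands for the square root of the conductance between [x] and [x + te j]. Wrapped edges
    are treated like all others; only the comparison with the environment singles them out. *)
Definition tgr j f x := s j x * (f (x + te j) - f x).
Definition tform f g := \sum_(j < d) tavg (fun x => tgr j f x * tgr j g x).
Definition tdv q x := \sum_(j < d) (s j x * q j x - s j (x - te j) * q j (x - te j)).
Definition tL f x := \sum_(j < d) (s j x ^+ 2 * (f (x + te j) - f x)
   + s j (x - te j) ^+ 2 * (f (x - te j) - f x)).

Lemma tavg_shiftN (j : 'I_d) (F : T -> R) : tavg (fun x => F (x - te j)) = tavg F.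
Proof.
by rewrite -(tavg_shift j (fun x => F (x - te j))); apply: eq_tavg => x; rewrite addrK.
Qed.

Lemma tdv_adj q f : tavg (fun x => tdv q x * f x) = - \sum_(j < d) tavg (fun x => q j x * tgr j f x).
Proof.
under eq_tavg do rewrite /tdv mulr_suml.
rewrite tavg_sum -sumrN; apply: eq_bigr => j _.
under eq_tavg do rewrite mulrBl.
rewrite tavgB -[X in _ - X](tavg_shift j) -tavgB -[RHS]mulN1r -tavgZ.
by apply: eq_tavg => x; rewrite addrK /tgr; ring.
Qed.

Lemma tL_dv f x : tL f x = tdv (fun j => tgr j f) x.
Proof.
by apply: eq_bigr => j _; rewrite /tgr subrK; ring.
Qed.

Lemma tL_adj f g : tavg (fun x => tL f x * g x) = - tform f g.
Proof.
by under eq_tavg do rewrite tL_dv; rewrite tdv_adj.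
Qed.

Lemma tformC f g : tform f g = tform g f.
Proof. by apply: eq_bigr => j _; apply: eq_tavg => x; rewrite mulrC. Qed.

Lemma tform_ge0 f : 0 <= tform f f.
Proof. by apply: sumr_ge0 => j _; apply: tavg_ge0 => x; rewrite -expr2 sqr_ge0. Qed.

Lemma tformB f f' g : tform (fun x => f x - f' x) g = tform f g - tform f' g.
Proof.
rewrite /tform -sumrB; apply: eq_bigr => j _; rewrite -tavgB.
by apply: eq_tavg => x; rewrite /tgr; ring.
Qed.

Lemma tavg_young (w : R) f g : 0 < w ->
  `|tavg (fun x => f x * g x)| <= tavg (fun x => f x ^+ 2) / w + w / 4 * tavg (fun x => g x ^+ 2).
Proof.
move=> w0; apply: (le_trans (normr_tavg _)).
rewrite [X in _ <= X + _]mulrC -!tavgZ -tavgD.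
apply: ler_tavg => x.
have h (t : R) : 0 <= w^-1 * f x ^+ 2 - t * (f x * g x) + t ^+ 2 * (w / 4 * g x ^+ 2).
  have -> : w^-1 * f x ^+ 2 - t * (f x * g x) + t ^+ 2 * (w / 4 * g x ^+ 2)
      = w^-1 * (f x - t * (w / 2) * g x) ^+ 2 by field; rewrite gt_eqF.
  by rewrite mulr_ge0 ?sqr_ge0// invr_ge0 ltW.
have h1 := h 1; have h2 := h (-1).
by rewrite ler_norml; apply/andP; split; lra.
Qed.

Lemma tavg_sqr_eq0 f : tavg (fun x => f x ^+ 2) = 0 -> forall x, f x = 0.
Proof.
move/eqP; rewrite mulf_eq0 invr_eq0 pnatr_eq0 -leqn0 leqNgt card_torus_gt0 /= => /eqP h x.
have := h; rewrite (bigD1 x)//= => /eqP.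
rewrite paddr_eq0 ?sqr_ge0//; last by apply: sumr_ge0 => y _; exact: sqr_ge0.
by rewrite sqrf_eq0 => /andP[/eqP].
Qed.

Section Energy.
Variables (omega : R) (k : 'I_d).
Hypothesis homega : 0 < omega.

Definition tgamma j x := s j x ^+ 2 - s j (x - te j) ^+ 2.
Definition terr (t : R) g q j x := tgr j g x + t * (j == k)%:R * s j x - q j x.

Lemma tgamma_adj j f : tavg (fun x => tgamma j x * f x) = - tavg (fun x => s j x * tgr j f x).
Proof.
under eq_tavg do rewrite /tgamma mulrBl.
rewrite tavgB -[X in _ - X](tavg_shift j) -tavgB -[RHS]mulN1r -tavgZ.
by apply: eq_tavg => x; rewrite addrK /tgr; ring.
Qed.

(** Counterpart of [env_energy]. On a finite torus every function is a test function, so the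
    approximants are arbitrary. *)
Lemma torus_energy f1 f2 g1 g2 q1 q2 :
  (forall x, tgamma k x = - omega * f2 x - tL f1 x) ->
  (forall x, 0 = omega * f1 x - tL f2 x) ->
  forall r1 r2, r1 = (fun x => f1 x - g1 x) -> r2 = (fun x => f2 x - g2 x) ->
  tform r1 r1 + tform r2 r2 + omega * (tavg (fun x => r1 x ^+ 2) + tavg (fun x => r2 x ^+ 2)) <=
  4 * (omega^-1 + 1) * (tavg (fun x => (- (omega * g2 x) - tdv q1 x) ^+ 2)
   + tavg (fun x => (omega * g1 x - tdv q2 x) ^+ 2)
   + \sum_(j < d) tavg (fun x => terr 1 g1 q1 j x ^+ 2)
   + \sum_(j < d) tavg (fun x => terr 0 g2 q2 j x ^+ 2)).
Proof.
move=> W1 W2 ? ? -> ->.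
set r1 := (fun x => f1 x - g1 x); set r2 := (fun x => f2 x - g2 x).
pose al1 x := - (omega * g2 x) - tdv q1 x; pose al2 x := omega * g1 x - tdv q2 x.
pose be1 j x := terr 1 g1 q1 j x; pose be2 j x := terr 0 g2 q2 j x.
have I (t : R) G Q g : \sum_(j < d) tavg (fun x => terr t G Q j x * tgr j g x) =
  tform G g + t * tavg (fun x => s k x * tgr k g x) + tavg (fun x => tdv Q x * g x).
  rewrite tdv_adj.
  have -> : t * tavg (fun x => s k x * tgr k g x) =
      \sum_(j < d) tavg (fun x => t * (j == k)%:R * (s j x * tgr j g x)).
    rewrite (bigD1 k)//= eqxx big1 ?addr0.
      by rewrite -tavgZ; apply: eq_tavg => x; rewrite mulr1.
    move=> j /negPf ->; rewrite -[RHS](tavg_cst (d := d) N); apply: eq_tavg => x.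
    by rewrite mulr0 mul0r.
  rewrite /tform -sumrN -!big_split /=; apply: eq_bigr => j _.
  by rewrite -tavgD -tavgB; apply: eq_tavg => x; rewrite /terr; ring.
have I1 g : tform r1 g - omega * tavg (fun x => r2 x * g x) =
    - tavg (fun x => al1 x * g x) - \sum_(j < d) tavg (fun x => be1 j x * tgr j g x).
  rewrite tformB I.
  have -> : tavg (fun x => r2 x * g x) = tavg (fun x => f2 x * g x) - tavg (fun x => g2 x * g x).
    by rewrite -tavgB; apply: eq_tavg => x; rewrite /r2; ring.
  have -> : tavg (fun x => al1 x * g x) = - omega * tavg (fun x => g2 x * g x) - tavg (fun x => tdv q1 x * g x).
    by rewrite -tavgZ -tavgB; apply: eq_tavg => x; rewrite /al1; ring.
  have : tavg (fun x => tgamma k x * g x) = - omega * tavg (fun x => f2 x * g x) + tform f1 g.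
    rewrite -[tform f1 g]opprK -tL_adj -tavgZ -tavgB.
    by apply: eq_tavg => x; rewrite W1; ring.
  rewrite tgamma_adj; lra.
have I2 g : tform r2 g + omega * tavg (fun x => r1 x * g x) =
    - tavg (fun x => al2 x * g x) - \sum_(j < d) tavg (fun x => be2 j x * tgr j g x).
  rewrite tformB I.
  have -> : tavg (fun x => r1 x * g x) = tavg (fun x => f1 x * g x) - tavg (fun x => g1 x * g x).
    by rewrite -tavgB; apply: eq_tavg => x; rewrite /r1; ring.
  have -> : tavg (fun x => al2 x * g x) = omega * tavg (fun x => g1 x * g x) - tavg (fun x => tdv q2 x * g x).
    by rewrite -tavgZ -tavgB; apply: eq_tavg => x; rewrite /al2; ring.
  have : omega * tavg (fun x => f1 x * g x) + tform f2 g = 0.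
    rewrite -[tform f2 g]opprK -tL_adj -tavgZ -tavgB -[RHS](tavg_cst (d := d) N).
    by apply: eq_tavg => x; rewrite mulrA -mulrBl -W2 mul0r.
  lra.
have Z (b : 'I_d -> T -> R) r :
   `|\sum_(j < d) tavg (fun x => b j x * tgr j r x)| <= \sum_(j < d) tavg (fun x => b j x ^+ 2) + 1 / 4 * tform r r.
  apply: (le_trans (ler_norm_sum _ _ _)).
  rewrite /tform mulr_sumr -big_split /=; apply: ler_sum => j _.
  have := tavg_young (b j) (tgr j r) ltr01; rewrite divr1.
  by rewrite (_ : tavg (fun x => tgr j r x * tgr j r x) = tavg (fun x => tgr j r x ^+ 2)).
have sq0 f : 0 <= tavg (fun x => f x ^+ 2) by apply: tavg_ge0 => x; exact: sqr_ge0.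
have sB (b : 'I_d -> T -> R) : 0 <= \sum_(j < d) tavg (fun x => b j x ^+ 2) by apply: sumr_ge0.
have i2 := I2 r2.
have r21 : tavg (fun x => r2 x * r1 x) = tavg (fun x => r1 x * r2 x) by apply: eq_tavg => x; rewrite mulrC.
have i3 := I2 r1; rewrite tformC in i3; have i1 := I1 r1; rewrite r21 in i1.
have Y := tavg_young _ _ homega.
exact: (energy_arith homega (tform_ge0 r1) (tform_ge0 r2) (sq0 r1) (sq0 r2) (sq0 al1) (sq0 al2) (sB be1) (sB be2)
  i1 (I1 r2) i3 i2 (Y al1 r1) (Y al1 r2) (Y al2 r1) (Y al2 r2) (Z be1 r1) (Z be1 r2) (Z be2 r1) (Z be2 r2)).
Qed.

(** Testing each equation against the other unknown, the symmetry of [tL] cancels the operator and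
    leaves [omega (|f1|^2 + |f2|^2) = 0]. *)
Lemma torus_inj f1 f2 :
  (forall x, 0 = - omega * f2 x - tL f1 x) -> (forall x, 0 = omega * f1 x - tL f2 x) ->
  forall x, f1 x = 0 /\ f2 x = 0.
Proof.
move=> W1 W2.
have : omega * (tavg (fun x => f1 x ^+ 2) + tavg (fun x => f2 x ^+ 2)) = 0.
  have := tL_adj f1 f2; rewrite tformC -tL_adj.
  rewrite (_ : tavg (fun x => tL f1 x * f2 x) = - omega * tavg (fun x => f2 x ^+ 2)); last first.
    by rewrite -tavgZ; apply: eq_tavg => x; have := W1 x; move/esym/eqP; rewrite subr_eq0 => /eqP <-; ring.
  rewrite (_ : tavg (fun x => tL f2 x * f1 x) = omega * tavg (fun x => f1 x ^+ 2)); last first.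
    by rewrite -tavgZ; apply: eq_tavg => x; have := W2 x; move/esym/eqP; rewrite subr_eq0 => /eqP <-; ring.
  lra.
have h0 f : 0 <= tavg (fun x => f x ^+ 2) by apply: tavg_ge0 => x; exact: sqr_ge0.
move/eqP; rewrite mulf_eq0 gt_eqF//= paddr_eq0// => /andP[/eqP e1 /eqP e2] x.
by split; exact: tavg_sqr_eq0.
Qed.

End Energy.
End TorusForm.

Section TorusResolvent.
Context {Omega : Type} {R : realType} {d : nat}.
Variable c : 'rV[int]_d -> 'rV[int]_d -> Omega -> R.
Variables (N : nat) (xi : Omega).
Hypothesis N1 : (1 < N)%N.
Local Notation T := (@torus d N).
Local Open Scope complex_scope.
Local Notation Re := (@complex.Re _).
Local Notation Im := (@complex.Im _).

Definition kap (j : 'I_d) (x : T) : R := c (torus_lift x) (torus_lift x + unitv j) xi.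

Lemma torus_lift_rep (x : T) : representative N (torus_lift x) = torus_lift x.
Proof.
apply/rowP => j; rewrite !mxE modz_small//; case: N N1 x => [|[|n]]// _ x.
by rewrite ltz_nat ltn_ord.
Qed.

Lemma lift_sub_rep (j : 'I_d) (x : T) :
  representative N (torus_lift x - unitv j) = torus_lift (x - te j).
Proof.
apply/rowP => i; rewrite !mxE /=; case: N N1 x => [|[|n]]// _ x.
have := ltn_ord (x 0 i); rewrite {2}/Zp_trunc /=; move: (x 0 i : nat) => a an.
case: (i == j) => /=; last first.
  by rewrite subr0 modz_small ?ltz_nat// subn0 modnn addn0 modn_small.
rewrite [(1 %% _)%N]modn_small// subn1 [(_.-1 %% _)%N]modn_small//=.
(* The coordinate 0 wraps around: the representative of [-1] is [N - 1]. *)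
case: a an => [|a] an.
  rewrite add0n modn_small//; have -> : (0%Z - 1 = n.+1%:Z + -1 * n.+2%:Z)%R.
    by rewrite mulN1r -[n.+2]addn1 PoszD opprD addrA subrr.
  by rewrite addrC modzMDl modz_small// ltz_nat leqnn.
rewrite addSnnS modnDr modn_small ?(ltnW an)//.
by rewrite -addn1 PoszD addrK modz_small// ltz_nat (ltnW an).
Qed.

Lemma torus_projN (j : 'I_d) : torus_proj N (- unitv j) = - te j.
Proof. by apply/rowP => i; rewrite !mxE rmorphN. Qed.

Lemma ctorus_unitv j x : ctorus c xi x (unitv j) = kap j x.
Proof.
rewrite /ctorus /periodized; case: pickP => [i /eqP/addrI/unitv_inj <-|/(_ j)].
  by rewrite torus_lift_rep.
by rewrite eqxx.
Qed.

Lemma ctorus_opp j x : ctorus c xi x (- unitv j) = kap j (x - te j).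
Proof.
rewrite /ctorus /periodized; case: pickP => [i /eqP/addrI/esym/unitv_neq_opp//|_].
case: pickP => [i /eqP|/(_ j)]; last by rewrite subrK eqxx.
rewrite -addrA -[X in X = _]addr0 => /addrI/esym/eqP; rewrite addrC subr_eq0 => /eqP/unitv_inj ->.
by rewrite lift_sub_rep.
Qed.

Lemma torus_generatorE (f : T -> R[i]) x :
  torus_generator c xi f x = \sum_(j < d) ((kap j x)%:C * (f (x + te j) - f x)
    + (kap j (x - te j))%:C * (f (x - te j) - f x)).
Proof.
rewrite /torus_generator big_nbr; apply: eq_bigr => j _.
by rewrite ctorus_unitv ctorus_opp torus_projN.
Qed.

Definition resolvent_op (omega : R) (f : {ffun T -> R[i]^o}) : {ffun T -> R[i]^o} :=
  [ffun x => 0 +i* omega * f x - \sum_(j < d) ((kap j x)%:C * (f (x + te j) - f x)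
    + (kap j (x - te j))%:C * (f (x - te j) - f x))].

Lemma resolvent_op_linear omega : linear (resolvent_op omega).
Proof.
move=> a f g; apply/ffunP => x; rewrite !ffunE /=.
rewrite /GRing.scale /= mulrBr mulr_sumr addrACA -opprD -big_split /=; congr (_ - _).
  by ring.
by apply: eq_bigr => j _; rewrite !ffunE /GRing.scale /=; ring.
Qed.

HB.instance Definition _ omega := GRing.isLinear.Build _ _ _ _ (resolvent_op omega)
  (resolvent_op_linear omega).

Hypothesis kap_gt0 : forall j x, 0 < kap j x.
Variable omega : R.
Hypothesis homega : 0 < omega.
Local Notation s := (fun j x => Num.sqrt (kap j x)).

Lemma sqr_sqrt_kap j x : Num.sqrt (kap j x) ^+ 2 = kap j x.
Proof. by rewrite sqr_sqrtr// ltW. Qed.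

Lemma ReIm_generator (h : T -> R[i]) x :
  torus_generator c xi h x = (tL s (Re \o h) x) +i* (tL s (Im \o h) x).
Proof.
rewrite torus_generatorE /tL.
have rs (F : 'I_d -> R[i]) : \sum_(j < d) F j = (\sum_(j < d) Re (F j)) +i* (\sum_(j < d) Im (F j)).
  elim/big_rec3: _ => //= j a b e _ ->; case: (F j) => u v; by [].
rewrite rs; congr (_ +i* _); apply: eq_bigr => j _; rewrite !sqr_sqrt_kap /=.
  case: (h _) => a1 a2; case: (h _) => b1 b2; case: (h _) => c1 c2 /=; ring.
case: (h _) => a1 a2; case: (h _) => b1 b2; case: (h _) => c1 c2 /=; ring.
Qed.

Lemma ReIm_resolvent (g h : T -> R[i]) x :
  g x = 0 +i* omega * h x - torus_generator c xi h x <->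
  Re (g x) = - omega * Im (h x) - tL s (Re \o h) x /\
  Im (g x) = omega * Re (h x) - tL s (Im \o h) x.
Proof.
rewrite ReIm_generator; case: (g x) => a b; case: (h x) => u v /=.
by split => [[-> ->]|[-> ->]]; [split|congr (_ +i* _)]; ring.
Qed.

(** A linear endomorphism of a finite-dimensional space is onto once it is injective; injectivity is
    [torus_inj] for the real and imaginary parts. *)
Lemma torus_resolvent_exists (g : T -> R[i]) :
  exists h, forall x, g x = 0 +i* omega * h x - torus_generator c xi h x.
Proof.
pose A := linfun (resolvent_op omega).
have kA : lker A == 0%VS.
  apply/lker0P => f f' /eqP; rewrite -subr_eq0 -linearB /= lfunE /= => /eqP e.
  apply/ffunP => x; apply/eqP; rewrite -subr_eq0; apply/eqP.
  have E y : (0 : R[i]) = 0 +i* omega * (f - f') y - torus_generator c xi (f - f') y.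
    by rewrite torus_generatorE; have := congr1 (fun h : {ffun T -> R[i]^o} => h y) e; rewrite !ffunE.
  have H y := (ReIm_resolvent (fun=> 0) (f - f') y).1 (E y).
  have [/= h1 h2] := torus_inj homega (fun y => (H y).1) (fun y => (H y).2) x.
  move: h1 h2; rewrite !ffunE; by case: (f x - f' x) => a b /= -> ->.
have : [ffun x => g x] \in limg A.
  by rewrite (lker0_limgf kA); exact: memvf.
case/memv_imgP => h _; rewrite lfunE /= => e; exists h => x.
have := congr1 (fun h : {ffun T -> R[i]^o} => h x) e.
by rewrite !ffunE torus_generatorE.
Qed.

Lemma torus_resolventP (g : T -> R[i]) x :
  let h := torus_resolvent c xi omega g in
  Re (g x) = - omega * Im (h x) - tL s (Re \o h) x /\
  Im (g x) = omega * Re (h x) - tL s (Im \o h) x.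
Proof.
apply/ReIm_resolvent; rewrite /torus_resolvent /operator_inv.
by have /(xgetPex 0)/(_ x) := torus_resolvent_exists g.
Qed.

End TorusResolvent.

(** * Convergence of the fluxes *)

Section TorusLimit.
Context {disp : measure_display} {Omega : measurableType disp} {R : realType}.
Context {d : nat}.
Variables (P : probability Omega R) (tau : 'rV[int]_d -> Omega -> Omega).
Variable c : 'rV[int]_d -> 'rV[int]_d -> Omega -> R.
Hypotheses (htau : is_action tau) (hstat : stationary P tau) (herg : ergodic P tau).
Hypotheses (hc : is_conductance c) (hcov : covariant tau c).
Hypothesis hc2 : forall z, nbr d z -> ('E_P[fun xi => (c 0 z xi ^+ 2)%R] < +oo)%E.
Implicit Types f g h : Omega -> R.
Local Notation L2 := (L2 P).
Local Notation Ex := (Ex P).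
Local Notation int1 := (int1 P).
Local Notation cnd := (cnd c).
Local Notation sq := (sq c).
Local Notation gr := (gr tau c).
Local Notation domE := (domE P tau c).

Definition pull (N : nat) (xi : Omega) f : @torus d N -> R := fun x => f (tau (torus_lift x) xi).

(** One quantity dominates all wrap-around errors: in the weight, 1 accounts for divergences and the
    conductance for gradients of bounded functions. *)
Definition layer (N : nat) (xi : Omega) : R :=
  \sum_(j < d) tavg (fun x : @torus d N => (wraps j x)%:R * (1 + pull xi (cnd j) x)).

Lemma cvgr0_le (u : nat -> R) : (forall n, (1 < n)%N -> 0 <= u n) ->
  (forall e, 0 < e -> exists n0, forall n, (n0 <= n)%N -> (1 < n)%N -> u n <= e) ->
  u n @[n --> \oo] --> 0.
Proof.
move=> u0 h; apply/cvgrPdist_le => e e0; have [n0 hn] := h e e0.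
exists (maxn 2 n0) => // n /=; rewrite geq_max => /andP[n1 nn].
by rewrite sub0r normrN ger0_norm ?u0// hn.
Qed.

Lemma layer_ge0 N xi : 0 <= layer N xi.
Proof.
apply: sumr_ge0 => j _; apply: tavg_ge0 => x; rewrite mulr_ge0// addr_ge0//.
exact/ltW/cnd_gt0.
Qed.

(** The layer is not a box, so the conductance is split at a level [M]. The bounded part contributes
    at most [(M + 1) / N]; the excess is dominated by its average over the whole torus, whose
    ergodic limit is small for large [M]. *)
Lemma layer_cvg0 : {ae P, forall xi, layer N xi @[N --> \oo] --> 0}.
Proof.
pose D j (M : nat) x := `|cnd j x - trunc M%:R (cnd j x)|.
have hD j M : int1 (D j M).
  apply/int1_norm/int1B; first exact: cnd_int1.
  apply: (@int1_bounded _ _ _ _ _ M%:R) => [|x]; last exact: trunc_bounded.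
  by apply: trunc_meas; exact: cnd_meas.
have : {ae P, forall xi, forall p : 'I_d * nat, oavg tau N (D p.1 p.2) xi @[N --> \oo] --> Ex (D p.1 p.2)}.
  by apply: ae_forall_count => -[j M]; exact: ergodic_theorem.
apply: filterS => xi hxi.
rewrite /layer -[X in _ --> X](_ : \sum_(j < d) (0 : R) = 0); last by rewrite big1.
apply: (cvg_big (op := +%R)) => [|j _]; first exact: add_continuous.
apply: cvgr0_le => [N _|e e0].
  apply: tavg_ge0 => x; rewrite mulr_ge0// addr_ge0//; exact/ltW/cnd_gt0.
have e4 : 0 < e / 4 by rewrite divr_gt0.
have [M hM] := trunc_L1 (cnd_int1 hc hc2 j) e4; have {}hM := hM M (leqnn M).
have := hxi (j, M) => /cvgrPdist_lt/(_ _ e4)/= [n0 _ h0].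
have [m hm] := natSinv_small (divr_gt0 e4 (ltr0Sn R M)).
exists (maxn m.+1 n0) => N; rewrite geq_max => /andP[mN n0N] N1.
have h1 : oavg tau N (D j M) xi <= e / 2.
  have := h0 N n0N; rewrite /= ltr_norml => /andP[h2 _].
  have : Ex (D j M) < e / 4 by exact: hM. move: h2; lra.
apply: (@le_trans _ _ (tavg (fun x : @torus d N => M.+1%:R * (wraps j x)%:R + pull xi (D j M) x))).
  apply: ler_tavg => x; case: (wraps j x); rewrite /= ?mul0r ?mulr0 ?add0r; last exact: normr_ge0.
  rewrite mul1r mulr1 -natr1 [_ + 1]addrC -addrA lerD2l /pull /D.
  have := ler_norm (cnd j (tau (torus_lift x) xi) - trunc M%:R (cnd j (tau (torus_lift x) xi))).
  have := trunc_bounded (cnd j (tau (torus_lift x) xi)) (ler0n R M).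
  by rewrite ler_norml => /andP[_ h2]; lra.
rewrite tavgD tavgZ tavg_wraps//.
have h2 : M.+1%:R * N%:R^-1 <= e / 4.
  case: N N1 mN {n0N h1} => // N _ mN.
  by have := hm N mN; rewrite ltr_pdivlMr// mulrC => /ltW.
move: h1; rewrite /oavg -/(pull xi (D j M)); move: h2; lra.
Qed.

Section PullBack.
Variables (N : nat) (xi : Omega).
Hypothesis N1 : (1 < N)%N.
Local Notation T := (@torus d N).
Implicit Types x : T.
Let s j : T -> R := pull xi (sq j).

Lemma pullE x f : pull xi f x = f (tau (torus_lift x) xi). Proof. by []. Qed.

Lemma pull_step j x f : ~~ wraps j x -> pull xi f (x + te j) = f (tau (unitv j) (tau (torus_lift x) xi)).
Proof. by move=> nw; rewrite /pull lift_add// addrC (tauD htau). Qed.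

(** Pulling back commutes with the gradient except on wrapping edges, where the two translates of
    [f] are unrelated and only its bound helps. *)
Lemma tgr_pull (C : R) f j x : tame C f ->
  `|tgr s j (pull xi f) x - pull xi (gr j f) x| <= 2 * C * ((wraps j x)%:R * s j x).
Proof.
move=> [_ fC]; rewrite [pull xi (gr j f) x]pullE -grE -!pullE -/(s j x) /tgr -mulrBr opprB addrA subrK.
have [w|nw] := boolP (wraps j x).
  have s0 : 0 <= s j x by exact: sq_ge0.
  rewrite mul1r normrM ger0_norm//.
  rewrite mulrC ler_wpM2r// (le_trans (ler_normB _ _))//.
  by rewrite mulr2n mulrDl mul1r; apply: lerD; exact: fC.
by rewrite mul0r mulr0 pull_step// subrr mulr0 normr0.
Qed.

Lemma tdv_pull (C : R) Q x : nice c C Q ->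
  `|tdv s (fun j => pull xi (Q j)) x - pull xi (dv tau c Q) x| <= 2 * C * \sum_(j < d) (wraps j (x - te j))%:R.
Proof.
move=> hQ; rewrite /tdv [pull xi (dv tau c Q) x]pullE /dv -sumrB mulr_sumr.
apply: (le_trans (ler_norm_sum _ _ _)); apply: ler_sum => j _.
have [_ [_ hC]] := hQ j.
rewrite opprB addrC -!addrA; set a := (X in `|X|).
have -> : a = sq j (tau (- unitv j) (tau (torus_lift x) xi)) * Q j (tau (- unitv j) (tau (torus_lift x) xi))
   - s j (x - te j) * pull xi (Q j) (x - te j) by rewrite /a /s !pullE; ring.
have [w|nw] := boolP (wraps j (x - te j)).
  rewrite mulr1 (le_trans (ler_normB _ _))//.
  by rewrite mulr2n mulrDl mul1r; apply: lerD; [exact: hC|exact: hC].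
have -> : tau (- unitv j) (tau (torus_lift x) xi) = tau (torus_lift (x - te j)) xi.
  by rewrite -[in torus_lift x](subrK (te j) x) lift_add// (tauD htau) addrC addrK.
by rewrite mulr0 /s !pullE subrr normr0.
Qed.

Lemma sqr_near (a b e : R) : `|a - b| <= e -> a ^+ 2 <= 2 * b ^+ 2 + 2 * e ^+ 2.
Proof.
move=> h; have : (a - b) ^+ 2 <= e ^+ 2.
  by rewrite -[leLHS]real_normK ?num_real// ler_sqr ?nnegrE// (le_trans _ h).
have := sqr_ge0 (a - 2 * b); lra.
Qed.

Lemma pull_sq2 j x : s j x ^+ 2 = pull xi (cnd j) x.
Proof. by rewrite /s /pull sqr_sq. Qed.

Lemma terr_pull (C t : R) (k : 'I_d) G Q j : tame C G ->
  tavg (fun x => terr s k t (pull xi G) (fun j => pull xi (Q j)) j x ^+ 2) <=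
  2 * oavg tau N (fun y => approx_err tau c k t G Q j y ^+ 2) xi + 8 * C ^+ 2 * layer N xi.
Proof.
move=> hG; rewrite /oavg.
have C8 : 0 <= 8 * C ^+ 2 by rewrite pmulr_rge0 ?sqr_ge0.
apply: (@le_trans _ _ (tavg (fun x : T => 2 * (pull xi (approx_err tau c k t G Q j) x) ^+ 2
   + 8 * C ^+ 2 * ((wraps j x)%:R * (1 + pull xi (cnd j) x))))).
  apply: ler_tavg => x.
  have /sqr_near : `|terr s k t (pull xi G) (fun j => pull xi (Q j)) j x - pull xi (approx_err tau c k t G Q j) x|
      <= 2 * C * ((wraps j x)%:R * s j x).
    apply: le_trans (tgr_pull j x hG); rewrite /terr [pull xi (approx_err _ _ _ _ _ _ _) x]pullE /approx_err.
    by rewrite /s !pullE le_eqVlt; apply/orP; left; apply/eqP; congr (`| _ |); ring.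
  move=> h; apply: (le_trans h); rewrite lerD2l.
  rewrite !exprMn pull_sq2; case: (wraps j x); rewrite ?expr0n ?mul0r ?mulr0//= expr1n !mul1r.
  have : 0 <= C ^+ 2 by exact: sqr_ge0.
  by move: (pull xi (cnd j) x) (C ^+ 2) => a b; lra.
rewrite tavgD !tavgZ lerD// ler_wpM2l//.
rewrite /layer (bigD1 j)//= lerDl; apply: sumr_ge0 => i _; apply: tavg_ge0 => x.
by rewrite mulr_ge0// addr_ge0//; exact/ltW/cnd_gt0.
Qed.

Lemma tdv_err_pull (C : R) Q G : nice c C Q ->
  tavg (fun x : T => (pull xi G x - tdv s (fun j => pull xi (Q j)) x) ^+ 2) <=
  2 * oavg tau N (fun y => (G y - dv tau c Q y) ^+ 2) xi + 8 * C ^+ 2 * d%:R * layer N xi.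
Proof.
move=> hQ; rewrite /oavg.
have C8 : 0 <= 8 * C ^+ 2 by rewrite pmulr_rge0 ?sqr_ge0.
apply: (@le_trans _ _ (tavg (fun x : T => 2 * (pull xi G x - pull xi (dv tau c Q) x) ^+ 2
   + 8 * C ^+ 2 * d%:R * \sum_(j < d) (wraps j (x - te j))%:R))).
  apply: ler_tavg => x.
  have /sqr_near h : `|(pull xi G x - tdv s (fun j => pull xi (Q j)) x) - (pull xi G x - pull xi (dv tau c Q) x)|
     <= 2 * C * \sum_(j < d) (wraps j (x - te j))%:R.
    rewrite distrC (_ : _ - _ = tdv s (fun j => pull xi (Q j)) x - pull xi (dv tau c Q) x).
      exact: tdv_pull.
    by ring.
  apply: (le_trans h); rewrite lerD2l exprMn.
  set S := \sum_(_ < _) _.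
  have S0 : 0 <= S by exact: sumr_ge0.
  have Sd : S <= d%:R.
    rewrite -[in leRHS](card_ord d) -sum1_card natr_sum; apply: ler_sum => j _.
    by case: wraps; rewrite ?ler01.
  (* [S] counts the wrapping edges that end at [x]; it is at most [d], so [S ^ 2 <= d S]. *)
  have -> : 2 * ((2 * C) ^+ 2 * S ^+ 2) = 8 * C ^+ 2 * (S * S) by ring.
  by rewrite -[leRHS]mulrA ler_wpM2l// ler_wpM2r.
rewrite tavgD !tavgZ lerD// ler_wpM2l//; first exact: mulr_ge0.
rewrite tavg_sum; apply: ler_sum => j _.
rewrite (tavg_shiftN j (fun x => (wraps j x)%:R)); apply: ler_tavg => x.
by rewrite -[leLHS]mulr1 ler_wpM2l// lerDl; exact/ltW/cnd_gt0.
Qed.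

Definition total_err (omega : R) k G1 G2 Q1 Q2 (y : Omega) : R :=
  (- (omega * G2 y) - dv tau c Q1 y) ^+ 2 + (omega * G1 y - dv tau c Q2 y) ^+ 2
  + \sum_(j < d) approx_err tau c k 1 G1 Q1 j y ^+ 2
  + \sum_(j < d) approx_err tau c k 0 G2 Q2 j y ^+ 2.

(** Four contributions of [8 C ^ 2 d] layers each, from the real and imaginary parts of the
    divergence and gradient errors; [8 = 2 * 2 ^ 2] comes from [sqr_near] with pointwise errors
    [2 C]. *)
Lemma torus_err_le (omega C : R) k G1 G2 Q1 Q2 :
  tame C G1 -> tame C G2 -> nice c C Q1 -> nice c C Q2 ->
  tavg (fun x : T => (- (omega * pull xi G2 x) - tdv s (fun j => pull xi (Q1 j)) x) ^+ 2)
   + tavg (fun x : T => (omega * pull xi G1 x - tdv s (fun j => pull xi (Q2 j)) x) ^+ 2)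
   + \sum_(j < d) tavg (fun x : T => terr s k 1 (pull xi G1) (fun j => pull xi (Q1 j)) j x ^+ 2)
   + \sum_(j < d) tavg (fun x : T => terr s k 0 (pull xi G2) (fun j => pull xi (Q2 j)) j x ^+ 2) <=
  2 * oavg tau N (total_err omega k G1 G2 Q1 Q2) xi + 32 * C ^+ 2 * d%:R * layer N xi.
Proof.
move=> hG1 hG2 hQ1 hQ2.
have h1 := tdv_err_pull (fun y => - (omega * G2 y)) hQ1.
have h2 := tdv_err_pull (fun y => omega * G1 y) hQ2.
have S t G Q : tame C G -> \sum_(j < d) tavg (fun x : T => terr s k t (pull xi G) (fun j => pull xi (Q j)) j x ^+ 2)
   <= 2 * (\sum_(j < d) oavg tau N (fun y => approx_err tau c k t G Q j y ^+ 2) xi) + 8 * C ^+ 2 * d%:R * layer N xi.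
  move=> hG; have -> : 8 * C ^+ 2 * d%:R * layer N xi = \sum_(j < d) 8 * C ^+ 2 * layer N xi.
    by rewrite sumr_const card_ord -[RHS]mulr_natr mulrAC.
  rewrite mulr_sumr -big_split /=; apply: ler_sum => j _; exact: terr_pull.
have h3 := S 1 G1 Q1 hG1; have h4 := S 0 G2 Q2 hG2.
rewrite (_ : oavg tau N (total_err omega k G1 G2 Q1 Q2) xi =
  oavg tau N (fun y => (- (omega * G2 y) - dv tau c Q1 y) ^+ 2) xi
  + oavg tau N (fun y => (omega * G1 y - dv tau c Q2 y) ^+ 2) xi
  + \sum_(j < d) oavg tau N (fun y => approx_err tau c k 1 G1 Q1 j y ^+ 2) xi
  + \sum_(j < d) oavg tau N (fun y => approx_err tau c k 0 G2 Q2 j y ^+ 2) xi); last first.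
  by rewrite /oavg /total_err !tavgD !tavg_sum.
have -> : 32 * C ^+ 2 * d%:R * layer N xi = 8 * C ^+ 2 * d%:R * layer N xi + 8 * C ^+ 2 * d%:R * layer N xi
  + 8 * C ^+ 2 * d%:R * layer N xi + 8 * C ^+ 2 * d%:R * layer N xi by ring.
rewrite !mulrDr; move: h1 h2 h3 h4; rewrite /pull; lra.
Qed.

(** The Young parameter [dl] is left free: the form error [E] will be small and takes the factor
    [1 / dl], while the average conductance will not and takes [dl / 4]. *)
Lemma flux_pull (C E dl : R) G j (f : T -> R) : 0 < dl -> tame C G ->
  tform s (fun x => f x - pull xi G x) (fun x => f x - pull xi G x) <= E ->
  `|tavg (fun x => s j x * tgr s j f x) - oavg tau N (fun y => sq j y * gr j G y) xi| <=
  E / dl + dl / 4 * oavg tau N (cnd j) xi + 2 * C * layer N xi.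
Proof.
move=> dl0 hG hE; set r := fun x => f x - pull xi G x.
have C0 : 0 <= C by have [_ h] := hG; exact: le_trans (normr_ge0 _) (h xi).
have -> : tavg (fun x => s j x * tgr s j f x) - oavg tau N (fun y => sq j y * gr j G y) xi =
   tavg (fun x => tgr s j r x * s j x) + tavg (fun x => s j x * (tgr s j (pull xi G) x - pull xi (gr j G) x)).
  by rewrite /oavg -tavgB -tavgD; apply: eq_tavg => x; rewrite /tgr /s /r !pullE; ring.
apply: (le_trans (ler_normD _ _)); apply: lerD.
  apply: (le_trans (tavg_young (tgr s j r) (s j) dl0)); apply: lerD.
    rewrite ler_wpM2r ?invr_ge0 ?(ltW dl0)//; apply: le_trans hE.
    rewrite /tform (bigD1 j)//= lerDl; apply: sumr_ge0 => i _; apply: tavg_ge0 => x.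
    by rewrite -expr2 sqr_ge0.
  by rewrite (_ : tavg (fun x => s j x ^+ 2) = oavg tau N (cnd j) xi)//; apply: eq_tavg => x; exact: pull_sq2.
apply: (le_trans (normr_tavg _)).
apply: (@le_trans _ _ (2 * C * tavg (fun x : T => (wraps j x)%:R * (1 + pull xi (cnd j) x)))).
  rewrite -tavgZ; apply: ler_tavg => x.
  have s0 : 0 <= s j x by exact: sq_ge0.
  rewrite normrM ger0_norm//; apply: (le_trans (ler_wpM2l s0 (tgr_pull j x hG))).
  have -> : s j x * (2 * C * ((wraps j x)%:R * s j x)) = 2 * C * ((wraps j x)%:R * s j x ^+ 2) by ring.
  by rewrite pull_sq2 ler_wpM2l ?mulr_ge0// ler_wpM2l// lerDr.
rewrite ler_wpM2l ?mulr_ge0// /layer (bigD1 j)//= lerDl; apply: sumr_ge0 => i _; apply: tavg_ge0 => x.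
by rewrite mulr_ge0// addr_ge0//; exact/ltW/cnd_gt0.
Qed.

End PullBack.

Lemma flux_env (E dl : R) (C : R) G h j : 0 < dl -> tame C G -> domE h ->
  form P tau c (fun x => h x - G x) (fun x => h x - G x) <= E ->
  `|Ex (fun x => sq j x * gr j h x) - Ex (fun x => sq j x * gr j G x)| <= E / dl + dl / 4 * Ex (cnd j).
Proof.
move=> dl0 hG dh hE.
have dG : domE G by have [mG GC] := hG; exact: domE_bounded mG GC.
have dr : domE (fun x => h x - G x).
  by under eq_fun do rewrite addrC -mulN1r; exact: domE_lin.
have I f : domE f -> int1 (fun x => sq j x * gr j f x).
  by move=> [_ df]; apply: L2_mul => //; exact: sq_L2.
rewrite -ExB; [|exact: I..].
rewrite (@eq_Ex _ _ _ _ _ (fun x => gr j (fun x => h x - G x) x * sq j x)); last first.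
  by move=> x; rewrite -!grE; ring.
apply: le_trans (Ex_young dl0 (dr.2 j) (sq_L2 hc hc2 j)) _; apply: lerD.
  rewrite ler_wpM2r ?invr_ge0 ?(ltW dl0)//; apply: le_trans hE.
  rewrite /form (bigD1 j)//= lerDl; apply: sumr_ge0 => i _; apply: Ex_ge0 => x.
  by rewrite -expr2 sqr_ge0.
by rewrite (@eq_Ex _ _ _ _ (fun x => sq j x ^+ 2) (cnd j))// => x; exact: sqr_sq.
Qed.

Lemma flux_cvg_of_approx xi j h (f : forall N, @torus d N -> R) (K B : R) : domE h -> 0 <= K -> 0 <= B ->
  oavg tau N (cnd j) xi @[N --> \oo] --> Ex (cnd j) ->
  layer N xi @[N --> \oo] --> 0 ->
  (forall e, 0 < e -> exists (C : R) G F,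
     [/\ tame C G, form P tau c (fun x => h x - G x) (fun x => h x - G x) <= K * e,
       oavg tau N F xi @[N --> \oo] --> Ex F, Ex F < e &
       oavg tau N (fun y => sq j y * gr j G y) xi @[N --> \oo] --> Ex (fun y => sq j y * gr j G y)] /\
     forall N, (1 < N)%N ->
       tform (fun j => pull xi (sq j)) (fun x => f N x - pull xi G x) (fun x => f N x - pull xi G x) <=
       K * (2 * oavg tau N F xi + B * C ^+ 2 * layer N xi)) ->
  tavg (fun x => pull xi (sq j) x * tgr (fun j => pull xi (sq j)) j (f N) x) @[N --> \oo] -->
    Ex (fun y => sq j y * gr j h y).
Proof.
move=> dh K0 B0 hcnd hlay happ; apply/cvgrPdist_le => eta eta0.
have c0 : 0 <= Ex (cnd j) by apply: Ex_ge0 => x; exact/ltW/cnd_gt0.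
set cj := Ex (cnd j) in hcnd c0.
(* Order of the choices: [dl] from [eta] and the mean conductance, [e] from [dl], then the
   approximants with their bound [C], and last [N], large enough for the layer to beat [D]. The
   shares are [eta / 2] for the terms in [dl], and [eta / 8] each for the approximation (five copies
   of [K e / dl]), the ergodic average of the flux and the layer. *)
pose dl := eta / (cj + 1).
have dl0 : 0 < dl by rewrite divr_gt0// ltr_wpDl.
have dlc : dl / 4 * (2 * cj + 1) <= eta / 2.
  have -> : dl / 4 * (2 * cj + 1) = eta / 4 * ((2 * cj + 1) / (cj + 1)) by rewrite /dl; ring.
  have : (2 * cj + 1) / (cj + 1) <= 2 by rewrite ler_pdivrMr ?ltr_wpDl//; lra.
  by move=> hc2'; rewrite (le_trans (ler_wpM2l _ hc2')) ?divr_ge0 ?(ltW eta0)//; lra.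
pose e := eta * dl / (40 * (K + 1)).
have K1 : 0 < K + 1 by rewrite ltr_wpDl.
have e0 : 0 < e by apply: divr_gt0; apply: mulr_gt0.
have Ke : 5 * (K * e) / dl <= eta / 8.
  have -> : 5 * (K * e) / dl = eta / 8 * (K / (K + 1)).
    by rewrite /e; field; rewrite ?gt_eqF.
  rewrite ler_piMr ?divr_ge0 ?(ltW eta0)// ler_pdivrMr//; lra.
have [C [G [F [[hG hform hF Fe hGj] htf]]]] := happ e e0.
have C0 : 0 <= C by have [_ h'] := hG; exact: le_trans (normr_ge0 _) (h' xi).
pose D := K * (B * C ^+ 2) / dl + 2 * C.
have D0 : 0 <= D by rewrite addr_ge0 ?mulr_ge0 ?invr_ge0 ?sqr_ge0 ?(ltW dl0).
have D1 : 0 < D + 1 by rewrite ltr_wpDl.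
have e8 : 0 < eta / 8 by rewrite divr_gt0.
have hE := flux_env j dl0 hG dh hform.
move/cvgrPdist_le/(_ _ ltr01) in hcnd.
move/cvgrPdist_le/(_ _ (divr_gt0 e8 D1)) in hlay.
move/cvgrPdist_le/(_ _ e8) in hGj.
move/cvgrPdist_le/(_ _ e0) in hF.
have n1 : \forall N \near \oo, (1 < N)%N by exists 2.
near=> N.
have N1 : (1 < N)%N by near: N.
have : `|cj - oavg tau N (cnd j) xi| <= 1 by near: N; exact: hcnd.
have : `|0 - layer N xi| <= eta / 8 / (D + 1) by near: N; exact: hlay.
have : `|Ex (fun y => sq j y * gr j G y) - oavg tau N (fun y => sq j y * gr j G y) xi| <= eta / 8.
  by near: N; exact: hGj.
have : `|Ex F - oavg tau N F xi| <= e by near: N; exact: hF.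
rewrite sub0r normrN [`|layer _ _|]ger0_norm ?layer_ge0// [layer _ _ <= _]ler_pdivlMr//.
have := flux_pull N1 j dl0 hG (htf N N1).
move: hE; rewrite -/cj.
set a1 := Ex _; set a2 := Ex _; set t := tavg _; set o2 := oavg _ _ _ _; set o1 := oavg _ _ _ _; set o3 := oavg _ _ _ _.
set l := layer _ _ => H1 H2 H3 H4 H5 H6.
have L0 : 0 <= l by exact: layer_ge0.
have -> : a1 - t = (a1 - a2) + (a2 - o2) - (t - o2) by ring.
apply: (le_trans (ler_normB _ _)); apply: (le_trans (lerD (ler_normD _ _) (lexx _))).
apply: (le_trans (lerD (lerD H1 H4) H2)).
have H7 : o1 <= 2 * e by move: H3; rewrite ler_norml => /andP[]; lra.
have H8 : o3 <= cj + 1 by move: H6; rewrite ler_norml => /andP[]; lra.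
have H9 : K * (2 * o1 + B * C ^+ 2 * l) / dl <= 4 * (K * e) / dl + K * (B * C ^+ 2) / dl * l.
  have -> : 4 * (K * e) / dl + K * (B * C ^+ 2) / dl * l = K * (4 * e + B * C ^+ 2 * l) / dl by ring.
  by rewrite ler_wpM2r ?invr_ge0 ?(ltW dl0)// ler_wpM2l// lerD2r; lra.
have H10 : dl / 4 * o3 <= dl / 4 * (cj + 1) by rewrite ler_wpM2l// divr_ge0// ltW.
have H11 : l * D = K * (B * C ^+ 2) / dl * l + 2 * C * l by rewrite /D; ring.
have H12 : K * e / dl * 5 <= eta / 8 by move: Ke; rewrite (_ : 5 * (K * e) / dl = K * e / dl * 5)//; ring.
have H13 : 4 * (K * e) / dl = K * e / dl * 4 by ring.
have H14 : dl / 4 * cj * 2 + dl / 4 <= eta / 2.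
  by move: dlc; rewrite (_ : dl / 4 * (2 * cj + 1) = dl / 4 * cj * 2 + dl / 4)//; ring.
have H15 : l * D + l <= eta / 8 by rewrite -[X in _ + X]mulr1 -mulrDr.
move: H9 H10 H15; rewrite H11 H13 [dl / 4 * (cj + 1)]mulrDr mulr1; move: H12 H14 L0 eta0.
move: (K * e / dl) (dl / 4 * cj) (dl / 4) (K * (B * C ^+ 2) / dl * l) (2 * C * l) (K * (2 * o1 + B * C ^+ 2 * l) / dl) => z1 z2 z3 z4 z5 z6.
clear -o3.
lra.
Unshelve. all: by end_near.
Qed.

Section Limit.
Variables (omega : R) (k : 'I_d).
Hypothesis homega : 0 < omega.

Lemma total_err_int1 (C : R) G1 G2 Q1 Q2 : tame C G1 -> tame C G2 -> nice c C Q1 -> nice c C Q2 ->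
  int1 (total_err omega k G1 G2 Q1 Q2) /\ Ex (total_err omega k G1 G2 Q1 Q2) =
  Ex (fun x => (- (omega * G2 x) - dv tau c Q1 x) ^+ 2)
   + Ex (fun x => (omega * G1 x - dv tau c Q2 x) ^+ 2)
   + \sum_(j < d) Ex (fun x => approx_err tau c k 1 G1 Q1 j x ^+ 2)
   + \sum_(j < d) Ex (fun x => approx_err tau c k 0 G2 Q2 j x ^+ 2).
Proof.
move=> hG1 hG2 hQ1 hQ2.
have i1 : int1 (fun x => (- (omega * G2 x) - dv tau c Q1 x) ^+ 2).
  apply/L2_sqr/L2B; last exact: dv_L2 hQ1.
  by apply/L2N/L2Z; exact: tame_L2 hG2.
have i2 : int1 (fun x => (omega * G1 x - dv tau c Q2 x) ^+ 2).
  apply/L2_sqr/L2B; last exact: dv_L2 hQ2.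
  by apply/L2Z; exact: tame_L2 hG1.
have i3 t G Q : tame C G -> nice c C Q -> forall j, int1 (fun x => approx_err tau c k t G Q j x ^+ 2).
  move=> hG hQ j; apply/L2_sqr/L2B; last by have [h _] := hQ j; exact: tame_L2 h.
  apply: L2D; last by apply: L2Z; exact: sq_L2.
  by have [mG GC] := hG; have [_] := domE_bounded htau hc hc2 mG GC.
split.
  by rewrite /total_err; apply: int1D; [apply: int1D; [exact: int1D|]|]; apply: int1_sum => j; exact: i3.
rewrite /total_err ExD; last 2 first.
- by apply: int1D; [exact: int1D|]; apply: int1_sum => j; exact: i3.
- by apply: int1_sum => j; exact: i3.
rewrite ExD; last 2 first.
- exact: int1D.
- by apply: int1_sum => j; exact: i3.
rewrite ExD//; congr (_ + _ + _); apply: Ex_sum => j; exact: i3.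
Qed.

Variables h1 h2 : Omega -> R.
Hypotheses (dh1 : domE h1) (dh2 : domE h2).
Hypothesis weak1 : forall g, domE g -> form P tau c h1 g - omega * Ex (fun x => h2 x * g x) =
  - Ex (fun x => sq k x * gr k g x).
Hypothesis weak2 : forall g, domE g -> form P tau c h2 g + omega * Ex (fun x => h1 x * g x) = 0.
(** The torus solutions depend on [xi], so the exceptional set has to be fixed before them. It comes
    from countably many limits, [layer_cvg0] and the ergodic averages attached to approximants of
    error [1 / (n + 1)]; the energy estimates hold at every [xi]. *)
Theorem flux_cvg : {ae P, forall xi, forall f1 f2 : forall N, @torus d N -> R,
  (forall N, (1 < N)%N -> forall x : @torus d N,
     tgamma (fun j => pull xi (sq j)) k x = - omega * f2 N x - tL (fun j => pull xi (sq j)) (f1 N) x) ->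
  (forall N, (1 < N)%N -> forall x : @torus d N,
     0 = omega * f1 N x - tL (fun j => pull xi (sq j)) (f2 N) x) ->
  forall j,
  tavg (fun x => pull xi (sq j) x * tgr (fun j => pull xi (sq j)) j (f1 N) x) @[N --> \oo] -->
    Ex (fun y => sq j y * gr j h1 y) /\
  tavg (fun x => pull xi (sq j) x * tgr (fun j => pull xi (sq j)) j (f2 N) x) @[N --> \oo] -->
    Ex (fun y => sq j y * gr j h2 y)}.
Proof.
have e_gt0 n : 0 < (n.+1%:R : R)^-1 by rewrite invr_gt0.
have [C /choice[G1 /choice[G2 /choice[Q1 /choice[Q2 appr]]]]] :=
  choice (fun n => approximation htau hstat hc hc2 k homega (e_gt0 n)).
pose F n := total_err omega k (G1 n) (G2 n) (Q1 n) (Q2 n).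
have hF n : int1 (F n) /\ Ex (F n) < n.+1%:R^-1.
  have [[_ tG1 tG2 nQ1 nQ2] ?] := appr n.
  by have [? E] := total_err_int1 tG1 tG2 nQ1 nQ2; rewrite /F E.
have iG n j (G : Omega -> R) : tame (C n) G -> int1 (fun y => sq j y * gr j G y).
  move=> [mG GC]; apply: L2_mul; first exact: sq_L2.
  by have [_] := domE_bounded htau hc hc2 mG GC.
have A1 : {ae P, forall xi, forall j, oavg tau N (cnd j) xi @[N --> \oo] --> Ex (cnd j)}.
  by apply: ae_forall_count => j; apply: ergodic_theorem => //; exact: cnd_int1.
have A2 : {ae P, forall xi, forall n, oavg tau N (F n) xi @[N --> \oo] --> Ex (F n)}.
  by apply: ae_forall_count => n; apply: ergodic_theorem => //; have [] := hF n.
have A3 : {ae P, forall xi, forall p : nat * 'I_d,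
   oavg tau N (fun y => sq p.2 y * gr p.2 (G1 p.1) y) xi @[N --> \oo] --> Ex (fun y => sq p.2 y * gr p.2 (G1 p.1) y)}.
  apply: ae_forall_count => -[n j]; apply: ergodic_theorem => //; apply: (iG n).
  by have [[]] := appr n.
have A4 : {ae P, forall xi, forall p : nat * 'I_d,
   oavg tau N (fun y => sq p.2 y * gr p.2 (G2 p.1) y) xi @[N --> \oo] --> Ex (fun y => sq p.2 y * gr p.2 (G2 p.1) y)}.
  apply: ae_forall_count => -[n j]; apply: ergodic_theorem => //; apply: (iG n).
  by have [[]] := appr n.
apply: filterS (filterI (filterI layer_cvg0 A1) (filterI A2 (filterI A3 A4))).
move=> xi [[a0 a1] [a2 [a3 a4]]] f1 f2 E1 E2 j.
pose K : R := 4 * (omega^-1 + 1).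
have w0 : 0 < omega^-1 by rewrite invr_gt0.
have K0 : 0 <= K by rewrite mulr_ge0// addr_ge0// ltW.
have B0 : 0 <= 32 * d%:R :> R by rewrite mulr_ge0.
have envE n : form P tau c (fun x => h1 x - G1 n x) (fun x => h1 x - G1 n x)
   + form P tau c (fun x => h2 x - G2 n x) (fun x => h2 x - G2 n x) <= K * Ex (F n).
  have [[_ tG1 tG2 nQ1 nQ2] _] := appr n.
  have [_ ->] := total_err_int1 tG1 tG2 nQ1 nQ2.
  apply: le_trans (env_energy htau hstat hc hc2 homega tG1 tG2 nQ1 nQ2 dh1 dh2 weak1 weak2 (erefl _) (erefl _)).
  by rewrite lerDl mulr_ge0 ?(ltW homega)// addr_ge0// Ex_ge0// => x; exact: sqr_ge0.
have torE n N : (1 < N)%N ->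
   tform (fun j => pull xi (sq j)) (fun x : @torus d N => f1 N x - pull xi (G1 n) x) (fun x => f1 N x - pull xi (G1 n) x)
   + tform (fun j => pull xi (sq j)) (fun x : @torus d N => f2 N x - pull xi (G2 n) x) (fun x => f2 N x - pull xi (G2 n) x)
   <= K * (2 * oavg tau N (F n) xi + 32 * d%:R * C n ^+ 2 * layer N xi).
  move=> N1; have [[_ tG1 tG2 nQ1 nQ2] _] := appr n.
  have H := torus_energy homega (fun j => pull xi (Q1 n j)) (fun j => pull xi (Q2 n j)) (E1 N N1) (E2 N N1)
    (erefl (fun x => f1 N x - pull xi (G1 n) x)) (erefl (fun x => f2 N x - pull xi (G2 n) x)).
  have H' := @torus_err_le N xi N1 omega (C n) k (G1 n) (G2 n) (Q1 n) (Q2 n) tG1 tG2 nQ1 nQ2.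
  rewrite [32 * d%:R * _]mulrAC.
  apply: le_trans (_ : _ <= _) (le_trans H (ler_wpM2l K0 H')).
  rewrite lerDl mulr_ge0 ?(ltW homega)// addr_ge0// tavg_ge0// => x; exact: sqr_ge0.
have small (e : R) : 0 < e -> exists n, n.+1%:R^-1 < e.
  by move=> /natSinv_small[n hn]; exists n; exact: hn.
split.
- apply: (@flux_cvg_of_approx xi j h1 f1 K (32 * d%:R)) => // e /small[n ne].
  exists (C n), (G1 n), (F n); have [[C0 tG1 tG2 nQ1 nQ2] _] := appr n; have [_ Fn] := hF n.
  have Fe : Ex (F n) < e by exact: lt_trans Fn ne.
  split; first split => //; [|exact: (a3 (n, j))|].
    apply: le_trans (_ : _ <= K * Ex (F n)) _; last by rewrite ler_wpM2l// ltW.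
    by apply: le_trans (envE n); rewrite lerDl form_ge0.
  by move=> N N1; apply: le_trans (torE n N N1); rewrite lerDl tform_ge0.
- apply: (@flux_cvg_of_approx xi j h2 f2 K (32 * d%:R)) => // e /small[n ne].
  exists (C n), (G2 n), (F n); have [[C0 tG1 tG2 nQ1 nQ2] _] := appr n; have [_ Fn] := hF n.
  have Fe : Ex (F n) < e by exact: lt_trans Fn ne.
  split; first split => //; [|exact: (a4 (n, j))|].
    apply: le_trans (_ : _ <= K * Ex (F n)) _; last by rewrite ler_wpM2l// ltW.
    by apply: le_trans (envE n); rewrite lerDr form_ge0.
  by move=> N N1; apply: le_trans (torE n N N1); rewrite lerDr tform_ge0.
Qed.

End Limit.

End TorusLimit.

(** * From the real systems to the complex mobility matrices *)

Local Open Scope complex_scope.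
Local Notation Re := (@complex.Re _).
Local Notation Im := (@complex.Im _).

Section ComplexLimits.
Context {R : realType}.

Lemma cvg_complex (T : Type) (F : set_system T) (FF : Filter F) (f : T -> R[i]^o) (l : R[i]^o) :
  Re (f x) @[x --> F] --> Re l -> Im (f x) @[x --> F] --> Im l -> f x @[x --> F] --> l.
Proof.
move=> hr hi; apply/cvgrPdist_lt => -[e ei]; rewrite ltcE /= => /andP[/eqP -> e0].
have e2 : 0 < e / 2 by rewrite divr_gt0.
move/cvgrPdist_lt/(_ _ e2) in hr; move/cvgrPdist_lt/(_ _ e2) in hi.
near=> x.
have h1 : `|Re l - Re (f x)| < e / 2 by near: x; exact: hr.
have h2 : `|Im l - Im (f x)| < e / 2 by near: x; exact: hi.
move: h1 h2; case: (f x) (l) => a b [u v] /= h1 h2.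
rewrite normc_def /= ltcR /=.
apply: le_lt_trans (_ : _ <= `|u - a| + `|v - b|) _; last by move: h1 h2; lra.
rewrite -[leRHS]ger0_norm ?addr_ge0// -sqrtr_sqr.
  rewrite ler_sqrt ?sqr_ge0// [leRHS]sqrrD !real_normK ?num_real//.
  by rewrite [leRHS]addrAC lerDl mulrn_wge0// mulr_ge0.
Unshelve. all: by end_near.
Qed.

Lemma cvg_matrix (m n : nat) (T : Type) (U : topologicalType) (F : set_system T) (FF : Filter F)
   (f : T -> 'M[U]_(m, n)) (M : 'M[U]_(m, n)) :
  (forall i j, f x i j @[x --> F] --> M i j) -> f x @[x --> F] --> M.
Proof.
move=> h A [Q hQ sQA].
have : \forall x \near F, forall p : 'I_m * 'I_n, Q p.1 p.2 (f x p.1 p.2).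
  by apply: filter_forall => -[i j]; exact: h (hQ i j).
by apply: filterS => x hx; apply: sQA => i j; exact: (hx (i, j)).
Qed.

Lemma sum_complex (I : Type) (r : seq I) (f : I -> R[i]) :
  \sum_(i <- r) f i = (\sum_(i <- r) Re (f i)) +i* (\sum_(i <- r) Im (f i)).
Proof. by elim/big_rec3: _ => //= j a b e _ ->; case: (f j). Qed.

Lemma torus_meanE d N (f : @torus d N -> R[i]) :
  torus_mean f = tavg (Re \o f) +i* tavg (Im \o f).
Proof.
rewrite /torus_mean sum_complex -(rmorph_nat (real_complex R)) -fmorphV /tavg /=.
by congr (_ +i* _); rewrite mul0r ?subr0 ?addr0.
Qed.

Lemma torus_innerE d N (a : @torus d N -> R) (f : @torus d N -> R[i]) :
  torus_inner (fun x => (a x)%:C) f = tavg (fun x => a x * Re (f x)) +i* tavg (fun x => a x * Im (f x)).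
Proof.
rewrite /torus_inner torus_meanE; congr (_ +i* _); apply: eq_tavg => x /=.
  by case: (f x) => u v /=; ring.
by case: (f x) => u v /=; ring.
Qed.

End ComplexLimits.

Section Mobility.
Context {disp : measure_display} {Omega : measurableType disp} {R : realType}.
Context {d : nat}.
Variables (P : probability Omega R) (tau : 'rV[int]_d -> Omega -> Omega).
Variable c : 'rV[int]_d -> 'rV[int]_d -> Omega -> R.
Hypotheses (htau : is_action tau) (hstat : stationary P tau).
Hypotheses (hc : is_conductance c) (hcov : covariant tau c).
Hypothesis hc2 : forall z, nbr d z -> ('E_P[fun xi => (c 0 z xi ^+ 2)%R] < +oo)%E.
Variable L : (Omega -> R) -> (Omega -> R) -> Prop.
Hypothesis hL : is_dirichlet_operator P tau c L.
Variable omega : R.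
Hypothesis homega : 0 < omega.
Implicit Types f g h : Omega -> R.
Local Notation L2 := (L2 P).
Local Notation Ex := (Ex P).
Local Notation int1 := (int1 P).
Local Notation cnd := (cnd c).
Local Notation sq := (sq c).
Local Notation gr := (gr tau c).
Local Notation domE := (domE P tau c).

Definition gam j (x : Omega) : R := env_gamma c x 0 j.

Lemma gamE j x : gam j x = cnd j x - cnd j (tau (- unitv j) x).
Proof. by rewrite /gam /env_gamma mxE (cndN hc hcov). Qed.

Lemma gam_L2 j : L2 (gam j).
Proof.
rewrite (_ : gam j = fun x => cnd j x - cnd j (tau (- unitv j) x)); last first.
  by apply/funext => x; rewrite gamE.
apply: L2B; first exact: cnd_L2.
exact: (L2_comp htau hstat (- unitv j) (cnd_L2 hc hc2 j)).
Qed.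

Lemma Ex_gam j f : domE f -> Ex (fun x => gam j x * f x) = - Ex (fun x => sq j x * gr j f x).
Proof.
move=> [Lf dfj].
have Lc := cnd_L2 hc hc2 j.
have Lfj := L2_comp htau hstat (unitv j) Lf.
have Lcj := L2_comp htau hstat (- unitv j) Lc.
rewrite (@eq_Ex _ _ _ _ _ (fun x => cnd j x * f x - cnd j (tau (- unitv j) x) * f x)); last first.
  by move=> x; rewrite gamE mulrBl.
rewrite ExB; [|exact: L2_mul..].
rewrite [X in _ - X](_ : _ = Ex (fun x => cnd j x * f (tau (unitv j) x))); last first.
  rewrite -(Ex_comp htau hstat (unitv j)); last exact: L2_mul.
  by apply: eq_Ex => x; rewrite (tauK htau).
rewrite -opprB -ExB; [|exact: L2_mul..]; congr (- _).
by apply: eq_Ex => x; rewrite -grE mulrA -expr2 (sqr_sq hc) mulrBr.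
Qed.

Definition res k : Omega -> R[i] := operator_inv 0 (iomega_sub P L omega) (env_gammaC c k).
Definition res1 k := Re \o res k.
Definition res2 k := Im \o res k.

(** [operator_inv] is a choice with default value 0, so a preimage has to be exhibited; afterwards
    only the equation satisfied by the chosen one is used. *)
Lemma res_solves k : iomega_sub P L omega (res k) (env_gammaC c k).
Proof.
suff : exists H, iomega_sub P L omega H (env_gammaC c k) by move/(xgetPex 0).
have [u1 [w1 [u2 [w2 [A1 A2 E1 E2]]]]] := sa_resolvent (L_selfadjoint hL) homega (gam_L2 k).
exists (fun x => u1 x +i* u2 x), (fun x => w1 x +i* w2 x); first by split.
apply: aeW => x; rewrite /env_gammaC -/(gam k x) /=.
apply/eqP; rewrite eq_complex /= (E1 x); apply/andP; split; apply/eqP; first by ring.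
by rewrite mul0r add0r -E2.
Qed.

Lemma res_spec k : exists w1 w2, [/\ L (res1 k) w1, L (res2 k) w2,
    {ae P, forall x, gam k x = - omega * res2 k x - w1 x} &
    {ae P, forall x, 0 = omega * res1 k x - w2 x}].
Proof.
have [w [L1 L2'] aew] := res_solves k.
exists (Re \o w), (Im \o w); split => //; apply: filterS aew => x /=; rewrite /res1 /res2 /=.
  by rewrite /env_gammaC -/(gam k x); case: (res k x) (w x) => a b [a' b'] [-> _] /=; ring.
by rewrite /env_gammaC -/(gam k x); case: (res k x) (w x) => a b [a' b'] [_] /=; rewrite mul0r add0r.
Qed.

Lemma res_dom k : domE (res1 k) /\ domE (res2 k).
Proof.
have [w1 [w2 [A1 A2 _ _]]] := res_spec k.
by split; [have [] := L_weak htau hstat hc hcov hL A1|have [] := L_weak htau hstat hc hcov hL A2].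
Qed.

Lemma res_weak1 k g : domE g ->
  form P tau c (res1 k) g - omega * Ex (fun x => res2 k x * g x) = - Ex (fun x => sq k x * gr k g x).
Proof.
move=> dg; have [w1 [w2 [A1 A2 E1 E2]]] := res_spec k.
have [_ -> //] := L_weak htau hstat hc hcov hL A1.
have [Lr Lw] := sa_L2 (L_selfadjoint hL) A1.
have Lr2 : L2 (res2 k) by have [_ []] := res_dom k.
have Lg : L2 g by case: dg.
rewrite -Ex_gam// -ExN; last exact: L2_mul.
rewrite -ExZ; last exact: L2_mul.
rewrite -ExB; last 2 first.
- by apply/int1N/L2_mul.
- by apply/int1Z/L2_mul.
apply: ae_eq_Ex.
- by apply: int1B; [apply/int1N/L2_mul|apply/int1Z/L2_mul].
- by apply: L2_mul => //; exact: gam_L2.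
by apply: filterS E1 => x ->; ring.
Qed.

Lemma res_weak2 k g : domE g ->
  form P tau c (res2 k) g + omega * Ex (fun x => res1 k x * g x) = 0.
Proof.
move=> dg; have [w1 [w2 [A1 A2 E1 E2]]] := res_spec k.
have [_ -> //] := L_weak htau hstat hc hcov hL A2.
have [Lr Lw] := sa_L2 (L_selfadjoint hL) A2.
have Lr1 : L2 (res1 k) by have [[]] := res_dom k.
have Lg : L2 g by case: dg.
apply/eqP; rewrite addrC subr_eq0; apply/eqP.
rewrite -ExZ; last exact: L2_mul.
apply: ae_eq_Ex; [exact/int1Z/L2_mul|exact: L2_mul|].
by apply: filterS E2 => x /esym/eqP; rewrite subr_eq0 mulrA => /eqP ->.
Qed.

Lemma Cinner_gam j (f : Omega -> R[i]) :
  Cinner P (env_gammaC c j) f = Ex (fun x => gam j x * Re (f x)) +i* Ex (fun x => gam j x * Im (f x)).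
Proof.
by congr (_ +i* _); apply: eq_Ex => x; rewrite /env_gammaC -/(gam j x); case: (f x) => a b /=; ring.
Qed.

Lemma mobility_cvg (herg : ergodic P tau) :
  {ae P, forall xi, torus_mobility c N xi omega @[N --> \oo] --> limit_mobility P c L omega}.
Proof.
have AF : {ae P, forall xi, forall k, forall f1 f2 : forall N, @torus d N -> R,
  (forall N, (1 < N)%N -> forall x : @torus d N,
     tgamma (fun j => pull tau xi (sq j)) k x = - omega * f2 N x - tL (fun j => pull tau xi (sq j)) (f1 N) x) ->
  (forall N, (1 < N)%N -> forall x : @torus d N,
     0 = omega * f1 N x - tL (fun j => pull tau xi (sq j)) (f2 N) x) ->
  forall j,
  tavg (fun x => pull tau xi (sq j) x * tgr (fun j => pull tau xi (sq j)) j (f1 N) x) @[N --> \oo] -->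
    Ex (fun y => sq j y * gr j (res1 k) y) /\
  tavg (fun x => pull tau xi (sq j) x * tgr (fun j => pull tau xi (sq j)) j (f2 N) x) @[N --> \oo] -->
    Ex (fun y => sq j y * gr j (res2 k) y)}.
  apply: ae_forall_count => k; have [d1 d2] := res_dom k.
  by apply: flux_cvg => //; [exact: res_weak1|exact: res_weak2].
have AC : {ae P, forall xi, forall j, oavg tau N (cnd j) xi @[N --> \oo] --> Ex (cnd j)}.
  by apply: ae_forall_count => j; apply: ergodic_theorem => //; exact: cnd_int1.
apply: filterS (filterI AF AC) => xi [aF aC].
have kapE N j (x : @torus d N) : kap c xi j x = pull tau xi (cnd j) x by exact: cnd_shift.
have sE N : (fun j (x : @torus d N) => Num.sqrt (kap c xi j x)) = (fun j => pull tau xi (sq j)).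
  by apply/funext => j; apply/funext => x; rewrite kapE.
have k0 N j (x : @torus d N) : 0 < kap c xi j x by rewrite kapE; exact: cnd_gt0.
have pull2 N j (x : @torus d N) : pull tau xi (sq j) x ^+ 2 = kap c xi j x.
  by rewrite kapE /pull sqr_sq.
have gE N j (x : @torus d N) : (1 < N)%N -> torus_gamma c xi j x = (tgamma (fun j => pull tau xi (sq j)) j x)%:C.
  by move=> N1; rewrite /torus_gamma ctorus_unitv ?ctorus_opp// /tgamma !pull2.
pose ph k N := torus_resolvent c (N := N) xi omega (torus_gamma c xi k).
have spec k N (N1 : (1 < N)%N) (x : @torus d N) :
    tgamma (fun j => pull tau xi (sq j)) k x = - omega * Im (ph k N x) - tL (fun j => pull tau xi (sq j)) (Re \o ph k N) x
    /\ 0 = omega * Re (ph k N x) - tL (fun j => pull tau xi (sq j)) (Im \o ph k N) x.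
  have := torus_resolventP N1 (k0 N) homega (torus_gamma c xi k) x.
  by rewrite sE gE.
apply: cvg_matrix => j k.
under eq_cvg do rewrite mxE.
rewrite mxE; apply: cvgB; last first.
  apply: cvgM; first exact: cvg_cst.
  rewrite Cinner_gam.
  have [a1 a2] := aF k (fun N => Re \o ph k N) (fun N => Im \o ph k N)
    (fun N N1 x => (spec k N N1 x).1) (fun N N1 x => (spec k N N1 x).2) j.
  have [d1 d2] := res_dom k.
  have inE N : (1 < N)%N -> torus_inner (torus_gamma c xi j) (ph k N) =
     (- tavg (fun x => pull tau xi (sq j) x * tgr (fun j => pull tau xi (sq j)) j (Re \o ph k N) x))
     +i* (- tavg (fun x => pull tau xi (sq j) x * tgr (fun j => pull tau xi (sq j)) j (Im \o ph k N) x)).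
    by move=> N1; rewrite (funext (fun x => gE N j x N1)) torus_innerE -!tgamma_adj.
  apply: cvg_complex => /=.
    rewrite Ex_gam//; apply: cvg_trans (cvgN a1); apply: near_eq_cvg.
    by exists 2 => // N /= N1; rewrite fctE -/(ph k N) inE.
  rewrite Ex_gam//; apply: cvg_trans (cvgN a2); apply: near_eq_cvg.
  by exists 2 => // N /= N1; rewrite fctE -/(ph k N) inE.
case: (j == k); last by rewrite !mulr0n; exact: cvg_cst.
rewrite !mulr1n; apply: cvg_complex => /=; last first.
  rewrite (_ : (fun _ => _) = fun=> 0); first exact: cvg_cst.
  by apply/funext => N; rewrite torus_meanE /= tavg_cst.
(* Forward and backward conductances have the same mean, on [Omega] by stationarity and on the torus
   by a shift. *)
have -> : \int[P]_x env_c c x 0 j = Ex (cnd j) + Ex (cnd j).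
  have Lc := cnd_L2 hc hc2 j.
  have Lcj := L2_comp htau hstat (- unitv j) Lc.
  rewrite -[X in _ + X](Ex_comp htau hstat (- unitv j)); last exact: L2_int1.
  rewrite -ExD; [|exact: L2_int1..]; apply: eq_Ex => x.
  by rewrite /env_c mxE (cndN hc hcov).
apply: cvg_trans (cvgD (aC j) (aC j)); apply: near_eq_cvg.
exists 2 => // N /= N1; rewrite fctE torus_meanE /= /oavg -[X in _ + X](tavg_shiftN j) -tavgD.
by apply: eq_tavg => x; rewrite /= ctorus_unitv ?ctorus_opp// !kapE.
Qed.

(** Testing the equations for [h_j] with the parts of [h_k], and conversely, turns the real part of
    [<gamma_j, h_k>] into the form of the real parts plus that of the imaginary parts, and its
    imaginary part into [- omega] times the sum of the inner products. Both are symmetric in [j] and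
    [k]. *)
Lemma limit_mobility_sym : (limit_mobility P c L omega)^T = limit_mobility P c L omega.
Proof.
apply/matrixP => j k; rewrite !mxE; congr (_ - 2 * _).
  by have [->|] := eqVneq k j; rewrite ?mulr0n.
have [dj1 dj2] := res_dom j; have [dk1 dk2] := res_dom k.
have [q qE] : exists q : (Omega -> R) -> (Omega -> R) -> R, forall f g, q f g = Ex (fun x => f x * g x).
  by eexists.
have [F FE] : exists F, F = form P tau c by eexists.
have CE a b : Cinner P (env_gammaC c a) (res b) = q (gam a) (res1 b) +i* q (gam a) (res2 b).
  by rewrite !qE; exact: Cinner_gam.
have W g : domE g -> forall i, q (gam i) g = F (res1 i) g - omega * q (res2 i) g.
  by move=> dg i; rewrite !qE FE Ex_gam// -res_weak1.
have W2 g : domE g -> forall i, F (res2 i) g + omega * q (res1 i) g = 0.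
  by move=> dg i; rewrite qE FE res_weak2.
have qC f g : q f g = q g f by rewrite !qE; apply: eq_Ex => x; rewrite mulrC.
have fC f g : F f g = F g f by rewrite FE; exact: formC.
rewrite -/(res j) -/(res k) !CE; congr (_ +i* _).
  rewrite (W _ dj1) (W _ dk1) (fC (res1 j)); congr (_ - _).
  have := W2 _ dj2 k; have := W2 _ dk2 j.
  rewrite (fC (res2 j)) (qC (res2 k)) (qC (res2 j)); lra.
rewrite (W _ dj2) (W _ dk2) (qC (res2 k)); congr (_ - _).
have := W2 _ dj1 k; have := W2 _ dk1 j.
rewrite (fC (res2 j) (res1 k)) (fC (res2 k) (res1 j)) (qC (res1 k)); lra.
Qed.

End Mobility.

Lemma env_gammaE (disp : measure_display) (Omega : measurableType disp) (R : realType) (d : nat) (c : 'rV[int]_d -> 'rV[int]_d -> Omega -> R) xi :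
  env_gamma c xi = \sum_(z \in nbr d) c 0 z xi *: map_mx intr z.
Proof.
rewrite big_nbr; apply/rowP => i; rewrite !mxE summxE (bigD1 i)//= big1 => [|j ji].
  by rewrite !mxE !eqxx !mulr1 addr0 mulrN1z mulrN mulr1.
by rewrite !mxE (eq_sym i) (negPf ji) !mulr0z !mulr0 addr0.
Qed.

(** * The semigroup formula *)

Section Calculus.
Context {R : realType}.
Implicit Types f F m dm : R -> R.

Lemma within_continuous_of_uniform t f :
  (forall e, 0 < e -> exists2 dl, 0 < dl & forall s s', 0 <= s -> s <= t -> 0 <= s' -> s' <= t ->
     `|s' - s| < dl -> `|f s' - f s| < e) ->
  {within `[0, t], continuous f}.
Proof.
move=> h; apply/subspace_continuousP => x /=; rewrite in_itv /= => /andP[x0 xt].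
apply/cvgrPdist_lt => e e0; have [dl dl0 hdl] := h e e0.
rewrite near_withinE; near=> y => /=; rewrite in_itv /= => /andP[y0 yt].
rewrite distrC; apply: hdl => //; rewrite distrC; near: y.
Unshelve. all: by end_near.
Qed.

Lemma le_of_derive_le (a b : R) m dm (k : R) : a <= b ->
  (forall s : R, a < s -> s < b -> is_derive s 1 m (dm s)) ->
  {within `[a, b], continuous m} -> (forall s, a < s -> s < b -> dm s <= k) ->
  m b - m a <= k * (b - a).
Proof.
rewrite le_eqVlt => /orP[/eqP <-|ab] hd hc hk; first by rewrite !subrr mulr0.
have hd' s : s \in `]a, b[ -> is_derive s 1 m (dm s).
  by rewrite in_itv /= => /andP[]; exact: hd.
have [s + ->] := MVT ab hd' hc.
rewrite in_itv /= => /andP[h1 h2]; rewrite ler_wpM2r ?subr_ge0 ?(ltW ab)// hk//.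
Qed.

(* Barbalat: [m] decreases by a fixed amount on every interval where [F] is not small. *)
Lemma barbalat m dm F (C : R) : 0 < C ->
  (forall s : R, 0 < s -> is_derive s 1 m (dm s)) ->
  (forall t : R, {within `[0, t], continuous m}) ->
  (forall s, 0 <= m s) ->
  (forall s : R, 0 < s -> F s ^+ 2 <= C * - dm s) ->
  (forall e : R, 0 < e -> exists2 dl : R, 0 < dl &
     forall s r : R, 0 < s -> 0 <= r -> r < dl -> `|F (s + r) - F s| < e) ->
  F s @[s --> +oo] --> 0.
Proof.
move=> C0 hd hcont m0 hF hu.
have dm0 s : 0 < s -> dm s <= 0.
  by move=> s0; rewrite -oppr_ge0 -(pmulr_rge0 _ C0) (le_trans _ (hF _ s0))// sqr_ge0.
have sub a b : 0 <= a -> {within `[a, b], continuous m}.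
  move=> a0; apply: continuous_subspaceW (hcont b) => x /=; rewrite !in_itv /= => /andP[h1 h2].
  by rewrite h2 (le_trans a0).
have mono a b : 0 <= a -> a <= b -> m b <= m a.
  move=> a0 ab; rewrite -subr_le0 -[leRHS](mul0r (b - a)).
  apply: (le_of_derive_le ab) (sub _ _ a0) _ => s as_ _; first by apply: hd; exact: le_lt_trans as_.
  by apply: dm0; exact: le_lt_trans as_.
apply/cvgrPdist_le => e e0.
have [dl dl0 hdl] := hu (e / 2) (divr_gt0 e0 (ltr0Sn R 1)).
(* While [|F| >= e / 2], the derivative of [m] is at most [- (e / 2) ^ 2 / C]; [ka] is the resulting
   drop over a time [dl / 2]. From [S0] on, [m] is within [ka] of its infimum, so no such drop is
   left. *)
pose ka : R := (e / 2) ^+ 2 / C * (dl / 2).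
have ka0 : 0 < ka by rewrite mulr_gt0 ?divr_gt0 ?exprn_gt0 ?divr_gt0.
have hinf : has_inf [set m s | s in [set s : R | 0 <= s]].
  by split; [exists (m 0), 0 => /=|exists 0 => _ [s _ <-]].
have [_ [S0 /= S00 <-] hS] := inf_adherent ka0 hinf.
have drop s : S0 <= s -> m S0 - m s < ka.
  move=> Ss; have : inf [set m s | s in [set s : R | 0 <= s]] <= m s.
    by apply: inf_lbound; [exact: hinf.2|exists s => //=; exact: le_trans Ss].
  move: hS; lra.
exists (S0 + 1); split; first exact: num_real.
move=> s /= Ss; rewrite sub0r normrN leNgt; apply/negP => hbig.
have s0 : 0 < s by lra.
have dl2 : 0 < dl / 2 by rewrite divr_gt0.
have : m (s + dl / 2) - m s <= - ((e / 2) ^+ 2 / C) * (s + dl / 2 - s).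
  apply: le_of_derive_le.
  - by rewrite lerDl ltW.
  - by move=> r sr _; apply: hd; exact: lt_trans sr.
  - by apply: sub; exact: ltW.
  - move=> r sr rs.
    have r0 : 0 < r by exact: lt_trans sr.
    rewrite lerNr ler_pdivrMr// [leRHS]mulrC; apply: le_trans (hF _ r0).
    have h : `|F r - F s| < e / 2.
      by rewrite -[in F r](subrKC s r); apply: hdl => //; lra.
    rewrite -[leRHS]real_normK ?num_real// ler_sqr ?nnegrE ?normr_ge0 ?divr_ge0 ?(ltW e0)//.
    have := lerB_dist (F s) (F r); rewrite distrC.
    by move: h hbig; lra.
rewrite addrAC subrr add0r mulNr -/ka.
have h1 := drop (s + dl / 2); have h2 := mono S0 s S00.
have := h1 _; have := h2 _; lra.
Qed.

End Calculus.

Lemma cvg_at_right0P (R : realType) (f : R -> R) : (forall s, 0 <= f s) ->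
  (f s @[s --> 0^'+] --> 0 <-> forall e : R, 0 < e -> exists2 dl : R, 0 < dl &
     forall s : R, 0 < s -> s < dl -> f s < e).
Proof.
move=> f0; split => [/cvgrPdist_lt h e e0|h].
  have /nbhs_ballP[dl /= dl0 hdl] := h e e0; exists dl => // s s0 sd.
  have := hdl s; rewrite /ball /= sub0r normrN gtr0_norm// => /(_ sd s0).
  by rewrite sub0r normrN ger0_norm.
apply/cvgrPdist_lt => e e0; have [dl dl0 hdl] := h e e0.
near=> s; rewrite sub0r normrN ger0_norm//; apply: hdl; near: s.
  exact: nbhs_right_gt.
exact: nbhs_right_lt.
Unshelve. all: by end_near.
Qed.

Section GeneratorDifference.
Context {R : realType} {V : lmodType R} (q : V -> V -> R) (T : R -> V -> V).
Hypotheses (hq : prehilbert q) (hT : semigroup q T).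

(** Puts the increment [T r X - X] of an orbit in the domain of the generator, so that [contraction]
    controls it at all later times. *)
Lemma generatesB F F' Z Z' : generates q T F Z -> generates q T F' Z' -> generates q T (F - F') (Z - Z').
Proof.
move=> h h' e e0; have e2 : 0 < e / 2 by rewrite divr_gt0.
have [d1 d10 hd1] := h _ e2; have [d2 d20 hd2] := h' _ e2.
exists (Num.min d1 d2); first by rewrite lt_min d10.
move=> s s0; rewrite lt_min => /andP[s1 s2].
set X := s^-1 *: (T s F - F) - Z; set Y := s^-1 *: (T s F' - F') - Z'.
have -> : qnorm q (s^-1 *: (T s (F - F') - (F - F')) - (Z - Z')) = qnorm q (X - Y).
  apply: (qnorm_eq hq).
  have -> : s^-1 *: (T s (F - F') - (F - F')) - (Z - Z') - (X - Y)
      = s^-1 *: (T s (F - F') - (T s F - T s F')).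
    have sub2 (x y u v : V) : x - y - (u - v) = x - u - (y - v) by rewrite opprD addrACA -opprD.
    have subC (x y w : V) : x - w - (y - w) = x - y by rewrite opprB addrA subrK.
    by rewrite (sub2 _ Z _ Z' : X - Y = _) subC -!scalerBr (sub2 (T s F)) subC.
  have := sgL hT (-1) F' F (ltW s0); rewrite scaleN1r [- F' + F]addrC scaleN1r [- _ + _]addrC => hh.
  by rewrite (qnormZ hq) hh mulr0.
apply: le_lt_trans (_ : _ <= qnorm q X + qnorm q Y) _.
  by have := qnorm_leD hq X 0 Y; rewrite subr0 sub0r (qnormN hq).
by rewrite (splitr e); apply: ltrD; [exact: hd1|exact: hd2].
Qed.

Lemma sg_step (s r : R) f : 0 <= s -> 0 <= r ->
  qnorm q (T (s + r) f - T s f) = qnorm q (T s (T r f - f)).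
Proof.
move=> s0 r0; rewrite (sgB hq hT)//; apply: (qnorm_eq hq).
by rewrite opprB addrA subrK (sgD hT).
Qed.

Lemma sgN u (s : R) f : 0 <= s -> q u (T s (- f)) = - q u (T s f).
Proof.
move=> s0; have nul x : qnorm q x = 0 -> q u x = 0.
  by move=> x0; apply/eqP; rewrite -normr_le0 (le_trans (ph_CSnorm hq _ _))// x0 mulr0.
have h0 : qnorm q (T s 0) = 0.
  by have := sgZ hq hT 0 0 s0; rewrite scale0r normr0 mul0r.
have /nul := sgL hT (-1) f 0 s0; rewrite addr0 !scaleN1r (phBr hq) (phDr hq) (phNr hq) (nul _ h0) addr0.
by move/eqP; rewrite subr_eq0 => /eqP.
Qed.

End GeneratorDifference.

Section SemigroupIntegral.
Context {disp : measure_display} {Omega : measurableType disp} {R : realType}.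
Context {d : nat}.
Variables (P : probability Omega R) (tau : 'rV[int]_d -> Omega -> Omega).
Variable c : 'rV[int]_d -> 'rV[int]_d -> Omega -> R.
Hypotheses (htau : is_action tau) (hstat : stationary P tau).
Hypotheses (hc : is_conductance c) (hcov : covariant tau c).
Hypothesis hc2 : forall z, nbr d z -> ('E_P[fun xi => (c 0 z xi ^+ 2)%R] < +oo)%E.
Variable L : (Omega -> R) -> (Omega -> R) -> Prop.
Hypothesis hL : is_dirichlet_operator P tau c L.
Variable omega : R.
Hypothesis homega : 0 < omega.
Variable T : R -> (Omega -> R[i]) -> Omega -> R[i].
Local Notation A := (operator_opp (iomega_sub P L omega)).
Hypothesis hT : is_semigroup_generated_by P A T.
Local Notation L2 := (L2 P).
Local Notation Ex := (Ex P).
Local Notation int1 := (int1 P).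
Local Notation cnd := (cnd c).
Local Notation sq := (sq c).
Local Notation gr := (gr tau c).
Local Notation domE := (domE P tau c).
Local Notation V := (LfunType P (lee1n 2)).
Local Notation H := {ffun bool -> V}.
Local Notation q := (@vinner _ _ _ P bool).
Local Notation gam := (gam c).
Implicit Types (F G Z : H) (f g : Omega -> R[i]).

(** A complex function is a pair of real ones indexed by [bool], [true] for the real part, so that
    the real theory of semigroups applies with [CL2norm] as the seminorm. *)
Definition cplx F : Omega -> R[i] := fun x => (F true : Omega -> R) x +i* (F false : Omega -> R) x.
Definition toH f : H := [ffun b : bool => toL P (if b then Re \o f else Im \o f)].
Definition Tr (s : R) F : H := toH (T s (cplx F)).

Lemma cplx_CL2 F : CL2 P (cplx F).
Proof. by split; exact: V_L2. Qed.

Lemma toHK f : CL2 P f -> cplx (toH f) = f.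
Proof.
move=> [h1 h2]; apply/funext => x; rewrite /cplx !ffunE !toLE//.
by apply/eqP; rewrite eq_complex /= !eqxx.
Qed.

Lemma cplx_lin (a : R) F G : cplx (a *: F + G) = fun x => a%:C * cplx F x + cplx G x.
Proof.
apply/funext => x; apply/eqP; rewrite eq_complex /cplx !ffunE /=.
by apply/andP; split; apply/eqP; rewrite mul0r ?subr0 ?addr0.
Qed.

Lemma cplxZ (a : R) F : cplx (a *: F) = fun x => a%:C * cplx F x.
Proof.
apply/funext => x; apply/eqP; rewrite eq_complex /cplx !ffunE /=.
by apply/andP; split; apply/eqP; rewrite mul0r ?subr0 ?addr0.
Qed.

Lemma cplxB F G : cplx (F - G) = fun x => cplx F x - cplx G x.
Proof. by apply/funext => x; rewrite /cplx !ffunE. Qed.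

Lemma qnorm_cplx F : qnorm q F = CL2norm P (cplx F).
Proof.
rewrite /qnorm /CL2norm /vinner big_bool /= -ExD; [|by apply: L2_mul; exact: V_L2..].
by congr Num.sqrt; apply: eq_Ex => x; rewrite /= !expr2.
Qed.

Lemma CL2norm_ae0 f g : CL2 P f -> CL2 P g -> {ae P, forall x, f x = g x} ->
  CL2norm P (fun x => f x - g x) = 0.
Proof.
move=> [f1 f2] [g1 g2] h; rewrite /CL2norm -[X in Num.sqrt X]/(Ex _).
have I : int1 (fun x => Re (f x - g x) ^+ 2 + Im (f x - g x) ^+ 2).
  have -> : (fun x => Re (f x - g x) ^+ 2 + Im (f x - g x) ^+ 2) =
    (fun x => (Re (f x) - Re (g x)) ^+ 2 + (Im (f x) - Im (g x)) ^+ 2).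
    by apply/funext => x; case: (f x) (g x) => a b [].
  by apply: int1D; apply/L2_sqr; apply: L2B.
rewrite (ae_eq_Ex (g := fun=> 0) I (int1_cst _ _)) ?Ex_cst ?sqrtr0//.
by apply: filterS h => x ->; rewrite subrr /= expr0n addr0.
Qed.

Lemma Tr_CL2 s F : 0 <= s -> CL2 P (T s (cplx F)).
Proof. by move=> s0; have [[h _ _] _] := hT; apply: h => //; exact: cplx_CL2. Qed.

Lemma cplxTr s F : 0 <= s -> cplx (Tr s F) = T s (cplx F).
Proof. by move=> s0; rewrite /Tr toHK//; exact: Tr_CL2. Qed.

Lemma Tr_semigroup : semigroup q Tr.
Proof.
case: hT => -[t1 t2 t3] [t4 t5 t6 t7]; split.
- move=> s a F G s0; rewrite qnorm_cplx cplxB; apply: CL2norm_ae0; [exact: cplx_CL2..|].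
  rewrite cplx_lin !cplxTr// cplx_lin.
  by apply: t2 => //; exact: cplx_CL2.
- move=> s s0; have [M hM] := t3 s s0; exists M => F.
  by rewrite !qnorm_cplx cplxTr// hM//; exact: cplx_CL2.
- move=> F; rewrite qnorm_cplx cplxB; apply: CL2norm_ae0; [exact: cplx_CL2..|].
  by rewrite cplxTr//; apply: t4; exact: cplx_CL2.
- move=> s t F s0 t0; rewrite qnorm_cplx cplxB; apply: CL2norm_ae0; [exact: cplx_CL2..|].
  rewrite !cplxTr ?addr_ge0//.
  by apply: t5 => //; exact: cplx_CL2.
- move=> F e e0; have /cvg_at_right0P h := t6 _ (cplx_CL2 F).
  have [dl dl0 hdl] := h (fun s => sqrtr_ge0 _) e e0; exists dl => // s s0 sd.
  by rewrite qnorm_cplx cplxB cplxTr ?(ltW s0)//; exact: hdl.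
Qed.

Lemma generatesE F G : generates q Tr F G <-> A (cplx F) (cplx G).
Proof.
case: hT => _ [_ _ _ /(_ _ _ (cplx_CL2 F) (cplx_CL2 G)) ->].
rewrite cvg_at_right0P; last by move=> s; exact: sqrtr_ge0.
by split => h e /h[dl dl0 hdl]; exists dl => // s s0 sd; have := hdl s s0 sd;
  rewrite qnorm_cplx cplxB cplxZ cplxB cplxTr// ltW.
Qed.

(** The skew part [- i omega] of the generator drops out of the real inner product with [F]; the
    form of [L] remains. *)
Lemma generates_dissip F Z : generates q Tr F Z ->
  (forall b, domE (F b)) /\ q F Z = - \sum_b form P tau c (F b) (F b).
Proof.
move=> /generatesE[w [w1 w2] aew].
have [d1 e1] := L_weak htau hstat hc hcov hL w1.
have [d2 e2] := L_weak htau hstat hc hcov hL w2.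
have [_ Lw1] := sa_L2 (L_selfadjoint hL) w1.
have [_ Lw2] := sa_L2 (L_selfadjoint hL) w2.
have a1 : {ae P, forall x, Re (w x) = - omega * (F false : V) x + (Z true : V) x}.
  apply: filterS aew => x /=; rewrite /cplx; case: (w x) => u v [h _] /=.
  by move: h => /=; lra.
have a2 : {ae P, forall x, Im (w x) = omega * (F true : V) x + (Z false : V) x}.
  apply: filterS aew => x /=; rewrite /cplx; case: (w x) => u v [_ h] /=.
  by move: h => /=; lra.
split; first by case.
rewrite !big_bool /= (e1 _ d1) (e2 _ d2) -!opprD opprK addrC /vinner big_bool /=.
have LF b : L2 (F b : V) by exact: V_L2.
have LZ b : L2 (Z b : V) by exact: V_L2.
rewrite -[LHS]ExD; [|exact: L2_mul..].
rewrite -[RHS]ExD; [|exact: L2_mul..].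
apply: ae_eq_Ex; [by apply: int1D; exact: L2_mul|by apply: int1D; exact: L2_mul|].
apply: filterS2 a1 a2 => x /= -> ->; rewrite /cplx /=; ring.
Qed.

Let hq := vinner_prehilbert P bool.
Let cq := @vinner_complete _ _ _ P bool.
Let hS := Tr_semigroup.

Lemma qnorm_near F G : `|qnorm q F - qnorm q G| <= qnorm q (F - G).
Proof.
have h1 := qnorm_leD hq F G 0; have h2 := qnorm_leD hq G F 0.
rewrite !subr0 in h1 h2; rewrite (qnorm_distC hq G) in h2.
by rewrite ler_norml; apply/andP; split; lra.
Qed.

Lemma functional_cont (t : R) G F : {within `[0, t], continuous (fun s => q G (Tr s F))}.
Proof.
apply: within_continuous_of_uniform => e e0.
have [t0|t0] := leP 0 t; last first.
  by exists 1 => // s s' s0 st; have := le_lt_trans (le_trans s0 st) t0; rewrite ltxx.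
have G1 : 0 < qnorm q G + 1 by rewrite ltr_wpDl ?qnorm_ge0.
have [dl dl0 hdl] := orbit_cont hq hS cq F t0 (divr_gt0 e0 G1).
exists dl => // s s' s0 st s'0 s't ss; rewrite -(phBr hq).
apply: (le_lt_trans (ph_CSnorm hq _ _)).
have := hdl s s' s0 st s'0 s't ss; rewrite ltr_pdivlMr//; apply: le_lt_trans.
by rewrite mulrC ler_wpM2l ?qnorm_ge0// lerDl.
Qed.

Lemma sqnorm_cont (t : R) F : {within `[0, t], continuous (fun s => q (Tr s F) (Tr s F))}.
Proof.
have hc0 : {within `[0, t], continuous (fun s => qnorm q (Tr s F))}.
  apply: within_continuous_of_uniform => e e0.
  have [t0|t0] := leP 0 t; last first.
    by exists 1 => // s s' s0 st; have := le_lt_trans (le_trans s0 st) t0; rewrite ltxx.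
  have [dl dl0 hdl] := orbit_cont hq hS cq F t0 e0.
  exists dl => // s s' s0 st s'0 s't ss.
  by apply: (le_lt_trans (qnorm_near _ _)); exact: hdl.
rewrite (_ : (fun s => q (Tr s F) (Tr s F)) = (fun s => qnorm q (Tr s F) * qnorm q (Tr s F))).
  by move=> x; apply: cvgM; exact: hc0.
by apply/funext => s; rewrite -expr2 (qnorm_sqr hq).
Qed.

Lemma Tr0 u F : q u (Tr 0 F) = q u F.
Proof.
apply/eqP; rewrite -subr_eq0 -(phBr hq) -normr_le0.
by rewrite (le_trans (ph_CSnorm hq _ _))// (sg0 hS) mulr0.
Qed.

Lemma orbit_drop F Z (s : R) : generates q Tr F Z -> 0 < s ->
  is_derive s 1 (fun s : R => q (Tr s F) (Tr s F) : R)
    (- (2 * \sum_b form P tau c (Tr s F b) (Tr s F b))).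
Proof.
move=> gF s0; have := orbit_sqr_is_derive hq hS cq s0 gF.
have [_ ->] := generates_dissip (generates_sg hq hS cq (ltW s0) gF).
by rewrite mulrN.
Qed.

(** The squared norm of the orbit has derivative minus twice the form. The domain of the generator
    is where the orbit is differentiable. *)
Lemma contraction F Z (s : R) : generates q Tr F Z -> 0 <= s -> qnorm q (Tr s F) <= qnorm q F.
Proof.
move=> gF s0.
rewrite -ler_sqr ?nnegrE ?qnorm_ge0// !(qnorm_sqr hq).
have t0 : q (Tr 0 F) (Tr 0 F) = q F F by rewrite Tr0 (phC hq) Tr0.
rewrite -t0 -subr_le0 -[leRHS](mul0r (s - 0)).
apply: (@le_of_derive_le _ 0 s (fun s => q (Tr s F) (Tr s F)) _ 0 s0 _ (@sqnorm_cont s F)).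
  by move=> r r0 _; exact: (orbit_drop gF r0).
by move=> r r0 _; rewrite oppr_le0 mulr_ge0// sumr_ge0// => b _; exact: form_ge0.
Qed.

(** As [gamma_j] is real, the two parts of the complex inner product with it are semi-inner products
    with fixed vectors, to which the derivative of orbits applies. *)
Definition probe j b : H := [ffun b' : bool => toL P (if b' == b then gam j else (fun=> 0))].

Lemma gamL2 j : L2 (gam j). Proof. exact: (gam_L2 htau hstat hc hcov hc2). Qed.

Lemma probeE j b F : q (probe j b) F = Ex (fun x => gam j x * (F b : Omega -> R) x).
Proof.
have hL0 b' : L2 (if b' == b then gam j else (fun=> 0)).
  by case: ifP => _; [exact: gamL2|exact: L2_cst].
have z b' : (b' == b) = false -> Ex (fun x => (probe j b b' : Omega -> R) x * (F b' : Omega -> R) x) = 0.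
  by move=> e; rewrite -[RHS](Ex_cst P 0); apply: eq_Ex => x; rewrite ffunE toLE// e mul0r.
have o : Ex (fun x => (probe j b b : Omega -> R) x * (F b : Omega -> R) x) = Ex (fun x => gam j x * (F b : Omega -> R) x).
  by apply: eq_Ex => x; rewrite ffunE toLE// eqxx.
rewrite /vinner (bigD1 b)//= big1 ?addr0; first exact: o.
by move=> b' nb; apply: z; exact: negPf nb.
Qed.

Lemma Cinner_probe j F : Cinner P (env_gammaC c j) (cplx F) = q (probe j true) F +i* q (probe j false) F.
Proof. by rewrite Cinner_gam !probeE. Qed.

(** After integration by parts [gamma_j] sees only the gradient in direction [j], paired with
    [sq j], whose squared norm is [Ex (cnd j)]. *)
Lemma probe_sqr_le j b F Z : generates q Tr F Z ->
  q (probe j b) F ^+ 2 <= Ex (cnd j) * \sum_b form P tau c (F b) (F b).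
Proof.
move=> /generates_dissip[dF _]; rewrite probeE (Ex_gam htau hstat hc hcov hc2)// sqrrN.
apply: le_trans (Ex_CS (sq_L2 hc hc2 j) ((dF b).2 j)) _.
have -> : Ex (fun x => sq j x ^+ 2) = Ex (cnd j) by apply: eq_Ex => x; exact: sqr_sq.
apply: ler_wpM2l; first by apply: Ex_ge0 => x; exact/ltW/cnd_gt0.
rewrite (bigD1 b)//= {1}/form (bigD1 j)//= -addrA -[leLHS]addr0; apply: lerD; first by [].
rewrite addr_ge0 ?sumr_ge0// => [i _|b' _]; last exact: form_ge0.
by apply: Ex_ge0 => x; rewrite -expr2 sqr_ge0.
Qed.

Section Integral.
Variables (j k : 'I_d).
Let X : H := toH (res P c L omega k).
Let G : H := toH (env_gammaC c k).

Lemma res_CL2 : CL2 P (res P c L omega k).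
Proof. by have [[h1 _] [h2 _]] := res_dom htau hstat hc hcov hc2 hL homega k. Qed.

Lemma gamC_CL2 : CL2 P (env_gammaC c k).
Proof. by split; [exact: gamL2|exact: L2_cst]. Qed.

Lemma generates_res : generates q Tr X (- G).
Proof.
apply/generatesE; rewrite toHK; last exact: res_CL2.
have eqG : (fun x => - cplx (- G) x) = env_gammaC c k.
  have -> : cplx (- G) = fun x => - cplx G x by apply/funext => x; rewrite /cplx !ffunE.
  by rewrite toHK; [apply/funext => x; rewrite opprK|exact: gamC_CL2].
by rewrite /operator_opp eqG; exact: (res_solves htau hstat hc hcov hc2 hL homega k).
Qed.

Lemma probe_cvg0 b : q (probe j b) (Tr s X) @[s --> +oo] --> 0.
Proof.
have c0 : 0 <= Ex (cnd j) by apply: Ex_ge0 => x; exact/ltW/cnd_gt0.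
(* The squared norm decreases at twice the form, whence the division by 2; the [+ 1] makes the
   constant positive. *)
apply: (@barbalat R (fun s => q (Tr s X) (Tr s X))
   (fun s => - (2 * \sum_b form P tau c (Tr s X b) (Tr s X b))) _ ((Ex (cnd j) + 1) / 2)).
- by rewrite divr_gt0// ltr_wpDl.
- by move=> s s0; exact: orbit_drop generates_res s0.
- by move=> t; exact: sqnorm_cont.
- by move=> s; exact: ph_ge0.
- move=> s s0; apply: le_trans (probe_sqr_le j b (generates_sg hq hS cq (ltW s0) generates_res)) _.
  rewrite opprK mulrA divfK// ler_wpM2r ?lerDl// sumr_ge0// => b' _; exact: form_ge0.
- move=> e e0; set u := probe j b.
  have u1 : 0 < qnorm q u + 1 by rewrite ltr_wpDl ?qnorm_ge0.
  have [dl dl0 hdl] := sg_cvg hS X (divr_gt0 e0 u1).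
  exists dl => // s r s0; rewrite le_eqVlt => /orP[/eqP <- _|r0 rd].
    by rewrite addr0 subrr normr0.
  rewrite -(phBr hq); apply: (le_lt_trans (ph_CSnorm hq _ _)).
  rewrite (sg_step hq hS _ (ltW s0) (ltW r0)).
  (* Continuity uniform in [s]: the increment of the orbit at [s] is [T s (T r X - X)], and [T s]
     does not increase the norm of [T r X - X]. *)
  have gr := generatesB hq hS (generates_sg hq hS cq (ltW r0) generates_res) generates_res.
  have h1 := contraction gr (ltW s0).
  apply: le_lt_trans (ler_wpM2l (qnorm_ge0 _ _) h1) _.
  have := hdl r r0 rd; rewrite ltr_pdivlMr//; apply: le_lt_trans.
  by rewrite mulrC ler_wpM2l ?qnorm_ge0// lerDl.
Qed.

(** [X] generates [- G], so [- q u (T s X)] is an antiderivative of [q u (T s G)] at positive times;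
    at 0 continuity suffices. *)
Lemma probe_integral b (S : R) : 0 < S ->
  \int[lebesgue_measure]_(s in `[0, S]) q (probe j b) (Tr s G) =
  q (probe j b) X - q (probe j b) (Tr S X).
Proof.
move=> S0; set u := probe j b.
have hder (s : R) : 0 < s -> is_derive s 1 (fun s : R => - q u (Tr s X) : R) (q u (Tr s G)).
  move=> s0; have := orbit_is_derive hq hS cq u s0 generates_res.
  by rewrite (sgN hq hS)// ?(ltW s0)// => h; rewrite -[X in is_derive _ _ _ X]opprK; exact: is_deriveN.
have hcX : {within `[0, S], continuous (fun s : R => - q u (Tr s X) : R)}.
  by move=> x; apply: cvgN; exact: functional_cont.
have [_ c1 c2] := (continuous_within_itvP _ S0).1 hcX.
rewrite /Rintegral (continuous_FTC2 (F := fun s : R => - q u (Tr s X) : R) S0).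
- by rewrite -EFinB /= opprK Tr0 addrC.
- exact: functional_cont.
- split => // s; rewrite in_itv /= => /andP[s0 _]; by have [] := hder s s0.
- move=> s; rewrite in_itv /= => /andP[s0 _]; rewrite derive1E; by have [] := hder s s0.
Qed.

Lemma semigroup_integral_cvg :
  let J (S : R) : R[i]^o := Cintegral lebesgue_measure `[0, S]
    (fun s => Cinner P (env_gammaC c j) (T s (env_gammaC c k))) in
  J S @[S --> +oo] --> (Cinner P (env_gammaC c j) (res P c L omega k) : R[i]^o).
Proof.
move=> J.
rewrite -[res P c L omega k]toHK; last exact: res_CL2.
rewrite Cinner_probe -/X.
have E (s : R) : 0 <= s -> Cinner P (env_gammaC c j) (T s (env_gammaC c k)) =
   q (probe j true) (Tr s G) +i* q (probe j false) (Tr s G).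
  by move=> s0; rewrite -Cinner_probe cplxTr// toHK//; exact: gamC_CL2.
have lim_ b : q (probe j b) X - q (probe j b) (Tr S X) @[S --> +oo] --> q (probe j b) X.
  rewrite -[X in _ --> X]subr0; apply: cvgB; [exact: cvg_cst|exact: probe_cvg0].
apply: cvg_complex => /=.
  apply: cvg_trans (lim_ true); apply: near_eq_cvg; near=> S.
  have S0 : 0 < S by near: S; exact: nbhs_pinfty_gt.
  rewrite -probe_integral//; apply: eq_Rintegral => s; rewrite inE /= in_itv /= => /andP[s0 _].
  exact: esym (congr1 Re (E s s0)).
apply: cvg_trans (lim_ false); apply: near_eq_cvg; near=> S.
have S0 : 0 < S by near: S; exact: nbhs_pinfty_gt.
rewrite -probe_integral//; apply: eq_Rintegral => s; rewrite inE /= in_itv /= => /andP[s0 _].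
exact: esym (congr1 Im (E s s0)).
Unshelve. all: by end_near.
Qed.

End Integral.

End SemigroupIntegral.

Theorem theorem2p3 (R : realType) (d : nat) (hd : (0 < d)%N)
  (disp : measure_display) (Omega : measurableType disp)
  (P : probability Omega R)
  (tau : 'rV[int]_d -> Omega -> Omega)
  (c : 'rV[int]_d -> 'rV[int]_d -> Omega -> R)
  (omega : R) (homega : 0 < omega)
  (htau : is_action tau)
  (hstat : stationary P tau) (herg : ergodic P tau)
  (hsep : CL2_separable P)
  (hc : is_conductance c) (hcov : covariant tau c)
  (hc2 : forall z, nbr d z -> ('E_P[fun xi => (c 0 z xi ^+ 2)%R] < +oo)%E)
  (L : (Omega -> R) -> (Omega -> R) -> Prop)
  (hL : is_dirichlet_operator P tau c L) :
  [/\ {ae P, forall xi : Omega,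
        torus_mobility c N xi omega @[N --> \oo] --> limit_mobility P c L omega},
      (limit_mobility P c L omega)^T = limit_mobility P c L omega,
      forall xi, env_gamma c xi = \sum_(z \in nbr d) c 0 z xi *: map_mx intr z &
      forall T, is_semigroup_generated_by P (operator_opp (iomega_sub P L omega)) T ->
      forall j k : 'I_d,
        let J (S : R) : R[i]^o := Cintegral lebesgue_measure `[0, S]
              (fun s => Cinner P (env_gammaC c j) (T s (env_gammaC c k))) in
        cvg (J S @[S --> +oo]) /\
        limit_mobility P c L omega j k =
          mean_env_c P c j *+ (j == k) - 2 * lim (J S @[S --> +oo])].
Proof.
split.
- exact: (mobility_cvg htau hstat hc hcov hc2 hL homega herg).
- exact: (limit_mobility_sym htau hstat hc hcov hc2 hL homega).
- by move=> xi; exact: env_gammaE.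
move=> T hT j k J.
have hJ : J S @[S --> +oo] --> (Cinner P (env_gammaC c j) (res P c L omega k) : R[i]^o).
  exact: (semigroup_integral_cvg htau hstat hc hcov hc2 hL homega hT).
split; first by apply/cvg_ex; eexists; exact: hJ.
by rewrite (cvg_lim (@norm_hausdorff _ _) hJ) mxE.
Qed.
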